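(* Let $k$, $\varphi:{\mathscr D}_t^\pm\to{\mathscr D}_s^\pm$, $b$, $a_1,\dots,a_d$, $u_{a_i}(s)$, $\mathbf V_{\mathfrak r}(s)$, $(M,D_t)$ and its direct image $(M_\varphi,D_s)$ be as in the context. For each $i=1,\dots,d$ let $\vec Y_{a_i,1}(t),\dots,\vec Y_{a_i,\mathfrak r}(t)$ be an optimal basis of horizontal elements of $(M,D_t)$ at $a_i$, ordered so that $\mathcal R_{a_i}(\vec Y_{a_i,1})\le\dots\le\mathcal R_{a_i}(\vec Y_{a_i,\mathfrak r})$, and suppose these bases are linked. Let $\mathscr P$ be the resulting set of fundamental pairs and, for each $\mathcal P\in\mathscr P$, let $\mathscr U_{\mathcal P}$ be a set of discs chosen as in the context. Then: (1) for every $\mathcal P\in\mathscr P$ and every $\mathcal U\in\mathscr U_{\mathcal P}$, the vector $\mathbf V_{\mathfrak r}(s)\,v_{\mathcal P,\mathcal U,s}$ is (the coordinate vector of) a horizontal element of $(M_\varphi,D_s)$ at $b$, and its radius of convergence $\mathcal R_b\big(\mathbf V_{\mathfrak r}(s)\,v_{\mathcal P,\mathcal U,s}\big)$ equals the radius $\rho$ of the open disc $\varphi(\mathcal U)={\mathscr D}_s(b,\rho^-)$; (2) the family $\{\mathbf V_{\mathfrak r}(s)\,v_{\mathcal P,\mathcal U,s}:\ \mathcal U\in\mathscr U_{\mathcal P},\ \mathcal P\in\mathscr P\}$ is an optimal basis of the space of horizontal elements of $(M_\varphi,D_s)$ at $b$.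
   Context: $k$ is an algebraically closed field complete for a non-archimedean absolute value $|\cdot|$ extending the $p$-adic absolute value of $\mathbb Q_p$. ${\mathscr D}_t(a,r^-)$, ${\mathscr D}_t(a,r)$ are the open and closed Berkovich discs of centre $a\in k$ and radius $r$ in coordinate $t$; $\mathcal O_t(a,r^-)$ is the ring of $\sum c_n(t-a)^n\in k[[t-a]]$ converging on $|t-a|<r$. ${\mathscr D}_t^\pm$ denotes the unit disc, either open ${\mathscr D}_t(0,1^-)$ or closed ${\mathscr D}_t(0,1)$, with ring of analytic functions $\mathcal O_t^\pm$; similarly in coordinate $s$. For $a\in k$ and $f\in k[[t-a]]$, $\mathcal R_a(f)=\sup\{r\in[0,1): f\in\mathcal O_t(a,r^-)\}$; for a vector of power series, $\mathcal R_a$ is the minimum over its components. $\eta_{a,r}$ denotes the maximal (Shilov) point of ${\mathscr D}_t(a,r)$, $\eta_{a,0}=a$. $\varphi:{\mathscr D}_t^\pm\to{\mathscr D}_s^\pm$ is a finite étale morphism of degree $d$ of unit discs (both open or both closed), written $s=f(t)$ with $f\in\mathcal O_t^\pm$ ($f'$ invertible). $P(s,X)\in\mathcal O_s^\pm[X]$ is the unique monic polynomial of degree $d$ with $P(f(t),t)=0$. Fix $b\in{\mathscr D}_s^\pm(k)$ and let $\varphi^{-1}(b)=\{a_1,\dots,a_d\}$ (distinct). For each $i$, $u_{a_i}(s)\in k[[s-b]]$ is the power series with constant term $a_i$ and $P(s,u_{a_i}(s))=0$ (it has positive radius of convergence). $\mathbf U(s)$ is the $d\times d$ matrix with $(i,j)$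 entry $u_{a_i}(s)^{j-1}$, $\mathbf V(s)=\mathbf U(s)^{-1}$, and $\mathbf V_{\mathfrak r}(s)$ is the $\mathfrak r d\times\mathfrak r d$ block diagonal matrix with $\mathfrak r$ diagonal blocks equal to $\mathbf V(s)$. A differential module $(M,D_t)$ of rank $\mathfrak r$ is a free $\mathcal O_t^\pm$-module $M$ of rank $\mathfrak r$ with a $k$-linear $D_t:M\to M$ satisfying $D_t(gm)=\frac{dg}{dt}m+gD_t(m)$. Fix a basis $e_1,\dots,e_{\mathfrak r}$. For $a\in{\mathscr D}_t^\pm(k)$, a horizontal element at $a$ is an element of the kernel of $D_t$ on $M\otimes\mathcal O_t(a,r^-)$ for some $r>0$, identified with its coordinate vector in $k[[t-a]]^{\mathfrak r}$; its radius of convergence is $\mathcal R_a$ of that vector. These form a $k$-space of dimension $\mathfrak r$. The multiradius at $a$ is $(\mathcal R_1,\dots,\mathcal R_{\mathfrak r})$ with $\mathcal R_i=\sup\{r\in(0,1]:\dim_k\ker(D_t|M\otimes\mathcal O_t(a,r^-))\ge\mathfrak r-i+1\}$; a basis of horizontal elements at $a$ is optimal if its radii of convergence can be rearranged to give the multiradius. The direct image $(M_\varphi,D_s)$ is $M$ viewed as an $\mathcal O_s^\pm$-module via $s=f(t)$, with $D_s(m)=\frac1{f'(t)}D_t(m)$; it is a differential module of rank $\mathfrak rd$ with basis $e_1,te_1,\dots,t^{d-1}e_1,e_2,\dots,t^{d-1}e_{\mathfrak r}$ (so position $(j-1)d+l+1$ corresponds to $t^le_j$). Horizontal elements of $M_\varphi$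 at $b$ and their radii are defined likewise, identified with coordinate vectors in $k[[s-b]]^{\mathfrak rd}$. Tree and branches: for $a\in{\mathscr D}_t^\pm(k)$, $l_{t,a}=\{\eta_{a,r}\}$ with $r\in[0,1)$ (open case) or $r\in[0,1]$ (closed case); $\mathbb T_{\varphi,b}=\bigcup_i l_{t,a_i}$. A point $\eta\in\mathbb T_{\varphi,b}$ is branching if $\mathbb T_{\varphi,b}\setminus\{\eta\}$ has more than two connected components; $\mathcal B_{\varphi,b}$ is the set of branching points. A branch at $\eta\in\mathcal B_{\varphi,b}$ is an open disc which is a connected component of ${\mathscr D}_t^\pm\setminus\{\eta\}$ meeting $\mathbb T_{\varphi,b}$; $\delta(\eta)$ is the number of branches at $\eta$. Linked bases: optimal bases $\vec Y_{a_i,1},\dots,\vec Y_{a_i,\mathfrak r}$ ($i=1,\dots,d$) are linked if whenever $|a_j-a_i|<\mathcal R_{a_i}(\vec Y_{a_i,l})$, the element $\vec Y_{a_i,l}$ (which is then also a horizontal element at $a_j$) equals one of $\vec Y_{a_j,1},\dots,\vec Y_{a_j,\mathfrak r}$. Fundamental pairs: for each $i,j$, with $r_{i,j}=\mathcal R_{a_i}(\vec Y_{a_i,j})$, the pair $(\vec Y_{a_i,j},{\mathscr D}_t(a_i,r_{i,j}^-))$; $\mathscr P$ is the set of distinct such pairs. For $\mathcal P=(\vec Y,U)\in\mathscr P$, $\mathcal B_{\varphi,b}(\mathcal P)=U\cap\mathcal B_{\varphi,b}$; for each $\eta\in\mathcal B_{\varphi,b}(\mathcal P)$ choose any set $\mathscr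 U_\eta$ of $\delta(\eta)-1$ branches at $\eta$, and let $\mathscr U_{\mathcal P}$ consist of $U$ together with all these chosen branches. For $\mathcal U\in\mathscr U_{\mathcal P}$, $v_{\mathcal P,\mathcal U,s}\in k[[s-b]]^{\mathfrak rd}$ is the vector whose entry in position $(l-1)d+i$ ($1\le l\le\mathfrak r$, $1\le i\le d$) is the $l$-th component of $\vec Y(u_{a_i}(s))$ if $a_i\in\mathcal U$, and $0$ otherwise. *)

(* Defs.v *)
From HB Require Import structures.
From mathcomp Require Import all_boot all_order all_algebra.
From mathcomp Require Import all_classical all_reals all_analysis.
Set Implicit Arguments. Unset Strict Implicit. Unset Printing Implicit Defensive.
Import Order.TTheory GRing.Theory Num.Theory.
Import numFieldNormedType.Exports.
Local Open Scope ring_scope.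
Local Open Scope classical_set_scope.

Definition nonarch_complete_abs {R : realType} {k : fieldType}
    (abs : k -> R) (p : nat) : Prop :=
  prime p /\
      (forall x, abs x = 0 <-> x = 0) /\
      (forall x, 0 <= abs x) /\
      (forall x y, abs (x * y) = abs x * abs y) /\
      (forall x y, abs (x + y) <= Num.max (abs x) (abs y)) /\
      abs (p%:R) = (p%:R)^-1 /\
      (forall u : nat -> k,
         (forall e : R, 0 < e -> exists N, forall m n, (N <= m)%N -> (N <= n)%N ->
              abs (u m - u n) < e) ->
         exists l, abs (u n - l) @[n --> \oo] --> (0 : R)).

(* Formal power series: a series  sum_n c n (X - a)^n  is its coefficient    *)
(* sequence c; the centre a is kept track of separately.                     *)
Definition ps (k : fieldType) := nat -> k.

Definition psC {k : fieldType} (c : k) : ps k := fun n => if n == 0%N then c else 0.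
Definition psX {k : fieldType} : ps k := fun n => if n == 1%N then 1 else 0.
Definition psadd {k : fieldType} (f g : ps k) : ps k := fun n => f n + g n.
Definition psmul {k : fieldType} (f g : ps k) : ps k :=
  fun n => \sum_(i < n.+1) f i * g (n - i)%N.
Definition pspow {k : fieldType} (f : ps k) (m : nat) : ps k := iter m (psmul f) (psC 1).
Definition psderiv {k : fieldType} (f : ps k) : ps k := fun n => f n.+1 *+ n.+1.
(* formal composition g(h), used only when h 0 = 0 *)
Definition pscomp {k : fieldType} (g h : ps k) : ps k :=
  fun n => \sum_(m < n.+1) g m * pspow h m n.

Definition ksum_to {R : realType} {k : fieldType} (abs : k -> R) (s : nat -> k) (l : k) :=
  abs (\sum_(i < n) s i - l) @[n --> \oo] --> (0 : R).
Definition ksum {R : realType} {k : fieldType} (abs : k -> R) (s : nat -> k) : k :=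
  xget 0 [set l | ksum_to abs s l].

Definition reexp {R : realType} {k : fieldType} (abs : k -> R) (f : ps k) (h : k) : ps k :=
  fun m => ksum abs (fun n => f (n + m)%N *+ binomial (n + m) m * h ^+ n).
Definition evalps {R : realType} {k : fieldType} (abs : k -> R) (f : ps k) (x : k) : k :=
  ksum abs (fun n => f n * x ^+ n).
(* composition g(f(t)) of a function g of s (centred at 0) with f (centred at 0) *)
Definition comp_an {R : realType} {k : fieldType} (abs : k -> R) (g f : ps k) : ps k :=
  pscomp (reexp abs g (f 0%N)) (psadd f (psC (- f 0%N))).

Definition conv_on {R : realType} {k : fieldType} (abs : k -> R) (f : ps k) (rho : R) :=
  forall sg : R, 0 <= sg < rho -> abs (f n) * sg ^+ n @[n --> \oo] --> (0 : R).
(* cl = true : closed unit disc, cl = false : open unit disc *)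
Definition analytic {R : realType} {k : fieldType} (abs : k -> R) (cl : bool) (f : ps k) :=
  if cl then abs (f n) @[n --> \oo] --> (0 : R) else conv_on abs f 1.
Definition in_disc {R : realType} {k : fieldType} (abs : k -> R) (cl : bool) (x : k) :=
  if cl then abs x <= 1 else abs x < 1.

Definition radius {R : realType} {k : fieldType} (abs : k -> R) (f : ps k) : R :=
  sup [set rho : R | 0 <= rho < 1 /\ conv_on abs f rho].
Definition vrad {R : realType} {k : fieldType} {I : finType} (abs : k -> R)
    (Y : I -> ps k) : R :=
  \big[Num.min/1]_(c : I) radius abs (Y c).

(* Differential modules, given in a fixed basis (e_c)_{c : I} by the matrix  *)
(* G of D(e_c') = sum_c G c c' e_c, entries analytic, centred at 0.          *)
Definition horizontal {R : realType} {k : fieldType} {I : finType} (abs : k -> R)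
    (G : I -> I -> ps k) (a : k) (Y : I -> ps k) : Prop :=
  (exists rho : R, 0 < rho /\ forall c, conv_on abs (Y c) rho) /\
  forall c n, psderiv (Y c) n + \sum_(c' : I) psmul (reexp abs (G c c') a) (Y c') n = 0.

Definition ps_indep {k : fieldType} {I : finType} {m : nat} (Ys : 'I_m -> I -> ps k) :=
  forall lam : 'I_m -> k, (forall c n, \sum_(i < m) lam i * Ys i c n = 0) ->
    forall i, lam i = 0.

Definition hor_spans {R : realType} {k : fieldType} {I : finType} (abs : k -> R)
    (G : I -> I -> ps k) (a : k) {m : nat} (Ys : 'I_m -> I -> ps k) :=
  forall Y, horizontal abs G a Y ->
    exists lam : 'I_m -> k, forall c n, Y c n = \sum_(i < m) lam i * Ys i c n.

(* multiradius, 0-based: mrad i = sup {rho in (0,1] : dim ker (D on M (x) O(a,rho^-)) >= rank - i} *)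
Definition mrad {R : realType} {k : fieldType} {I : finType} (abs : k -> R)
    (G : I -> I -> ps k) (a : k) (i : nat) : R :=
  sup [set rho : R | 0 < rho <= 1 /\
        exists Ys : 'I_(#|I| - i) -> I -> ps k,
          (forall m, horizontal abs G a (Ys m) /\ forall c, conv_on abs (Ys m c) rho)
          /\ ps_indep Ys].

Definition optimal_basis {R : realType} {k : fieldType} {I : finType} (abs : k -> R)
    (G : I -> I -> ps k) (a : k) {N : nat} (Ys : 'I_N -> I -> ps k) : Prop :=
  [/\ forall m, horizontal abs G a (Ys m), ps_indep Ys, hor_spans abs G a Ys &
      exists sg : 'I_N -> 'I_#|I|, bijective sg /\
        forall m, vrad abs (Ys m) = mrad abs G a (sg m)].

(* The tree T_{phi,b}. The point eta_{c,rho} (maximal point of D(c,rho)) is  *)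
(* represented by the pair (c, rho); open discs D(c, rho^-) by (c, rho).     *)
(* number of distinct open discs D(a_i, rho^-) contained in D(c, rho) *)
Definition ndiscs {R : realType} {k : fieldType} {d : nat} (abs : k -> R)
    (a : 'I_d -> k) (c : k) (rho : R) : nat :=
  #|[set i : 'I_d | (abs (a i - c) <= rho) &&
      [forall i' : 'I_d, (i' < i)%N ==> ~~ (abs (a i - a i') < rho)]]|.

Definition on_tree {R : realType} {k : fieldType} {d : nat} (abs : k -> R) (cl : bool)
    (a : 'I_d -> k) (c : k) (rho : R) : Prop :=
  0 <= rho /\ (if cl then (rho <= 1)%R else (rho < 1)%R) /\ exists i, abs (a i - c) <= rho.

(* eta_{c,rho} is a branching point: T minus eta has > 2 connected components:
   one upward component iff rho < 1, and one per open disc D(a_i,rho^-) in D(c,rho). *)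
Definition branching {R : realType} {k : fieldType} {d : nat} (abs : k -> R) (cl : bool)
    (a : 'I_d -> k) (c : k) (rho : R) : Prop :=
  0 < rho /\ on_tree abs cl a c rho /\ (2 < nat_of_bool (rho < 1)%R + ndiscs abs a c rho)%N.

Definition delta {R : realType} {k : fieldType} {d : nat} (abs : k -> R)
    (a : 'I_d -> k) (c : k) (rho : R) : nat := ndiscs abs a c rho.

Definition is_branch {R : realType} {k : fieldType} {d : nat} (abs : k -> R)
    (a : 'I_d -> k) (c : k) (rho : R) (U : k * R) : bool :=
  [&& U.2 == rho, abs (U.1 - c) <= rho & [exists i, abs (a i - U.1) < rho]].

Definition same_disc {R : realType} {k : fieldType} (abs : k -> R) (U V : k * R) : bool :=
  (U.2 == V.2) && (abs (U.1 - V.1) < U.2).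

Definition point_in {R : realType} {k : fieldType} (abs : k -> R) (c : k) (rho : R)
    (U : k * R) : bool :=
  (rho < U.2) && (abs (c - U.1) < U.2).

(* L is a valid choice of the family U_P, where U is the disc of the pair P *)
Definition valid_UP {R : realType} {k : fieldType} {d : nat} (abs : k -> R) (cl : bool)
    (a : 'I_d -> k) (U : k * R) (L : seq (k * R)) : Prop :=
  [/\ exists2 x, x \in L & same_disc abs x U,
      (forall n m, (n < size L)%N -> (m < size L)%N -> n <> m ->
         ~~ same_disc abs (nth U L n) (nth U L m)),
      (forall x, x \in L -> same_disc abs x U \/
         exists c rho, [/\ branching abs cl a c rho, point_in abs c rho U &
                           is_branch abs a c rho x]) &
      (forall c rho, branching abs cl a c rho -> point_in abs c rho U ->
         count (is_branch abs a c rho) L = (delta abs a c rho).-1)].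

(* the vector v_{P,U,s}, P = (i0, j0), indexed by (l, i) <-> position (l-1)d+i *)
Definition vvec {R : realType} {k : fieldType} {d r : nat} (abs : k -> R)
    (a : 'I_d -> k) (u : 'I_d -> ps k) (Y : 'I_d -> 'I_r -> 'I_r -> ps k)
    (P : 'I_d * 'I_r) (U : k * R) : 'I_r * 'I_d -> ps k :=
  fun li => if abs (a li.2 - U.1) < U.2 then
              pscomp (reexp abs (Y P.1 P.2 li.1) (a li.2 - a P.1))
                     (psadd (u li.2) (psC (- a li.2)))
            else (fun=> 0).

Definition Vr_mul {k : fieldType} {d r : nat} (V : 'I_d -> 'I_d -> ps k)
    (v : 'I_r * 'I_d -> ps k) : 'I_r * 'I_d -> ps k :=
  fun li n => \sum_(i' < d) psmul (V li.2 i') (v (li.1, i')) n.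

Definition image_disc {R : realType} {k : fieldType} (abs : k -> R) (f : ps k) (b : k)
    (U : k * R) (sg : R) : Prop :=
  forall y, (exists x, abs (x - U.1) < U.2 /\ evalps abs f x = y) <-> abs (y - b) < sg.

(* fundamental pairs (Y_{i,j}, D(a_i, r_ij^-)) and (Y_{i',j'}, D(a_i', r_i'j'^-)) coincide *)
Definition same_pair {R : realType} {k : fieldType} {d r : nat} (abs : k -> R)
    (a : 'I_d -> k) (Y : 'I_d -> 'I_r -> 'I_r -> ps k) (P Q : 'I_d * 'I_r) : Prop :=
  vrad abs (Y P.1 P.2) = vrad abs (Y Q.1 Q.2) /\
  abs (a Q.1 - a P.1) < vrad abs (Y P.1 P.2) /\
  forall c, reexp abs (Y P.1 P.2 c) (a Q.1 - a P.1) = Y Q.1 Q.2 c.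

(* Main.v *)
Require Import Defs.
From HB Require Import structures.
From mathcomp Require Import all_boot all_order all_algebra.
From mathcomp Require Import all_classical all_reals all_analysis.
From mathcomp Require Import ring lra zify.
Import Order.TTheory GRing.Theory Num.Theory.
Import numFieldNormedType.Exports.
Set Implicit Arguments. Unset Strict Implicit. Unset Printing Implicit Defensive.
Local Open Scope ring_scope.

(* For x in the disc, |f(x) - y| is the product of the |x - z| over the fibre f^-1(y); this gives
   the radius of the image of each disc and a lower bound for |f'|.

   An element Z of M_phi is determined by its pull-backs to the a_i. The pull-back of
   V_r v_{P,U} at a_i is Y_P (recentred at a_i) if a_i lies in U and 0 otherwise, so it is horizontal.
   It converges on phi(U): multiplying truncations of Y_P by polynomials that approximate the
   indicator function of U on the tube |f - b| <= |c|, one gets polynomials in t, whose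
   coordinates on 1, t, ..., t^(d-1) are analytic in s and, by Lagrange interpolation on the
   fibres, bounded independently of the approximation.

   On the discs attached to a fixed pair P = (Y, U_P), the incidence matrix between the chosen discs
   and the a_i in U_P is invertible, by descending through the branching points; hence the family is
   a basis. If a combination of the family converges on a disc of radius T > radius of phi(U), its
   pull-back to a_i in U converges on a disc larger than U. Either this disc exceeds U_P, and the
   coordinates on the solutions of P vanish by optimality at the a_i, or the coordinates are
   constant on it because the bases are linked; in both cases the coefficient at U vanishes. So the
   family is compatible with the filtration by radii of convergence, which amounts to optimality. *)

(** * The ring of formal power series *)

(** No analytic space is constructed: functions are coefficient sequences, and identities between
    them are checked on values at points of k. Passing from values back to coefficients needs enough
    points, hence the families of integral points at mutual distance 1, and radii |c| arbitrarily
    close to a given one, hence the roots of p.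

    The obstacle to convergence on phi(U) is that [V] and the branches [u i] may converge only on a
    much smaller disc, so the radius of the product cannot be read off its factors. The coordinates
    of a polynomial in t have no such defect, and the product is compared with them one coefficient
    at a time, where only formal estimates near b occur. Etaleness enters quantitatively: the
    Lagrange denominators on a fibre are at least |f'|, which is bounded below on the tube.

    That a member of the family converges no further than phi(U) gets no separate argument: it is
    the one-term case of the compatibility with the filtration. *)

Section PowerSeriesRing.
Variable k : fieldType.
Implicit Types f g h : ps k.

HB.instance Definition _ := gen_eqMixin (ps k).
HB.instance Definition _ := gen_choiceMixin (ps k).

Definition ps0 : ps k := fun=> 0.
Definition psopp f : ps k := fun n => - f n.

Lemma psaddA : associative (@psadd k).
Proof. by move=> f g h; apply/funext=> n; rewrite /psadd addrA. Qed.
Lemma psaddC : commutative (@psadd k).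
Proof. by move=> f g; apply/funext=> n; rewrite /psadd addrC. Qed.
Lemma psadd0 : left_id ps0 (@psadd k).
Proof. by move=> f; apply/funext=> n; rewrite /psadd add0r. Qed.
Lemma psaddN : left_inverse ps0 psopp (@psadd k).
Proof. by move=> f; apply/funext=> n; rewrite /psadd addNr. Qed.

HB.instance Definition _ :=
  GRing.isZmodule.Build (ps k) psaddA psaddC psadd0 psaddN.

Definition pstrunc N f : {poly k} := \poly_(i < N) f i.

(** Reduces the ring axioms of [ps k] to those of [{poly k}], one coefficient at a time. *)
Lemma psmul_trunc N f g n : (n < N)%N ->
  psmul f g n = (pstrunc N f * pstrunc N g)`_n.
Proof.
move=> nN; rewrite /psmul coefM; apply: eq_bigr => i _.
by rewrite !coef_poly (leq_ltn_trans (leq_ord i) nN) (leq_ltn_trans (leq_subr _ _) nN).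
Qed.

Lemma psmulC : commutative (@psmul k).
Proof.
by move=> f g; apply/funext=> n; rewrite !(psmul_trunc _ _ (ltnSn n)) mulrC.
Qed.

Lemma psmulA : associative (@psmul k).
Proof.
move=> f g h; apply/funext=> n.
change (\sum_(i < n.+1) f i * psmul g h (n - i)%N = \sum_(i < n.+1) psmul f g i * h (n - i)%N).
pose F := pstrunc n.+1 f; pose G := pstrunc n.+1 g; pose H := pstrunc n.+1 h.
transitivity ((F * (G * H))`_n).
  rewrite coefM; apply: eq_bigr => i _.
  by rewrite (@psmul_trunc n.+1) ?ltnS ?leq_subr// coef_poly ltn_ord.
rewrite mulrA coefM; apply: eq_bigr => i _.
by rewrite (@psmul_trunc n.+1)// [H`_ _]coef_poly ltnS leq_subr.
Qed.

Lemma psmul1 : left_id (psC 1) (@psmul k).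
Proof.
move=> f; apply/funext=> n; rewrite /psmul big_ord_recl /psC /= mul1r subn0.
by rewrite big1 ?addr0// => i _; rewrite mul0r.
Qed.

Lemma psmulDl : left_distributive (@psmul k) (@psadd k).
Proof.
move=> f g h; apply/funext=> n; rewrite /psmul /psadd -big_split /=.
by apply: eq_bigr => i _; rewrite mulrDl.
Qed.

Lemma psC1_neq0 : psC (1 : k) != 0 :> ps k.
Proof.
apply/eqP => /(congr1 (fun f : ps k => f 0%N)) /eqP.
by rewrite /psC /= oner_eq0.
Qed.

HB.instance Definition _ :=
  GRing.Zmodule_isComNzRing.Build (ps k) psmulA psmulC psmul1 psmulDl psC1_neq0.

Lemma psDE f g n : (f + g) n = f n + g n. Proof. by []. Qed.
Lemma psNE f n : (- f) n = - f n. Proof. by []. Qed.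
Lemma psBE f g n : (f - g) n = f n - g n. Proof. by []. Qed.
Lemma psME f g n : (f * g) n = \sum_(i < n.+1) f i * g (n - i)%N. Proof. by []. Qed.
Lemma ps0E n : (0 : ps k) n = 0. Proof. by []. Qed.
Lemma ps_sumE I r (P : pred I) (F : I -> ps k) n :
  (\sum_(i <- r | P i) F i) n = \sum_(i <- r | P i) F i n.
Proof. exact: (big_morph (fun f : ps k => f n)). Qed.
Lemma psMnE f m n : (f *+ m) n = f n *+ m.
Proof. by elim: m => //= m IH; rewrite !mulrS psDE IH. Qed.

Lemma psCM c f n : (psC c * f) n = c * f n.
Proof.
rewrite psME big_ord_recl /psC /= subn0 big1 ?addr0// => i _; by rewrite mul0r.
Qed.
Lemma psXM f n : (psX * f) n = if n is m.+1 then f m else 0.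
Proof.
rewrite psME; case: n => [|n]; first by rewrite big_ord1 /psX /= mul0r.
rewrite 2!big_ord_recl /psX /= mul0r mul1r add0r /bump /= subSS subn0.
by rewrite big1 ?addr0// => i _; rewrite mul0r.
Qed.
Lemma psM0 f g : (f * g) 0%N = f 0%N * g 0%N.
Proof. by rewrite psME big_ord1. Qed.

Lemma pspowE f m : pspow f m = f ^+ m.
Proof. by elim: m => //= m IH; rewrite exprS -IH. Qed.

Fact psC_add : additive (@psC k).
Proof.
move=> x y; apply/funext=> n; rewrite psBE /psC.
by case: eqP => _; rewrite ?subr0.
Qed.
HB.instance Definition _ := GRing.isAdditive.Build k (ps k) (@psC k) psC_add.
Fact psC_mul : multiplicative (@psC k).
Proof.
split=> // x y; apply/funext=> n; rewrite psCM /psC.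
by case: eqP => _; rewrite ?mulr0.
Qed.
HB.instance Definition _ := GRing.isMultiplicative.Build k (ps k) (@psC k) psC_mul.

Lemma psX_exp m n : (psX ^+ m : ps k) n = (n == m)%:R.
Proof.
elim: m n => [|m IH] n; first by rewrite expr0 /= /GRing.one /= /psC; case: eqP.
by rewrite exprS psXM; case: n => //= n; rewrite IH eqSS.
Qed.

Lemma ps_expn_lt h m n : h 0%N = 0 -> (n < m)%N -> (h ^+ m) n = 0.
Proof.
move=> h0; elim: m n => // m IH n nm; rewrite exprS psME big_ord_recl h0 mul0r add0r.
rewrite big1// => i _; rewrite IH ?mulr0// lift0; have := ltn_ord i; lia.
Qed.

Lemma ps_expn_diag h m : h 0%N = 0 -> (h ^+ m) m = h 1%N ^+ m.
Proof.
move=> h0; elim: m => // m IH; rewrite !exprS psME 2!big_ord_recl h0 mul0r add0r.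
rewrite lift0 subSS subn0 IH big1 ?addr0// => i _.
by rewrite ps_expn_lt ?mulr0// !lift0; have := ltn_ord i; lia.
Qed.

(** As h^m starts in degree m, the range of summation may exceed n. With a range independent of n,
    the composite is a polynomial in h and the ring laws apply to it. *)
Lemma pscompE N g h n : h 0%N = 0 -> (n < N)%N ->
  pscomp g h n = (\sum_(m < N) psC (g m) * h ^+ m) n.
Proof.
move=> h0 nN; rewrite ps_sumE /pscomp.
transitivity (\sum_(m < N | (m < n.+1)%N) (psC (g m) * h ^+ m) n).
  rewrite (big_ord_widen N (fun m => g m * pspow h m n) nN).
  by apply: eq_bigr => i _; rewrite psCM pspowE.
rewrite [RHS](bigID (fun m : 'I_N => (m < n.+1)%N)) /= [X in _ + X]big1 ?addr0// => i.
by rewrite -leqNgt psCM => ni; rewrite ps_expn_lt ?mulr0.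
Qed.

Lemma pscompD g1 g2 h : pscomp (g1 + g2) h = pscomp g1 h + pscomp g2 h.
Proof.
apply/funext=> n; rewrite psDE /pscomp -big_split /=.
by apply: eq_bigr => i _; rewrite psDE mulrDl.
Qed.
Lemma pscompN g h : pscomp (- g) h = - pscomp g h.
Proof.
apply/funext=> n; rewrite psNE /pscomp -sumrN.
by apply: eq_bigr => i _; rewrite psNE mulNr.
Qed.
Lemma pscomp0 h : pscomp 0 h = 0.
Proof. by apply/funext=> n; rewrite /pscomp big1// => i _; rewrite mul0r. Qed.
Lemma pscomp_sum I r (P : pred I) (F : I -> ps k) h :
  pscomp (\sum_(i <- r | P i) F i) h = \sum_(i <- r | P i) pscomp (F i) h.
Proof.
apply: (big_morph (fun g => pscomp g h)) => [? ?|]; [exact: pscompD|exact: pscomp0].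
Qed.

Lemma pscomp_monomial m c h : h 0%N = 0 ->
  pscomp (psC c * psX ^+ m) h = psC c * h ^+ m.
Proof.
move=> h0; apply/funext=> n.
have nN : (n < (maxn n m).+1)%N by rewrite ltnS leq_maxl.
rewrite (pscompE _ h0 nN) ps_sumE.
have mN : (m < (maxn n m).+1)%N by rewrite ltnS leq_maxr.
rewrite (bigD1 (Ordinal mN)) //= !psCM psX_exp eqxx mulr1 big1 ?addr0// => i /eqP im.
rewrite psCM psCM psX_exp; case: eqP => [e|_]; last by rewrite mulr0 mul0r.
by exfalso; apply: im; apply/val_inj.
Qed.
Lemma pscompC c h : h 0%N = 0 -> pscomp (psC c) h = psC c.
Proof. by move=> h0; have := @pscomp_monomial 0 c h h0; rewrite !expr0 !mulr1. Qed.

Lemma pscompM g1 g2 h : h 0%N = 0 ->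
  pscomp (g1 * g2) h = pscomp g1 h * pscomp g2 h.
Proof.
move=> h0; apply/funext=> n; rewrite psME.
pose S g : ps k := \sum_(m < n.+1) psC (g m) * h ^+ m.
transitivity ((S g1 * S g2) n); last first.
  rewrite psME; apply: eq_bigr => i _.
  by rewrite (@pscompE n.+1)// (@pscompE n.+1)// ltnS leq_subr.
rewrite mulr_suml ps_sumE.
under eq_bigr => i _ do rewrite mulr_sumr ps_sumE.
rewrite /pscomp.
have E (i j : nat) : (psC (g1 i) * h ^+ i * (psC (g2 j) * h ^+ j)) n =
    g1 i * g2 j * (h ^+ (i + j)) n.
  by rewrite mulrACA -rmorphM -exprD psCM.
under [RHS]eq_bigr => i _ do under eq_bigr => j _ do rewrite E.
transitivity (\sum_(m < n.+1) \sum_(i < m.+1) g1 i * g2 (m - i)%N * (h ^+ m) n).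
  by apply: eq_bigr => m _; rewrite psME mulr_suml pspowE.
transitivity (\sum_(m < n.+1) \sum_(i < n.+1 | (i < m.+1)%N)
    g1 i * g2 (m - i)%N * (h ^+ m) n).
  apply: eq_bigr => m _.
  by rewrite (big_ord_widen n.+1 (fun i => g1 i * g2 (m - i)%N * (h ^+ m) n)).
rewrite (exchange_big_dep xpredT) //=; apply: eq_bigr => i _.
rewrite -(big_mkord (fun m => (i < m.+1)%N) (fun m => g1 i * g2 (m - i)%N * (h ^+ m) n)).
rewrite (@big_cat_nat _ _ _ i) //=; last by rewrite ltnW.
rewrite big_nat_cond big1 ?add0r; last by move=> m /andP[/andP[_ mi]]; rewrite ltnS leqNgt mi.
rewrite -[index_iota i n.+1]/(index_iota (0 + i) n.+1) big_addn big_mkord.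
(* The product of the two truncated sums also contains pairs with i + j > n; there h^(i+j) has no
   term of degree n. *)
rewrite [RHS](bigID (fun j : 'I_n.+1 => (j < n.+1 - i)%N)) /= [X in _ = _ + X]big1 ?addr0; last first.
  by move=> j; rewrite -leqNgt => jn; rewrite ps_expn_lt ?mulr0//; lia.
rewrite (big_ord_widen_cond n.+1 (fun j => (i < (j + i).+1)%N)
  (fun j => g1 i * g2 (j + i - i)%N * (h ^+ (j + i)) n)) ?leq_subr//.
apply: eq_big => [j|j _]; first by rewrite ltnS leq_addl.
by rewrite addnK addnC.
Qed.

Lemma pscompX_exp g h m : h 0%N = 0 -> pscomp (g ^+ m) h = pscomp g h ^+ m.
Proof.
move=> h0; elim: m => [|m IH]; first by rewrite !expr0 pscompC.
by rewrite !exprS pscompM ?IH.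
Qed.

Lemma pscomp_coef0 g h : h 0%N = 0 -> pscomp g h 0%N = g 0%N.
Proof. by move=> h0; rewrite /pscomp big_ord1 /= /psC /= mulr1. Qed.


Lemma pscompA g h F : h 0%N = 0 -> F 0%N = 0 ->
  pscomp (pscomp g h) F = pscomp g (pscomp h F).
Proof.
move=> h0 F0; apply/funext=> n.
rewrite (pscompE _ F0 (ltnSn n)) (pscompE _ _ (ltnSn n)) ?pscomp_coef0//.
transitivity (pscomp (\sum_(m < n.+1) psC (g m) * h ^+ m) F n).
  rewrite (pscompE _ F0 (ltnSn n)) !ps_sumE; apply: eq_bigr => i _.
  by rewrite !psCM -pscompE.
rewrite pscomp_sum; congr (_ n); apply: eq_bigr => i _.
by rewrite pscompM// pscompC// pscompX_exp.
Qed.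

(** Triangularity: the coefficient of degree n of g(F) is g_n F_1^n plus terms in the g_i with i <
    n. *)
Lemma pscomp_inj0 g F : F 0%N = 0 -> F 1%N != 0 -> pscomp g F = 0 -> g = 0.
Proof.
move=> F0 F1 gF; apply/funext=> n; rewrite ps0E.
elim/ltn_ind: n => n IH; have := congr1 (fun f : ps k => f n) gF.
rewrite ps0E /pscomp big_ord_recr /= big1 ?add0r; last first.
  by move=> i _; rewrite IH ?mul0r.
rewrite pspowE ps_expn_diag// => /eqP; rewrite mulf_eq0 expf_eq0 (negPf F1) andbF orbF.
by move/eqP.
Qed.

Lemma psderivD f g : psderiv (f + g) = psderiv f + psderiv g.
Proof. by apply/funext=> n; rewrite psDE /psderiv psDE mulrnDl. Qed.
Lemma psderiv_sum I r (P : pred I) (F : I -> ps k) :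
  psderiv (\sum_(i <- r | P i) F i) = \sum_(i <- r | P i) psderiv (F i).
Proof.
apply: (big_morph (@psderiv k)) => [? ?|]; first exact: psderivD.
by apply/funext=> n; rewrite /psderiv mul0rn.
Qed.
Lemma psderivM f g : psderiv (f * g) = psderiv f * g + f * psderiv g.
Proof.
apply/funext=> n; rewrite /psderiv psDE !psME -sumrMnl.
have E : \sum_(i < n.+2) f i * g (n.+1 - i)%N *+ n.+1 =
   \sum_(i < n.+2) (f i *+ i) * g (n.+1 - i)%N + \sum_(i < n.+2) f i * (g (n.+1 - i)%N *+ (n.+1 - i)).
  rewrite -big_split /=; apply: eq_bigr => i _.
  by rewrite mulrnAl mulrnAr -mulrnDr subnKC// -ltnS.
rewrite E; congr (_ + _).
  rewrite big_ord_recl mulr0n mul0r add0r; apply: eq_bigr => i _.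
  by rewrite /bump /= subSS.
rewrite big_ord_recr /= subnn mulr0n mulr0 addr0; apply: eq_bigr => i _.
by rewrite subSn// -ltnS.
Qed.
Lemma psderivC c : psderiv (psC c) = 0 :> ps k.
Proof. by apply/funext=> n; rewrite /psderiv /psC /= mul0rn. Qed.
Lemma psderivX : psderiv psX = 1 :> ps k.
Proof. apply/funext=> n; change ((if n == 0%N then 1 else 0) *+ n.+1 = psC (1 : k) n).
by rewrite /psC; case: n => //= n; rewrite mul0rn. Qed.
Lemma psderiv_exp f m : psderiv (f ^+ m) = (f ^+ m.-1 * psderiv f) *+ m.
Proof.
elim: m => [|m IH]; first by rewrite expr0 psderivC mulr0n.
rewrite exprS psderivM IH; case: m {IH} => [|m]; first by rewrite expr0 !mulr0n mulr0 addr0 mulr1 mul1r.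
by rewrite /= mulrnAr mulrA -exprS [in RHS]mulrS mulrC.
Qed.

Lemma psderiv_comp g h : h 0%N = 0 ->
  psderiv (pscomp g h) = psderiv h * pscomp (psderiv g) h.
Proof.
move=> h0; apply/funext=> n; rewrite {1}/psderiv (pscompE _ h0 (ltnSn n.+1)).
rewrite -/(psderiv _ n) psderiv_sum big_ord_recl psderivM psderivC expr0 psderivC mul0r mulr0 !add0r.
transitivity ((psderiv h * \sum_(m < n.+1) psC (psderiv g m) * h ^+ m) n); last first.
  rewrite !psME; apply: eq_bigr => i _.
  by rewrite -pscompE// ltnS leq_subr.
rewrite mulr_sumr; congr (_ n); apply: eq_bigr => i _.
rewrite psderivM psderivC mul0r add0r psderiv_exp lift0 /=.
by rewrite [psC (psderiv g i)](raddfMn psC) mulrnAr mulrnAl mulrnAr; congr (_ *+ _); rewrite mulrA mulrC.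
Qed.

End PowerSeriesRing.

(** * Values of convergent power series *)

Section RealNull.
Variable R : realType.
Implicit Types u v : nat -> R.

(** A one-sided condition, limsup u <= 0, so that it passes to every smaller sequence; for
    nonnegative sequences it is convergence to 0. *)
Definition rnull u := forall e, 0 < e -> exists N, forall n, (N <= n)%N -> u n <= e.

Lemma rnullP u : (forall n, 0 <= u n) -> (u n @[n --> \oo] --> (0 : R))%classic <-> rnull u.
Proof.
move=> u0; split=> [/cvgrPdist_le h e e0|h].
  have [N _ hN] := h e e0; exists N => n Nn; have := hN n Nn.
  by rewrite sub0r normrN ger0_norm.
apply/cvgrPdist_le => e e0; have [N hN] := h e e0.
by exists N => // n Nn; rewrite sub0r normrN ger0_norm//; exact: hN.
Qed.

Lemma rnull_le u v : (forall n, u n <= v n) -> rnull v -> rnull u.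
Proof.
by move=> uv hv e /hv[N hN]; exists N => n /hN; apply: le_trans.
Qed.

Lemma rnullM u c : 0 <= c -> rnull u -> rnull (fun n => c * u n).
Proof.
(* Dividing by c + 1 instead of c covers c = 0. *)
move=> c0 hu e e0; have c1 : 0 < c + 1 by rewrite ltr_wpDl.
have [N hN] := hu (e / (c + 1)) (divr_gt0 e0 c1).
exists N => n /hN h; apply: (@le_trans _ _ (c * (e / (c + 1)))); first exact: ler_wpM2l.
by rewrite mulrCA ger_pMr// ler_pdivrMr// mul1r lerDl.
Qed.

Lemma rnull_max u v : rnull u -> rnull v -> rnull (fun n => Num.max (u n) (v n)).
Proof.
move=> hu hv e e0; have [N hN] := hu e e0; have [M hM] := hv e e0.
exists (maxn N M) => n; rewrite geq_max => /andP[/hN a /hM b].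
by rewrite ge_max a b.
Qed.

Lemma rnull_shift u m : rnull u -> rnull (fun n => u (n + m)%N).
Proof. by move=> hu e /hu[N hN]; exists N => n Nn; apply: hN; rewrite (leq_trans Nn)// leq_addr. Qed.
Lemma rnull_unshift u m : rnull (fun n => u (n + m)%N) -> rnull u.
Proof.
move=> hu e /hu[N hN]; exists (N + m)%N => n Nn.
by have := hN (n - m)%N; rewrite subnK; [apply; lia|lia].
Qed.

Lemma rnull_geom x : 0 <= x < 1 -> rnull (fun n => x ^+ n).
Proof.
move=> /andP[x0 x1]; apply/rnullP; first by move=> n; exact: exprn_ge0.
by apply: cvg_expr; rewrite ger0_norm.
Qed.

Lemma rnull_finite u N : (forall n, (N <= n)%N -> u n <= 0) -> rnull u.
Proof. by move=> h e e0; exists N => n /h un; apply: le_trans un (ltW e0). Qed.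

Lemma rnull_bounded u : rnull u -> exists2 B, 0 <= B & forall n, u n <= B.
Proof.
move=> /(_ 1 ltr01)[N hN].
exists (1 + \sum_(i < N) `|u i|); first by rewrite addr_ge0// sumr_ge0.
move=> n; have [nN|Nn] := ltnP n N; last first.
  by apply: le_trans (hN n Nn) _; rewrite lerDl sumr_ge0.
apply: le_trans (ler_norm _) _; rewrite (bigD1 (Ordinal nN)) //= addrCA lerDl.
by rewrite addr_ge0// sumr_ge0.
Qed.

Lemma le0_eps x : (forall e : R, 0 < e -> x <= e) -> x <= 0.
Proof. by move=> h; apply/ler_addgt0Pl => e /h; rewrite addr0. Qed.

(** In ultrametric estimates an arbitrarily small error enters through a maximum, not through a
    sum. *)
Lemma le_eps x y : (forall e : R, 0 < e -> x <= Num.max y e) -> 0 <= y -> x <= y.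
Proof.
move=> h y0; rewrite leNgt; apply/negP => yx.
have yx2 : y < (y + x) / 2 by rewrite ltr_pdivlMr//; lra.
have := h _ (le_lt_trans y0 yx2); rewrite (max_r (ltW yx2)) leNgt => /negP; apply.
by rewrite ltr_pdivrMr//; lra.
Qed.
End RealNull.

Section NonArchimedean.
Variables (R : realType) (k : closedFieldType) (abs : k -> R) (p : nat).
Hypothesis Habs : nonarch_complete_abs abs p.
Notation conv_on := (conv_on abs).

(** * The ultrametric absolute value, infinite sums, Gauss norms and evaluation *)

Section Values.
Implicit Types (x y z : k) (r s B : R) (f g h : ps k).

Lemma abs_eq0 x : (abs x == 0) = (x == 0).
Proof. by case: Habs => _ [h _]; apply/eqP/eqP => /h. Qed.
Lemma abs0 : abs 0 = 0. Proof. by apply/eqP; rewrite abs_eq0. Qed.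
Lemma abs_ge0 x : 0 <= abs x. Proof. by case: Habs => _ [_ [h _]]. Qed.
Hint Resolve abs_ge0 : core.
Lemma abs_gt0 x : (0 < abs x) = (x != 0). Proof. by rewrite lt0r abs_eq0 abs_ge0 andbT. Qed.
Lemma absM x y : abs (x * y) = abs x * abs y. Proof. by case: Habs => _ [_ [_ [h _]]]. Qed.
Lemma abs_addr x y : abs (x + y) <= Num.max (abs x) (abs y).
Proof. by case: Habs => _ [_ [_ [_ [h _]]]]. Qed.
Lemma abs_prime : abs p%:R = p%:R^-1.
Proof. by case: Habs => _ [_ [_ [_ [_ [h _]]]]]. Qed.
Lemma abs_complete (u : nat -> k) :
  (forall e : R, 0 < e -> exists N, forall m n, (N <= m)%N -> (N <= n)%N -> abs (u m - u n) < e) ->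
  exists l, rnull (fun n => abs (u n - l)).
Proof.
case: Habs => _ [_ [_ [_ [_ [_ h]]]]] /h [l hl]; exists l; exact/rnullP.
Qed.
Lemma prime_p : prime p. Proof. by case: Habs. Qed.

Lemma abs1 : abs 1 = 1.
Proof.
have : abs 1 != 0 by rewrite abs_eq0 oner_eq0.
by move=> n0; apply: (mulfI n0); rewrite -absM !mulr1.
Qed.
Lemma absX x n : abs (x ^+ n) = abs x ^+ n.
Proof. by elim: n => [|n IH]; rewrite ?expr0 ?abs1// !exprS absM IH. Qed.
Lemma absN1 : abs (-1) = 1.
Proof.
have := absX (-1) 2; rewrite sqrrN expr1n abs1 => /esym/eqP.
by rewrite sqrf_eq1 => /orP[/eqP//|/eqP h]; have := abs_ge0 (-1); rewrite h oppr_ge0 ler10.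
Qed.
Lemma absN x : abs (- x) = abs x.
Proof. by rewrite -mulN1r absM absN1 mul1r. Qed.
Lemma absB x y : abs (x - y) = abs (y - x).
Proof. by rewrite -absN opprB. Qed.
Lemma absV x : abs x^-1 = (abs x)^-1.
Proof.
have [->|x0] := eqVneq x 0; first by rewrite invr0 abs0 invr0.
by apply: (mulfI (_ : abs x != 0)); rewrite ?abs_eq0// -absM !divff ?abs1 ?abs_eq0.
Qed.

Lemma abs_add_le x y B : abs x <= B -> abs y <= B -> abs (x + y) <= B.
Proof. by move=> a b; apply: le_trans (abs_addr _ _) _; rewrite ge_max a b. Qed.
Lemma abs_add_lt x y B : abs x < B -> abs y < B -> abs (x + y) < B.
Proof. by move=> a b; apply: le_lt_trans (abs_addr _ _) _; rewrite gt_max a b. Qed.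
Lemma abs_sub_le x y B : abs x <= B -> abs y <= B -> abs (x - y) <= B.
Proof. by move=> a b; apply: abs_add_le; rewrite ?absN. Qed.
Lemma abs_tri x y z : abs (x - z) <= Num.max (abs (x - y)) (abs (y - z)).
Proof. by rewrite -(subrKA y x (- z)); exact: abs_addr. Qed.
Lemma abs_tri_le x y z B : abs (x - y) <= B -> abs (y - z) <= B -> abs (x - z) <= B.
Proof. by move=> a b; rewrite -(subrKA y x (- z)); exact: abs_add_le. Qed.
Lemma abs_tri_lt x y z B : abs (x - y) < B -> abs (y - z) < B -> abs (x - z) < B.
Proof. by move=> a b; rewrite -(subrKA y x (- z)); exact: abs_add_lt. Qed.
Lemma abs_dom x y : abs y < abs x -> abs (x + y) = abs x.
Proof.
move=> yx; apply/eqP; rewrite eq_le; apply/andP; split; first exact: abs_add_le (ltW yx).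
rewrite leNgt; apply/negP => h.
have : abs (x + y - y) < abs x by apply: abs_add_lt => //; rewrite absN.
by rewrite addrK ltxx.
Qed.
Lemma abs_iso x y z : abs (y - z) < abs (x - y) -> abs (x - z) = abs (x - y).
Proof. by move=> h; rewrite -(subrKA y x (- z)) (abs_dom h). Qed.
Lemma abs_sum_le I (r : seq I) (P : pred I) (F : I -> k) B : 0 <= B ->
  (forall i, P i -> abs (F i) <= B) -> abs (\sum_(i <- r | P i) F i) <= B.
Proof.
move=> B0 h; apply: (big_ind (fun x => abs x <= B)) => //; first by rewrite abs0.
by move=> *; exact: abs_add_le.
Qed.
Lemma abs_prod I (r : seq I) (P : pred I) (F : I -> k) :
  abs (\prod_(i <- r | P i) F i) = \prod_(i <- r | P i) abs (F i).
Proof. exact: (big_morph abs absM abs1). Qed.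
Lemma abs_nat n : abs n%:R <= 1.
Proof. by elim: n => [|n IH]; rewrite ?abs0 ?ler01// -natr1 abs_add_le ?abs1. Qed.
Lemma absMn_le x n : abs (x *+ n) <= abs x.
Proof. by rewrite -mulr_natr absM ler_piMr// abs_nat. Qed.


Lemma ksum_toP (s : nat -> k) l :
  ksum_to abs s l <-> rnull (fun n => abs (\sum_(i < n) s i - l)).
Proof. by rewrite /ksum_to; apply: rnullP. Qed.

Lemma ksum_to_unique (s : nat -> k) l l' : ksum_to abs s l -> ksum_to abs s l' -> l = l'.
Proof.
move=> /ksum_toP h /ksum_toP h'; apply/eqP; rewrite -subr_eq0 -abs_eq0 eq_le abs_ge0 andbT.
apply: le0_eps => e e0; have [N hN] := h e e0; have [N' hN'] := h' e e0.
have := hN (maxn N N') (leq_maxl _ _); have := hN' (maxn N N') (leq_maxr _ _).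
by move=> a b; apply: abs_tri_le a; rewrite absB.
Qed.

Lemma ksumE (s : nat -> k) l : ksum_to abs s l -> ksum abs s = l.
Proof.
move=> h; apply: (@ksum_to_unique s) => //; rewrite /ksum.
by case: xgetP => [y _|/(_ l)].
Qed.

Lemma abs_sum_nat (s : nat -> k) m n B : 0 <= B -> (forall i, (m <= i)%N -> abs (s i) <= B) ->
  (m <= n)%N -> abs (\sum_(i < n) s i - \sum_(i < m) s i) <= B.
Proof.
move=> B0 h mn; rewrite -!(big_mkord xpredT s) (@big_cat_nat _ _ _ m)//= addrAC subrr add0r.
rewrite big_nat_cond; apply: abs_sum_le => // i /andP[/andP[mi _] _]; exact: h.
Qed.

(** Differences of partial sums are bounded by the largest term involved, so the partial sums of a
    null sequence are Cauchy; completeness of k gives the limit. *)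
Lemma ksum_ex (s : nat -> k) : rnull (fun n => abs (s n)) -> ksum_to abs s (ksum abs s).
Proof.
move=> hs; have [l hl] : exists l, rnull (fun n => abs (\sum_(i < n) s i - l)).
  apply: abs_complete => e e0; have [N hN] := hs (e / 2) (divr_gt0 e0 (ltr0n _ 2)).
  have e2 : 0 <= e / 2 by rewrite divr_ge0// ltW.
  exists N => m n Nm Nn; apply: le_lt_trans (_ : e / 2 < e); last lra.
  apply: (@abs_tri_le _ (\sum_(i < N) s i)); first exact: abs_sum_nat.
  by rewrite absB; exact: abs_sum_nat.
by rewrite (ksumE ((ksum_toP _ _).2 hl)); apply/ksum_toP.
Qed.

Lemma ksum_le (s : nat -> k) B : 0 <= B -> rnull (fun n => abs (s n)) -> (forall n, abs (s n) <= B) ->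
  abs (ksum abs s) <= B.
Proof.
move=> B0 hs hB; have /ksum_toP h := ksum_ex hs.
apply: le_eps => // e e0; have [N /(_ N (leqnn _)) hN] := h e e0.
rewrite -[ksum abs s]opprK absN -[- _](addKr (\sum_(i < N) s i)).
apply: abs_add_le; last by rewrite le_max hN orbT.
by rewrite absN le_max abs_sum_le.
Qed.

Lemma ksum_fin (s : nat -> k) N : (forall n, (N <= n)%N -> s n = 0) ->
  ksum abs s = \sum_(i < N) s i.
Proof.
move=> h; apply: ksumE; apply/ksum_toP; apply: (@rnull_finite _ _ N) => n Nn.
by apply: abs_sum_nat => // i /h ->; rewrite abs0.
Qed.

Lemma ksumD (s t : nat -> k) : rnull (fun n => abs (s n)) -> rnull (fun n => abs (t n)) ->
  ksum abs (fun n => s n + t n) = ksum abs s + ksum abs t.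
Proof.
move=> /ksum_ex/ksum_toP hs /ksum_ex/ksum_toP ht; apply: ksumE; apply/ksum_toP.
apply: rnull_le (rnull_max hs ht) => n.
by rewrite big_split /= opprD addrACA abs_addr.
Qed.

Lemma ksumZ c (s : nat -> k) : rnull (fun n => abs (s n)) -> ksum abs (fun n => c * s n) = c * ksum abs s.
Proof.
move=> /ksum_ex/ksum_toP hs; apply: ksumE; apply/ksum_toP.
apply: rnull_le (rnullM (abs_ge0 c) hs) => n.
by rewrite -mulr_sumr -mulrBr absM.
Qed.

(* [cvr f r]: f converges on the closed disc of radius r;
   [gle f r B]: the Gauss norm of f at radius r is at most B. *)
Definition cvr f r := rnull (fun n => abs (f n) * r ^+ n).
Definition gle f r B := forall n, abs (f n) * r ^+ n <= B.
Definition ev f x := evalps abs f x.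

Lemma cvr_gle f r : cvr f r -> exists2 B, 0 <= B & gle f r B.
Proof. exact: rnull_bounded. Qed.

Lemma cvr_le f r r' : 0 <= r' -> r' <= r -> cvr f r -> cvr f r'.
Proof.
move=> r0 rr; apply: rnull_le => n; rewrite ler_wpM2l//.
by rewrite lerXn2r// nnegrE// (le_trans r0).
Qed.
Lemma gle_ge0 f r B : 0 <= r -> gle f r B -> 0 <= B.
Proof. by move=> r0 /(_ 0%N); apply: le_trans; rewrite mulr_ge0. Qed.

Lemma cvrD f g r : 0 <= r -> cvr f r -> cvr g r -> cvr (f + g) r.
Proof.
move=> r0 hf hg; apply: rnull_le (rnull_max hf hg) => n.
by rewrite -maxr_pMl ?exprn_ge0// ler_wpM2r ?exprn_ge0// psDE abs_addr.
Qed.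
Lemma gleD f g r B : 0 <= r -> gle f r B -> gle g r B -> gle (f + g) r B.
Proof.
move=> r0 hf hg n; have := abs_addr (f n) (g n) => h.
apply: le_trans (ler_wpM2r (exprn_ge0 n r0) h) _.
by rewrite maxr_pMl ?exprn_ge0// ge_max hf hg.
Qed.
Lemma cvrN f r : cvr f r -> cvr (- f) r.
Proof. by apply: rnull_le => n; rewrite psNE absN. Qed.
Lemma cvr0 r : cvr 0 r.
Proof. by apply: (@rnull_finite _ _ 0) => n _; rewrite ps0E abs0 mul0r. Qed.
Lemma cvr_sum I (s : seq I) (P : pred I) (F : I -> ps k) r : 0 <= r ->
  (forall i, P i -> cvr (F i) r) -> cvr (\sum_(i <- s | P i) F i) r.
Proof.
move=> r0 h; apply: (big_ind (fun f => cvr f r)) => //; first exact: cvr0.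
by move=> *; exact: cvrD.
Qed.
Lemma cvrZ c f r : 0 <= r -> cvr f r -> cvr (psC c * f) r.
Proof.
move=> r0 hf; apply: rnull_le (rnullM (abs_ge0 c) hf) => n.
by rewrite psCM absM mulrA.
Qed.
Lemma cvrX_exp m f r : 0 <= r -> cvr f r -> cvr (psX ^+ m * f) r.
Proof.
move=> r0 hf; elim: m => [|m IH]; first by rewrite expr0 mul1r.
rewrite exprS -mulrA; apply: (@rnull_unshift _ _ 1).
apply: rnull_le (rnullM r0 IH) => n; rewrite addn1 psXM exprS.
by rewrite mulrCA.
Qed.
Lemma cvr1 r : cvr 1 r.
Proof.
by apply: (@rnull_finite _ _ 1) => -[//|n _]; rewrite /GRing.one /= /psC /= abs0 mul0r.
Qed.
Lemma cvrC c r : 0 <= r -> cvr (psC c) r.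
Proof. by move=> r0; rewrite -[psC c]mulr1; apply: cvrZ => //; exact: cvr1. Qed.
Lemma cvr_monomial c m r : 0 <= r -> cvr (psC c * psX ^+ m) r.
Proof. by move=> r0; apply: cvrZ => //; rewrite -[psX ^+ m]mulr1; apply: cvrX_exp => //; exact: cvr1. Qed.
Lemma cvrX r : 0 <= r -> cvr psX r.
Proof. by move=> r0; have := @cvr_monomial 1 1 r r0; rewrite rmorph1 mul1r. Qed.

Definition pstail N f : ps k := fun n => if (n < N)%N then 0 else f n.
Lemma ps_head_tail N f : f = \sum_(m < N) psC (f m) * psX ^+ m + pstail N f.
Proof.
apply/funext=> n; rewrite psDE ps_sumE /pstail.
under eq_bigr => m _ do rewrite psCM psX_exp.
case: ltnP => [nN|Nn].
  rewrite (bigD1 (Ordinal nN))//= eqxx mulr1 big1 ?addr0// => i /eqP hi.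
  by case: eqP => [e|]; rewrite ?mulr0//; case: hi; apply: val_inj.
rewrite big1 ?add0r// => i _; case: eqP => [e|]; rewrite ?mulr0//.
by have := ltn_ord i; rewrite -e ltnNge Nn.
Qed.
Lemma cvr_tail N f r : 0 <= r -> cvr f r -> cvr (pstail N f) r.
Proof.
move=> r0; apply: rnull_le => n; rewrite ler_wpM2r ?exprn_ge0// /pstail.
by case: ifP; rewrite ?abs0.
Qed.
Lemma gle_tail f r e : 0 < e -> cvr f r -> exists N, gle (pstail N f) r e.
Proof.
move=> e0 /(_ e e0)[N hN]; exists N => n; rewrite /pstail; case: ltnP => [_|/hN//].
by rewrite abs0 mul0r ltW.
Qed.

(* Polynomials are dense among convergent series for the Gauss norm. *)
Lemma dense_vanish (Psi : ps k -> k) r K : 0 <= r -> 0 <= K ->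
  (forall f g, cvr f r -> cvr g r -> Psi (f + g) = Psi f + Psi g) ->
  (forall m c, Psi (psC c * psX ^+ m) = 0) ->
  (forall f B, cvr f r -> gle f r B -> abs (Psi f) <= K * B) ->
  forall f, cvr f r -> Psi f = 0.
Proof.
move=> r0 K0 PD Pm PB f hf; apply/eqP; rewrite -abs_eq0 eq_le abs_ge0 andbT.
apply: le0_eps => e e0; have K1 : 0 < K + 1 by rewrite ltr_wpDl.
have [N hN] := gle_tail (divr_gt0 e0 K1) hf.
have Ph M : Psi (\sum_(m < M) psC (f m) * psX ^+ m) = 0.
  elim: M => [|M IH]; last by rewrite big_ord_recr PD ?IH ?Pm ?addr0//;
    [apply: cvr_sum => // i _; exact: cvr_monomial|exact: cvr_monomial].
  by rewrite big_ord0; have := Pm 0%N 0; rewrite rmorph0 mul0r.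
rewrite (ps_head_tail N f) PD ?Ph ?add0r; last 2 first.
- by apply: cvr_sum => // i _; exact: cvr_monomial.
- exact: cvr_tail.
apply: le_trans (PB _ _ (cvr_tail N r0 hf) hN) _.
by rewrite mulrCA ger_pMr// ler_pdivrMr// mul1r lerDl.
Qed.

(** A bounded additive operator preserves convergence as soon as it does so on monomials, since the
    image of a tail has small Gauss norm. Applied to products, recentrings and composites. *)
Lemma dense_cvr (T : ps k -> ps k) r r' K : 0 <= r -> 0 <= r' -> 0 <= K ->
  (forall f g, cvr f r -> cvr g r -> T (f + g) = T f + T g) ->
  (forall m c, cvr (T (psC c * psX ^+ m)) r') ->
  (forall f B, cvr f r -> gle f r B -> gle (T f) r' (K * B)) ->
  forall f, cvr f r -> cvr (T f) r'.
Proof.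
move=> r0 r'0 K0 TD Tm TB f hf e e0; have K1 : 0 < K + 1 by rewrite ltr_wpDl.
have [N hN] := gle_tail (divr_gt0 e0 K1) hf.
have Th M : cvr (T (\sum_(m < M) psC (f m) * psX ^+ m)) r'.
  elim: M => [|M IH].
    by rewrite big_ord0; have := Tm 0%N 0; rewrite rmorph0 mul0r.
  rewrite big_ord_recr TD; first exact: cvrD.
    by apply: cvr_sum => // i _; exact: cvr_monomial.
  exact: cvr_monomial.
have [M hM] := Th N e e0; exists M => n Mn.
rewrite (ps_head_tail N f) TD; last 2 first.
- by apply: cvr_sum => // i _; exact: cvr_monomial.
- exact: cvr_tail.
rewrite psDE; have h := abs_addr (T (\sum_(m < N) psC (f m) * psX ^+ m) n) (T (pstail N f) n).
apply: le_trans (ler_wpM2r (exprn_ge0 n r'0) h) _.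
rewrite maxr_pMl ?exprn_ge0// ge_max hM//=.
apply: le_trans (TB _ _ (cvr_tail N r0 hf) hN n) _.
by rewrite mulrCA ger_pMr// ler_pdivrMr// mul1r lerDl.
Qed.

Lemma cvr_null f r x : abs x <= r -> cvr f r -> rnull (fun n => abs (f n * x ^+ n)).
Proof.
move=> xr; apply: rnull_le => n; rewrite absM absX ler_wpM2l// lerXn2r// nnegrE//.
exact: le_trans xr.
Qed.
Lemma ev_gle f r B x : abs x <= r -> cvr f r -> gle f r B -> abs (ev f x) <= B.
Proof.
move=> xr hf hB; have r0 := le_trans (abs_ge0 x) xr; apply: ksum_le (cvr_null xr hf) _.
  exact: gle_ge0 hB.
move=> n; apply: le_trans (hB n); rewrite absM absX ler_wpM2l// lerXn2r// nnegrE//.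
Qed.
Lemma evD f g r x : abs x <= r -> cvr f r -> cvr g r -> ev (f + g) x = ev f x + ev g x.
Proof.
move=> xr hf hg; rewrite -(ksumD (cvr_null xr hf) (cvr_null xr hg)).
by congr (ksum _ _); apply/funext=> n; rewrite psDE mulrDl.
Qed.
Lemma evZ c f r x : abs x <= r -> cvr f r -> ev (psC c * f) x = c * ev f x.
Proof.
move=> xr hf; rewrite -(ksumZ c (cvr_null xr hf)).
by congr (ksum _ _); apply/funext=> n; rewrite psCM mulrA.
Qed.
Lemma ev_monomial c m x : ev (psC c * psX ^+ m) x = c * x ^+ m.
Proof.
rewrite /ev /evalps (@ksum_fin _ m.+1) => [|n mn]; last first.
  by rewrite psCM psX_exp gtn_eqF// mulr0 mul0r.
rewrite big_ord_recr /= big1 ?add0r => [|i _]; last first.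
  by rewrite psCM psX_exp ltn_eqF// mulr0 mul0r.
by rewrite psCM psX_exp eqxx mulr1.
Qed.
Lemma evC c x : ev (psC c) x = c.
Proof. by have := ev_monomial c 0 x; rewrite !expr0 !mulr1. Qed.
Lemma evX x : ev psX x = x.
Proof. by have := ev_monomial 1 1 x; rewrite rmorph1 !mul1r. Qed.
Lemma ev0 x : ev 0 x = 0.
Proof. by have := evC 0 x; rewrite rmorph0. Qed.
Lemma ev_at0 f : ev f 0 = f 0%N.
Proof.
rewrite /ev /evalps (@ksum_fin _ 1) ?big_ord1 ?mulr1// => -[//|n _].
by rewrite expr0n mulr0.
Qed.
Lemma evN f r x : abs x <= r -> cvr f r -> ev (- f) x = - ev f x.
Proof.
move=> xr hf; have := evZ (-1) xr hf.
by rewrite rmorphN rmorph1 !mulN1r.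
Qed.
Lemma evB f g r x : abs x <= r -> cvr f r -> cvr g r -> ev (f - g) x = ev f x - ev g x.
Proof. by move=> xr hf hg; rewrite (evD xr hf (cvrN hg)) (evN xr hg). Qed.
Lemma ev_sum I (s : seq I) (P : pred I) (F : I -> ps k) r x : abs x <= r ->
  (forall i, P i -> cvr (F i) r) -> ev (\sum_(i <- s | P i) F i) x = \sum_(i <- s | P i) ev (F i) x.
Proof.
move=> xr h; have r0 := le_trans (abs_ge0 x) xr.
suff [] : ev (\sum_(i <- s | P i) F i) x = \sum_(i <- s | P i) ev (F i) x /\
  cvr (\sum_(i <- s | P i) F i) r by [].
elim: s => [|i s [IH IHc]]; first by rewrite !big_nil ev0; split=> //; exact: cvr0.
rewrite !big_cons; case: ifP => // Pi; split; last by apply: cvrD => //; exact: h.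
by rewrite (evD xr (h _ Pi) IHc) IH.
Qed.

Lemma gleM f g r A B : 0 <= r -> gle f r A -> gle g r B -> gle (f * g) r (A * B).
Proof.
move=> r0 hf hg n; rewrite psME.
have A0 := gle_ge0 r0 hf; have B0 := gle_ge0 r0 hg.
have [rn0|rn0] := eqVneq (r ^+ n) 0; first by rewrite rn0 mulr0 mulr_ge0.
have rn : 0 < r ^+ n by rewrite lt0r rn0 exprn_ge0.
rewrite -ler_pdivlMr//; apply: abs_sum_le => [|i _].
  by rewrite divr_ge0 ?mulr_ge0// ltW.
rewrite ler_pdivlMr// absM.
have -> : r ^+ n = r ^+ i * r ^+ (n - i) by rewrite -exprD subnKC// -ltnS.
by rewrite mulrACA ler_pM// mulr_ge0 ?exprn_ge0.
Qed.
Lemma gle_exp f r A m : 0 <= r -> gle f r A -> gle (f ^+ m) r (A ^+ m).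
Proof.
move=> r0 hf; elim: m => [|m IH]; last by rewrite !exprS; exact: gleM.
move=> [|n]; rewrite !expr0 /GRing.one /= /psC /=; first by rewrite abs1 mulr1.
by rewrite abs0 mul0r.
Qed.

Lemma cvrM f g r : 0 <= r -> cvr f r -> cvr g r -> cvr (f * g) r.
Proof.
move=> r0 hf hg; have [B B0 gB] := cvr_gle hg.
apply: (@dense_cvr (fun f => f * g) r r B) => //.
- by move=> *; exact: mulrDl.
- by move=> m c; rewrite -mulrA; apply: cvrZ => //; exact: cvrX_exp.
- by move=> f' A _ fA; rewrite mulrC; exact: gleM.
Qed.
Lemma cvr_exp f r m : 0 <= r -> cvr f r -> cvr (f ^+ m) r.
Proof.
move=> r0 hf; elim: m => [|m IH]; [exact: cvr1|by rewrite exprS; exact: cvrM].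
Qed.

Lemma evXM f r x : abs x <= r -> cvr f r -> ev (psX * f) x = x * ev f x.
Proof.
move=> xr hf; have r0 := le_trans (abs_ge0 x) xr.
pose Psi f := ev (psX * f) x - x * ev f x.
apply/eqP; rewrite -subr_eq0 -/(Psi f); apply/eqP.
have cX g : cvr g r -> cvr (psX * g) r by move=> ?; apply: cvrM => //; exact: cvrX.
apply: (@dense_vanish Psi r r) => //.
- move=> f1 g1 h1 h2; rewrite /Psi mulrDr (evD xr (cX _ h1) (cX _ h2)) (evD xr h1 h2); ring.
- move=> m c; rewrite /Psi mulrCA -exprS !ev_monomial exprS; ring.
- move=> f1 B h1 hB; have B0 := gle_ge0 r0 hB; rewrite /Psi; apply: abs_sub_le; last first.
    by rewrite absM ler_pM//; exact: ev_gle hB.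
  apply: (ev_gle xr (cX _ h1)); apply: gleM => // -[|[|n]].
  + by rewrite /psX /= abs0 mul0r.
  + by rewrite /psX /= abs1 mul1r expr1.
  + by rewrite /psX /= abs0 mul0r.
Qed.
Lemma evX_expM m f r x : abs x <= r -> cvr f r -> ev (psX ^+ m * f) x = x ^+ m * ev f x.
Proof.
move=> xr hf; have r0 := le_trans (abs_ge0 x) xr; elim: m => [|m IH]; first by rewrite !expr0 !mul1r.
by rewrite !exprS -!mulrA (evXM xr) ?IH//; exact: cvrX_exp.
Qed.

Lemma evM f g r x : abs x <= r -> cvr f r -> cvr g r -> ev (f * g) x = ev f x * ev g x.
Proof.
move=> xr hf hg; have r0 := le_trans (abs_ge0 x) xr.
have [B B0 gB] := cvr_gle hg.
pose Psi f := ev (f * g) x - ev f x * ev g x.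
apply/eqP; rewrite -subr_eq0 -/(Psi f); apply/eqP.
apply: (@dense_vanish Psi r B) => //.
- move=> f1 g1 h1 h2; rewrite /Psi mulrDl (evD xr (cvrM r0 h1 hg) (cvrM r0 h2 hg)) (evD xr h1 h2); ring.
- move=> m c; rewrite /Psi -mulrA (evZ _ xr (cvrX_exp m r0 hg)) (evX_expM m xr hg) ev_monomial; ring.
- move=> f1 A h1 hA; have A0 := gle_ge0 r0 hA; rewrite /Psi [B * A]mulrC; apply: abs_sub_le; last first.
    by rewrite absM ler_pM//; [exact: (ev_gle xr h1 hA)|exact: (ev_gle xr hg gB)].
  by apply: (ev_gle xr (cvrM r0 h1 hg)); exact: gleM.
Qed.
Lemma ev_exp f m r x : abs x <= r -> cvr f r -> ev (f ^+ m) x = ev f x ^+ m.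
Proof.
move=> xr hf; have r0 := le_trans (abs_ge0 x) xr; elim: m => [|m IH].
  by rewrite !expr0; have := evC 1 x; rewrite rmorph1.
by rewrite !exprS (evM xr hf (cvr_exp m r0 hf)) IH.
Qed.

End Values.

(** * Recentring and composition; recovering coefficients from values *)

Section Composition.
Implicit Types (x y z : k) (r s B : R) (f g h : ps k).
Hint Resolve abs_ge0 : core.

Lemma reexp_null f r (h : k) m : 0 < r -> abs h <= r -> cvr f r ->
  rnull (fun n => abs (f (n + m)%N *+ 'C(n + m, m) * h ^+ n)).
Proof.
move=> r0 hr hf; have rm : 0 < r ^+ m by rewrite exprn_gt0.
have := rnullM (ltW (_ : 0 < (r ^+ m)^-1)) (rnull_shift m hf); rewrite invr_gt0 => /(_ rm).
apply: rnull_le => n; rewrite absM absX ler_pdivlMl// exprD.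
rewrite mulrC [X in _ <= X]mulrA ler_pM2r//.
apply: ler_pM => //; [exact: exprn_ge0|exact: absMn_le|].
by rewrite lerXn2r// nnegrE// ltW.
Qed.

Lemma reexpD f g r (h : k) : 0 < r -> abs h <= r -> cvr f r -> cvr g r ->
  reexp abs (f + g) h = reexp abs f h + reexp abs g h :> ps k.
Proof.
move=> r0 hr hf hg; apply/funext=> m.
rewrite psDE -(ksumD (reexp_null m r0 hr hf) (reexp_null m r0 hr hg)).
by congr (ksum _ _); apply/funext=> n; rewrite psDE mulrnDl mulrDl.
Qed.

(** Binomial coefficients are integers, hence of absolute value at most 1: recentring inside the
    disc costs nothing. *)
Lemma gle_reexp f r (h : k) B : 0 < r -> abs h <= r -> cvr f r -> gle f r B -> gle (reexp abs f h) r B.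
Proof.
move=> r0 hr hf hB m; have rm : 0 < r ^+ m by rewrite exprn_gt0.
rewrite -ler_pdivlMr//; apply: (ksum_le _ (reexp_null m r0 hr hf)).
  by rewrite divr_ge0// ?(gle_ge0 (ltW r0) hB)// ltW.
move=> n; rewrite ler_pdivlMr//; apply: le_trans (hB (n + m)%N).
rewrite absM absX exprD mulrA ler_pM2r//.
apply: ler_pM => //; [exact: exprn_ge0|exact: absMn_le|].
by rewrite lerXn2r// nnegrE// ltW.
Qed.

Lemma reexp_monomial c N (h : k) : 
  reexp abs (psC c * psX ^+ N) h = psC c * (psX + psC h) ^+ N :> ps k.
Proof.
apply/funext=> m; rewrite psCM exprDn ps_sumE /reexp.
have E i : (psX ^+ (N - i) * psC h ^+ i *+ 'C(N, i) : ps k) m =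
   (m == N - i)%N%:R * h ^+ i *+ 'C(N, i).
  by rewrite psMnE mulrC -rmorphXn psCM psX_exp mulrC.
under eq_bigr => i _ do rewrite E.
rewrite (@ksum_fin _ N.+1) => [|n Nn]; last first.
  by rewrite psCM psX_exp; case: eqP => [e|_]; [lia|rewrite mulr0 mul0rn mul0r].
rewrite mulr_sumr; apply: eq_bigr => i _.
rewrite psCM psX_exp; have iN : (i <= N)%N by rewrite -ltnS.
have -> : (i + m == N)%N = (m == N - i)%N by apply/eqP/eqP; lia.
case: eqP => [e|_]; last by rewrite mulr0 mul0rn !mul0r mul0rn mulr0.
rewrite mulr1 mul1r mulrnAl mulrnAr; congr (_ *+ _).
by rewrite -bin_sub; [congr 'C(_, _); lia|lia].
Qed.

Lemma cvr_XD (h : k) r : 0 <= r -> cvr (psX + psC h) r.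
Proof. by move=> r0; apply: cvrD => //; [exact: cvrX _ _|exact: cvrC _ _ _]. Qed.

Lemma cvr_reexp f r (h : k) : 0 < r -> abs h <= r -> cvr f r -> cvr (reexp abs f h) r.
Proof.
move=> r0 hr; have r0' := ltW r0.
apply: (@dense_cvr (fun f => reexp abs f h) r r 1) => //.
- by move=> *; exact: (reexpD r0).
- move=> m c; rewrite reexp_monomial; apply: cvrZ => //.
  by apply: cvr_exp => //; exact: cvr_XD.
- by move=> *; rewrite mul1r; exact: gle_reexp.
Qed.

Lemma ev_reexp f r (h : k) x : 0 < r -> abs h <= r -> abs x <= r -> cvr f r ->
  ev (reexp abs f h) x = ev f (x + h).
Proof.
move=> r0 hr xr hf; have r0' := ltW r0.
have xhr : abs (x + h) <= r by exact: abs_add_le.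
pose Psi f := ev (reexp abs f h) x - ev f (x + h).
apply/eqP; rewrite -subr_eq0 -/(Psi f); apply/eqP.
apply: (@dense_vanish Psi r 1) => //.
- move=> f1 g1 h1 h2; rewrite /Psi (reexpD r0 hr h1 h2).
  rewrite (evD xr (cvr_reexp r0 hr h1) (cvr_reexp r0 hr h2)) (evD xhr h1 h2).
  by rewrite opprD addrACA.
- move=> m c; rewrite /Psi reexp_monomial ev_monomial.
  rewrite (evZ _ xr); last by apply: cvr_exp => //; exact: cvr_XD.
  rewrite (ev_exp _ xr); last exact: cvr_XD.
  by rewrite (evD xr (cvrX r0') (cvrC _ r0')) evX evC subrr.
- move=> f1 B h1 hB; rewrite mul1r /Psi; apply: abs_sub_le.
    by apply: (ev_gle xr (cvr_reexp r0 hr h1)); exact: gle_reexp.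
  exact: (ev_gle xhr h1).
Qed.

Lemma gle_comp g h r s B : 0 <= r -> 0 <= s -> h 0%N = 0 -> gle h r s -> gle g s B ->
  gle (pscomp g h) r B.
Proof.
move=> r0 s0 h0 hs hB n; have B0 := gle_ge0 s0 hB.
have [rn0|rn0] := eqVneq (r ^+ n) 0; first by rewrite rn0 mulr0.
have rn : 0 < r ^+ n by rewrite lt0r rn0 exprn_ge0.
rewrite -ler_pdivlMr//; apply: abs_sum_le => [|i _].
  by rewrite divr_ge0// ltW.
rewrite ler_pdivlMr// pspowE absM -mulrA.
apply: le_trans (hB i); rewrite ler_wpM2l//; exact: (gle_exp i r0 hs).
Qed.

Lemma cvr_comp g h r s : 0 <= r -> 0 <= s -> h 0%N = 0 -> gle h r s -> cvr h r -> cvr g s ->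
  cvr (pscomp g h) r.
Proof.
move=> r0 s0 h0 hs hr.
apply: (@dense_cvr (fun g => pscomp g h) s r 1) => //.
- by move=> *; exact: pscompD.
- move=> m c; rewrite pscomp_monomial//; apply: cvrZ => //; exact: cvr_exp.
- by move=> f B _ fB; rewrite mul1r; exact: (gle_comp r0 s0).
Qed.

Lemma ev_comp g h r s x : abs x <= r -> 0 <= s -> h 0%N = 0 -> gle h r s -> cvr h r -> cvr g s ->
  ev (pscomp g h) x = ev g (ev h x).
Proof.
move=> xr s0 h0 hs hr hg; have r0 := le_trans (abs_ge0 x) xr.
have hxs : abs (ev h x) <= s by exact: (ev_gle xr hr hs).
pose Psi g := ev (pscomp g h) x - ev g (ev h x).
apply/eqP; rewrite -subr_eq0 -/(Psi g); apply/eqP.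
have cc f : cvr f s -> cvr (pscomp f h) r by exact: cvr_comp.
apply: (@dense_vanish Psi s 1) => //.
- move=> f1 g1 h1 h2; rewrite /Psi pscompD (evD xr (cc _ h1) (cc _ h2)) (evD hxs h1 h2).
  by rewrite opprD addrACA.
- move=> m c; rewrite /Psi pscomp_monomial// ev_monomial.
  by rewrite (evZ _ xr (cvr_exp m r0 hr)) (ev_exp _ xr hr) subrr.
- move=> f1 B h1 hB; rewrite mul1r /Psi; apply: abs_sub_le.
    by apply: (ev_gle xr (cc _ h1)); exact: (gle_comp r0 s0).
  exact: (ev_gle hxs h1).
Qed.

Lemma prod_le1_eq1 (I : eqType) (l : seq I) (F : I -> R) : (forall i, i \in l -> 0 <= F i <= 1) ->
  \prod_(i <- l) F i = 1 -> forall i, i \in l -> F i = 1.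
Proof.
elim: l => // j l IH h; rewrite big_cons => e.
have hj := h j (mem_head _ _); have hl i : i \in l -> 0 <= F i <= 1.
  by move=> il; apply: h; rewrite inE il orbT.
have /andP[P0 P1] : 0 <= \prod_(i <- l) F i <= 1.
  apply/andP; split; first by rewrite big_seq prodr_ge0// => i /hl/andP[].
  by rewrite big_seq; apply: prodr_ile1 => i il; have := hl i il.
have Fj : F j = 1 by move: e hj => e /andP[a b]; nra.
by move=> i; rewrite inE => /orP[/eqP->//|]; apply: IH => //; move: e; rewrite Fj mul1r.
Qed.

Definition separated (l : seq k) :=
  [/\ uniq l, forall z, z \in l -> abs z <= 1 &
      forall z z', z \in l -> z' \in l -> z != z' -> abs (z - z') = 1].

(* Take the roots of X^q - X with q a large power of p: the derivative of this polynomial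
   has absolute value 1 at every integral point. *)
Lemma separated_points N : exists2 l, separated l & (N <= size l)%N.
Proof.
have p1 := prime_gt1 prime_p.
(* The exponent ensures both q >= N, hence enough roots, and p | q, hence |q| < 1. *)
pose q := (p ^ N.+1)%N; have q1 : (1 < q)%N by rewrite /q -(exp1n N.+1) ltn_exp2r.
have Nq : (N <= q)%N by rewrite ltnW// /q (leq_trans (ltn_expl N p1))// leq_exp2l.
pose Q : {poly k} := 'X^q - 'X.
have sQ : size Q = q.+1 by rewrite size_polyDl size_polyXn// size_polyN size_polyX ltnS.
have lQ : lead_coef Q = 1.
  by rewrite lead_coefDl ?lead_coefXn// size_polyXn size_polyN size_polyX ltnS.
have [l hl] := closed_field_poly_normal Q.
rewrite lQ scale1r in hl.
have sl : size l = q by apply/eq_add_S; rewrite -sQ hl size_prod_XsubC.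
have zq z : z \in l -> z ^+ q = z.
  move=> zl; have : root Q z by rewrite hl root_prod_XsubC.
  by rewrite /root /Q !hornerE subr_eq0 => /eqP.
have z1 z : z \in l -> abs z <= 1.
  move=> /zq e; rewrite leNgt; apply/negP => lt1; have := absX z q; rewrite e.
  by move/eqP; rewrite lt_eqF// -{1}[abs z]expr1 ltr_eXn2l.
have dz z : z \in l -> abs (Q^`()).[z] = 1.
  move=> zl; rewrite /Q derivB derivXn derivX !hornerE.
  rewrite addrC abs_dom absN abs1// hornerMn !hornerE.
  rewrite -mulr_natl absM absX; apply: le_lt_trans (_ : p%:R^-1 < 1); last first.
    by rewrite invf_lt1 ?ltr1n ?ltr0n// ltnW.
  rewrite -[X in _ <= X]mulr1 ler_pM ?exprn_ge0//; last by rewrite exprn_ile1 ?z1.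
  rewrite /q expnS natrM absM abs_prime ler_piMr ?abs_nat// invr_ge0 ler0n.
(* The derivative at z is the product of the differences from the other roots, all of absolute value
   at most 1; a product of absolute value 1 makes each of them 1. As [rem] removes one occurrence
   only, this also excludes multiple roots. *)
have key z : z \in l -> (forall z', z' \in rem z l -> abs (z - z') = 1).
  move=> zl; have e : Q = ('X - z%:P) * \prod_(i <- rem z l) ('X - i%:P).
    by rewrite hl (perm_big _ (perm_to_rem zl)) big_cons.
  have := dz z zl; rewrite e derivM derivXsubC mul1r !hornerE subrr mul0r addr0.
  rewrite horner_prod abs_prod; under eq_bigr => i _ do rewrite !hornerE.
  apply: prod_le1_eq1 => i /mem_rem il; rewrite abs_ge0/=.
  by apply: abs_sub_le; exact: z1.
exists l; last by rewrite sl.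
split=> // [|z z' zl z'l zz'].
  apply: count_mem_uniq => z; have [zl|/count_memPn//] := boolP (z \in l).
  rewrite (permP (perm_to_rem zl)) /= eqxx (count_memPn _)//.
  apply/negP => /(key z zl); rewrite subrr abs0 => /eqP.
  by rewrite eq_sym oner_eq0.
apply: key => //.
by move: z'l; rewrite (perm_mem (perm_to_rem zl)) inE eq_sym (negPf zz').
Qed.

(** Newton interpolation: the quotient of Q - Q(z) by X - z has values bounded by B at the other
    points, because the divisors there have absolute value 1. *)
Lemma poly_coef_le (l : seq k) (Q : {poly k}) B : separated l -> (size Q <= size l)%N ->
  0 <= B -> (forall z, z \in l -> abs Q.[z] <= B) -> forall n, abs Q`_n <= B.
Proof.
move=> [ul l1 l2] sQ B0; elim: l Q ul l1 l2 sQ => [|z l IH] Q.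
  by rewrite leqn0 size_poly_eq0 => _ _ _ /eqP-> _ n; rewrite coef0 abs0.
move=> /= /andP[zl ul] l1 l2 sQ hQ n.
have /factor_theorem [Q1 e] : root (Q - Q.[z]%:P) z by rewrite /root !hornerE subrr.
have {}e : Q = Q1 * ('X - z%:P) + Q.[z]%:P by rewrite -e subrK.
have sQ1 : (size Q1 <= size l)%N.
  have [->|Q10] := eqVneq Q1 0; first by rewrite size_poly0.
  have := size_Mmonic Q10 (monicXsubC z); rewrite size_XsubC addn2 /= => sz.
  rewrite -ltnS -sz.
  have -> : Q1 * ('X - z%:P) = Q - Q.[z]%:P by rewrite {1}e addrK.
  rewrite (leq_trans (size_polyD _ _))// geq_max sQ size_polyN.
  by rewrite (leq_trans (size_polyC_leq1 _)).
have h1 m : abs Q1`_m <= B.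
  apply: (IH Q1) => // [x xl|x y xl yl|x xl].
  - by apply: l1; rewrite inE xl orbT.
  - by apply: l2; rewrite inE ?xl ?yl orbT.
  have xz : x != z by apply: contraNneq zl => <-.
  have -> : abs Q1.[x] = abs (Q.[x] - Q.[z]).
    rewrite {1}e !hornerE addrK absM l2 ?mulr1// inE ?eqxx//.
    by rewrite xl orbT.
  by apply: abs_sub_le; apply: hQ; rewrite inE ?xl ?orbT ?eqxx.
rewrite e coefD; apply: abs_add_le; last first.
  by rewrite coefC; case: ifP => _; [apply: hQ; rewrite mem_head|rewrite abs0].
rewrite mulrBr coefB; apply: abs_sub_le.
  by rewrite coefMX; case: ifP => _; rewrite ?abs0.
rewrite mulrC coefCM absM; apply: le_trans (h1 n); rewrite ler_piMl//.
by apply: l1; rewrite mem_head.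
Qed.

(* Interpolating a polynomial approximation of f at points of mutual distance 1 recovers
   its coefficients. *)
Lemma gauss_le f c B : c != 0 -> 0 <= B -> cvr f (abs c) ->
  (forall x, abs x <= abs c -> abs (ev f x) <= B) -> gle f (abs c) B.
Proof.
move=> c0 B0 hf hB n; apply: le_eps => // e e0.
have [M hM] := gle_tail e0 hf.
(* N exceeds n so that the coefficient of degree n survives in the truncation. *)
pose N := maxn M n.+1.
have hN : gle (pstail N f) (abs c) e.
  move=> i; apply: le_trans (hM i); rewrite ler_wpM2r ?exprn_ge0 ?abs_ge0// /pstail.
  case: (ltnP i N) => [_|]; first by rewrite abs0.
  by rewrite geq_max => /andP[Mi _]; rewrite ltnNge Mi.
have [l sl Nl] := separated_points N.
pose Q : {poly k} := \poly_(i < N) (f i * c ^+ i).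
have -> : abs (f n) * abs c ^+ n = abs Q`_n.
  by rewrite coef_poly leq_max ltnSn orbT absM absX.
apply: (poly_coef_le sl).
- by rewrite (leq_trans (size_poly _ _)).
- by rewrite le_max B0.
case: sl => _ l1 _ z zl.
have czc : abs (c * z) <= abs c by rewrite absM ler_piMr// l1.
have -> : Q.[z] = ev f (c * z) - ev (pstail N f) (c * z).
  rewrite {1}(ps_head_tail N f) (evD czc _ (cvr_tail N _ hf))//; last first.
    by apply: cvr_sum => // i _; exact: cvr_monomial _ _ _ _.
  rewrite addrK (ev_sum _ czc); last by move=> i _; exact: cvr_monomial _ _ _ _.
  rewrite horner_poly; apply: eq_bigr => i _.
  by rewrite ev_monomial exprMn mulrA.
apply: abs_sub_le; first by rewrite le_max hB.
rewrite le_max; apply/orP; right.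
by apply: (ev_gle czc (cvr_tail N _ hf)).
Qed.

(** The roots of X^(N+1) = p have absolute value p^(-1/(N+1)), which tends to 1. *)
Lemma abs_near1 (t : R) : t < 1 -> exists2 x, t < abs x & abs x < 1.
Proof.
move=> t1; pose t' := Num.max t 0; have p1 := prime_gt1 prime_p.
have pi0 : 0 < p%:R^-1 :> R by rewrite invr_gt0 ltr0n ltnW.
have [N hN] : exists N, forall n, (N <= n)%N -> t' ^+ n <= p%:R^-1 / 2.
  by apply: rnull_geom; rewrite ?divr_gt0// gt_max le_max lexx orbT t1 ltr01.
have := hN N.+1 (leqnSn _) => {}hN.
have sX : size ('X^(N.+1) - (p%:R)%:P : {poly k}) != 1%N by rewrite size_XnsubC.
have [x] := closed_rootP _ sX; rewrite /root !hornerE subr_eq0 => /eqP /(congr1 abs).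
rewrite absX abs_prime => e; exists x.
  apply: le_lt_trans (_ : t' < _); first by rewrite le_max lexx.
  rewrite ltNge; apply/negP => xt.
  have : abs x ^+ N.+1 <= t' ^+ N.+1 by rewrite lerXn2r// nnegrE// le_max lexx orbT.
  by rewrite e => h; move: (le_trans h hN) pi0; lra.
rewrite ltNge; apply/negP => x1; have : 1 <= abs x ^+ N.+1 by rewrite exprn_ege1.
by rewrite e leNgt invf_lt1 ?ltr1n ?p1// ltr0n ltnW.
Qed.

(** If s/t < |x| < 1, the first power of x of absolute value below t cannot jump below s. *)
Lemma abs_dense (s t : R) : 0 <= s -> s < t -> t <= 1 -> exists2 c, s < abs c & abs c < t.
Proof.
move=> s0 st t1; have t0 := le_lt_trans s0 st.
have st1 : s / t < 1 by rewrite ltr_pdivrMr// mul1r.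
have [x xst x1] := abs_near1 st1.
have xn : exists n, abs x ^+ n < t.
  have x01 : 0 <= abs x < 1 by rewrite abs_ge0.
  have [N /(_ N (leqnn _)) hN] := rnull_geom x01 (divr_gt0 t0 (ltr0n _ 2)).
  by exists N; apply: le_lt_trans hN _; lra.
case: (ex_minnP xn) => -[|n]; first by rewrite expr0 => h; move: (lt_le_trans h t1); rewrite ltxx.
  move=> h hmin; exists (x ^+ n.+1); rewrite absX//.
  have tn : t <= abs x ^+ n by rewrite leNgt; apply/negP => /hmin; rewrite ltnn.
  rewrite exprS; apply: lt_le_trans (_ : abs x * t <= _); last by rewrite ler_wpM2l.
by rewrite -ltr_pdivrMr.
Qed.

Lemma ev_eq0 f r : 0 < r -> cvr f r -> (forall x, abs x <= r -> ev f x = 0) -> f = 0.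
Proof.
move=> r0 hf h.
have [c c0 cr] : exists2 c, 0 < abs c & abs c < Num.min r 1.
  by apply: abs_dense; rewrite ?ge_min ?lexx ?orbT// lt_min r0 ltr01.
have {}cr : abs c <= r by apply: ltW; apply: lt_le_trans cr _; rewrite ge_min lexx.
have hg : gle f (abs c) 0.
  apply: gauss_le => //; first by rewrite -abs_gt0.
    exact: (cvr_le (abs_ge0 c) cr hf).
  by move=> x xc; rewrite h ?abs0// (le_trans xc).
apply/funext=> n; apply/eqP; rewrite ps0E -abs_eq0 eq_le abs_ge0 andbT.
by have := hg n; rewrite pmulr_lle0// exprn_gt0.
Qed.

Lemma ev_inj f g r : 0 < r -> cvr f r -> cvr g r ->
  (forall x, abs x <= r -> ev f x = ev g x) -> f = g.
Proof.
move=> r0 hf hg h; apply/eqP; rewrite -subr_eq0; apply/eqP; apply: (ev_eq0 r0).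
  by apply: cvrD => //; [exact: ltW|exact: cvrN].
by move=> x xr; rewrite (evB xr hf hg) h ?subrr.
Qed.

(** Pigeonhole: the disc contains d + 1 points at mutual distance |c|, and each t_j is at distance
    less than |c| from at most one of them. *)
Lemma generic_point (a c : k) (d : nat) (t : 'I_d -> k) : c != 0 ->
  exists2 x, abs (x - a) <= abs c & forall j, abs c <= abs (x - t j).
Proof.
move=> c0; have [l [ul l1 l2] dl] := separated_points d.+1.
have [/hasP[z zl /forallP hz]|/hasPn H] :=
  boolP (has (fun z => [forall j, abs c <= abs (a + c * z - t j)]) l).
  exists (a + c * z) => //; rewrite addrC addrA addNr add0r absM ler_piMr ?abs_ge0//.
  exact: l1.
pose g (z : k) : option 'I_d := [pick j | abs (a + c * z - t j) < abs c].
have gP z : z \in l -> exists2 j, g z = Some j & abs (a + c * z - t j) < abs c.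
  move=> /H /forallPn[j]; rewrite -ltNge => hj; rewrite /g; case: pickP => [j' h|/(_ j)].
    by exists j'.
  by rewrite hj.
have ginj : {in l &, injective g}.
  move=> z z' zl z'l; have [j -> hj] := gP z zl; have [j' -> hj'] := gP z' z'l.
  case=> e; move: hj'; rewrite -e => hj'; apply/eqP; apply: contraT => zz'.
  have : abs (c * (z - z')) < abs c.
    have -> : c * (z - z') = (a + c * z - t j) - (a + c * z' - t j) by ring.
    by apply: abs_add_lt; rewrite ?absN.
  by rewrite absM l2// mulr1 ltxx.
have : (size (map g l) <= size (map Some (enum 'I_d)))%N.
  apply: uniq_leq_size; first by rewrite map_inj_in_uniq.
  move=> _ /mapP[z zl ->]; have [j -> _] := gP z zl.
  by apply: map_f; rewrite mem_enum.
by rewrite (size_map g) (size_map Some) size_enum_ord leqNgt dl.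
Qed.

End Composition.

(** * Analytic functions on the unit disc: division by zeros and interpolation *)

Section Disc.
Implicit Types (x y z : k) (r s B : R) (f g h : ps k).
Hint Resolve abs_ge0 : core.

(** Treats both cases at once: either unit disc is the union of the closed discs around 0 whose
    radius satisfies this. *)
Definition radius_in (cl : bool) r : bool := if cl then r <= 1 else r < 1.

Lemma radius_in_le1 cl r : radius_in cl r -> r <= 1.
Proof. by case: cl => //; exact: ltW. Qed.
Lemma radius_in_le cl r s : r <= s -> radius_in cl s -> radius_in cl r.
Proof. by case: cl; [exact: le_trans|exact: le_lt_trans]. Qed.
Lemma radius_in_max cl r s : radius_in cl r -> radius_in cl s -> radius_in cl (Num.max r s).
Proof. by case: cl => /= a b; rewrite ?ge_max ?gt_max a b. Qed.
Lemma radius_in_lt cl r : r < 1 -> radius_in cl r.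
Proof. by case: cl => //; exact: ltW. Qed.
Lemma in_discE cl x : in_disc abs cl x = radius_in cl (abs x).
Proof. by case: cl. Qed.
Lemma radius_in_bigmax cl (l : seq R) : all (radius_in cl) l ->
  exists r, [/\ 0 < r, radius_in cl r & all (fun s => s <= r) l].
Proof.
elim: l => [_|s l IH /= /andP[hs /IH[r [r0 hr hl]]]].
  by exists (1 / 2); split=> //; apply: radius_in_lt; lra.
exists (Num.max s r); split; first by rewrite lt_max r0 orbT.
  exact: radius_in_max.
rewrite le_max lexx/=; apply: sub_all hl => t tr.
by rewrite le_max tr orbT.
Qed.

Lemma conv_onP f rho : conv_on f rho <-> forall r, 0 <= r < rho -> cvr f r.
Proof.
have pos r : 0 <= r < rho -> forall n, 0 <= abs (f n) * r ^+ n.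
  by move=> /andP[r0 _] n; rewrite mulr_ge0 ?exprn_ge0.
by split=> h r hr; apply/(rnullP (pos r hr)); exact: h.
Qed.

Lemma conv_on_le f rho rho' : rho' <= rho -> conv_on f rho -> conv_on f rho'.
Proof. by move=> h hf sg /andP[a b]; apply: hf; rewrite a (lt_le_trans b). Qed.

Lemma analytic_cvr cl f r : analytic abs cl f -> 0 <= r -> radius_in cl r -> cvr f r.
Proof.
case: cl => /= hf r0 r1; last by move/conv_onP: hf; apply; rewrite r0.
apply: (cvr_le r0 r1) => e e0; have /rnullP h := hf; have [//|N hN] := h _ e e0.
by exists N => n /hN; rewrite expr1n mulr1.
Qed.

Lemma root_ex n x : (0 < n)%N -> exists y, y ^+ n = x.
Proof.
move=> n0; have sX : size ('X^n - x%:P) != 1%N by rewrite size_XnsubC// eqSS -lt0n.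
have [y] := closed_rootP _ sX; rewrite /root !hornerE subr_eq0 => /eqP <-; by exists y.
Qed.

Lemma abs_root_near1 (t : R) n : t < 1 -> exists c, [/\ t < abs c ^+ n.+1, t < abs c, 0 < abs c & abs c < 1].
Proof.
move=> t1; have t1' : Num.max t 0 < 1 by rewrite gt_max t1 ltr01.
have [x] := abs_near1 t1'; rewrite gt_max => /andP[tx x0] x1.
have [y yx] := root_ex x (ltn0Sn n).
have e : abs y ^+ n.+1 = abs x by rewrite -absX yx.
have y1 : abs y < 1.
  rewrite ltNge; apply/negP => h; have := exprn_ege1 n.+1 h.
  by rewrite e leNgt x1.
have xy : abs x <= abs y.
  by rewrite -e exprS ler_piMr// exprn_ile1// ltW.
exists y; split=> //; [by rewrite e|exact: lt_le_trans xy|exact: lt_le_trans xy].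
Qed.

(** Stands for the limit |c| -> 1: on the open disc only radii below 1 are available, while the
    bounds sought are those at radius 1. *)
Lemma pow_limit (A C r0 : R) n : 0 <= C -> r0 < 1 ->
  (forall c, r0 < abs c -> abs c < 1 -> A * abs c ^+ n <= C) -> A <= C.
Proof.
move=> C0 r01 h; rewrite leNgt; apply/negP => CA.
have A0 := le_lt_trans C0 CA.
have t1 : Num.max r0 (C / A) < 1 by rewrite gt_max r01 ltr_pdivrMr// mul1r.
have [c []] := abs_root_near1 n t1; rewrite !gt_max => /andP[_ h1] /andP[h2 _] c0 c1.
have := h c h2 c1; rewrite leNgt => /negP; apply.
rewrite mulrC -ltr_pdivrMr//; apply: lt_le_trans h1 _.
by rewrite exprS ler_piMl ?exprn_ge0// ltW.
Qed.

Lemma analytic_coef_le1 cl f : analytic abs cl f ->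
  (forall x, in_disc abs cl x -> abs (ev f x) <= 1) -> forall n, abs (f n) <= 1.
Proof.
move=> hf h1 n; apply: (@pow_limit _ _ 0 n) => // c c0 c1.
have cc : c != 0 by rewrite -abs_gt0.
apply: (gauss_le cc) => //.
  by apply: (analytic_cvr hf) => //; exact: radius_in_lt.
move=> x xc; apply: h1; rewrite in_discE; apply: radius_in_lt; exact: le_lt_trans c1.
Qed.

Lemma gle1 f r : 0 <= r -> r <= 1 -> (forall n, abs (f n) <= 1) -> gle f r 1.
Proof. by move=> r0 r1 h n; rewrite mulr_ile1 ?exprn_ge0 ?exprn_ile1. Qed.

Definition psshift f : ps k := fun n => f n.+1.
Lemma ps_shiftE f : f = psC (f 0%N) + psX * psshift f.
Proof. by apply/funext=> -[|n]; rewrite psDE psXM /psC /= ?addr0// add0r. Qed.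
Lemma cvr_shift f r : 0 < r -> cvr f r -> cvr (psshift f) r.
Proof.
move=> r0 hf; have := rnullM (ltW (_ : 0 < r^-1)) (rnull_shift 1 hf); rewrite invr_gt0 => /(_ r0).
by apply: rnull_le => n; rewrite ler_pdivlMl// addn1 exprS mulrCA.
Qed.
Lemma gle_shift f r B : 0 < r -> gle f r B -> gle (psshift f) r (B / r).
Proof.
move=> r0 hf n; rewrite ler_pdivlMr// -mulrA -exprSr; exact: hf.
Qed.
Lemma ev_shift f r x : 0 < r -> abs x <= r -> cvr f r -> ev f x = f 0%N + x * ev (psshift f) x.
Proof.
move=> r0 xr hf; have hs := cvr_shift r0 hf; have r0' := ltW r0.
rewrite {1}(ps_shiftE f) (evD xr (cvrC _ r0') (cvrM r0' (cvrX r0') hs)).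
by rewrite evC (evXM xr hs).
Qed.

(** After recentring at x, division by y - x is a shift of coefficients, which divides the Gauss
    norm by r; recentring back is free. *)
Lemma ps_divide f r x : 0 < r -> abs x <= r -> cvr f r -> ev f x = 0 ->
  exists q, [/\ cvr q r, forall y, abs y <= r -> ev f y = (y - x) * ev q y &
             forall B, gle f r B -> gle q r (B / r)].
Proof.
move=> r0 xr hf fx.
have hg := cvr_reexp r0 xr hf; have hs := cvr_shift r0 hg.
have xr' : abs (- x) <= r by rewrite absN.
exists (reexp abs (psshift (reexp abs f x)) (- x)); split.
- exact: cvr_reexp.
- move=> y yr; rewrite (ev_reexp r0 xr' yr hs).
  have yxr : abs (y - x) <= r by exact: abs_sub_le.
  have := ev_shift r0 yxr hg; rewrite (ev_reexp r0 xr yxr hf) subrK => ->.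
  by rewrite -ev_at0 (ev_reexp r0 xr _ hf) ?add0r ?fx ?add0r// abs0 ltW.
- move=> B hB; apply: (gle_reexp r0 xr' hs); apply: gle_shift => //.
  exact: gle_reexp.
Qed.

(** An ultrametric Schwarz lemma: the zeros are divided out one by one, and each division gains a
    factor r. *)
Lemma zeros_bound (l : seq k) f r B y : 0 < r -> abs y <= r -> uniq l ->
  (forall x, x \in l -> abs x <= r) -> cvr f r -> gle f r B ->
  (forall x, x \in l -> ev f x = 0) ->
  abs (ev f y) * r ^+ size l <= B * \prod_(x <- l) abs (y - x).
Proof.
move=> r0 yr; elim: l f B => [|x l IH] f B.
  by move=> _ _ hf hB _; rewrite big_nil !mulr1; exact: (ev_gle yr hf hB).
move=> /= /andP[xl ul] hl hf hB h0.
have xr : abs x <= r by apply: hl; rewrite mem_head.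
have [q [hq fq qB]] := ps_divide r0 xr hf (h0 x (mem_head _ _)).
have := IH q (B / r) ul _ hq (qB _ hB) _.
have hl' z : z \in l -> abs z <= r by move=> zl; apply: hl; rewrite inE zl orbT.
have hz z : z \in l -> ev q z = 0.
  move=> zl; have /eqP := fq z (hl' _ zl); rewrite h0; last by rewrite inE zl orbT.
  rewrite eq_sym mulf_eq0 subr_eq0 => /orP[/eqP e|/eqP//].
  by move: xl; rewrite -e zl.
move=> /(_ hl' hz) h; rewrite fq// big_cons absM exprS.
rewrite mulrACA [B * _]mulrCA -mulrA ler_wpM2l//.
by rewrite mulrC -ler_pdivlMr// mulrAC [in X in X <= _]mulrC [in X in X <= _]mulrC.
Qed.

(** The Schwarz bound for f - f(y) and its single known zero y, at a radius 1 or tending to 1. *)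
Lemma ev_lipschitz cl f x y : analytic abs cl f -> (forall n, abs (f n) <= 1) ->
  in_disc abs cl x -> in_disc abs cl y -> abs (ev f x - ev f y) <= abs (x - y).
Proof.
move=> hf f1; rewrite !in_discE => dx dy.
have [r0 [r00 hr]] : exists r, [/\ 0 < r, radius_in cl r & all (fun s => s <= r) [:: abs x; abs y]].
  by apply: radius_in_bigmax; rewrite /= dx dy.
move=> /= /and3P[xr yr _].
have main r : 0 < r -> radius_in cl r -> abs x <= r -> abs y <= r ->
   abs (ev f x - ev f y) * r <= abs (x - y).
  move=> {}r00 {}hr {}xr {}yr.
  have r1 := radius_in_le1 hr; have hfr := analytic_cvr hf (ltW r00) hr.
  have hfy : cvr (f - psC (ev f y)) r.
    by apply: (cvrD (ltW r00) hfr); apply: cvrN; exact: (cvrC _ (ltW r00)).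
  have E z : abs z <= r -> ev (f - psC (ev f y)) z = ev f z - ev f y.
    by move=> zr; rewrite (evB zr hfr (cvrC _ (ltW r00))) evC.
  have := @zeros_bound [:: y] (f - psC (ev f y)) r 1 x r00 xr isT.
  rewrite E// big_seq1 expr1 mul1r; apply=> //.
  - by move=> z; rewrite inE => /eqP->.
  - apply: (gleD (ltW r00)); first exact: gle1 (ltW r00) r1 f1.
    move=> [|n]; rewrite psNE absN /psC /=; last by rewrite abs0 mul0r.
    by rewrite mulr1 (ev_gle yr hfr)//; exact: gle1 (ltW r00) r1 f1.
  - by move=> z; rewrite inE => /eqP->; rewrite E// subrr.
have [r01|r01] := ltP r0 1; last first.
  have r1 : r0 = 1 by apply/eqP; rewrite eq_le r01 (radius_in_le1 hr).
  by have := main r0 r00 hr xr yr; rewrite r1 mulr1.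
apply: (@pow_limit _ _ r0 1) => // c rc c1; rewrite expr1.
apply: main; [exact: lt_trans rc|exact: radius_in_lt|..].
  exact: le_trans xr (ltW rc).
exact: le_trans yr (ltW rc).
Qed.

Lemma prod_XsubC_coef_le (l : seq k) : (forall z, z \in l -> abs z <= 1) ->
  forall n, abs (\prod_(z <- l) ('X - z%:P))`_n <= 1.
Proof.
elim: l => [|z l IH] hl n.
  by rewrite big_nil coef1; case: eqP; rewrite ?abs1 ?abs0 ?ler01.
have hl' x : x \in l -> abs x <= 1 by move=> xl; apply: hl; rewrite inE xl orbT.
rewrite big_cons mulrBl coefB; apply: abs_sub_le.
  by rewrite coefXM; case: eqP => _; rewrite ?abs0 ?ler01 ?IH.
by rewrite coefCM absM mulr_ile1 ?IH ?hl ?mem_head.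
Qed.

(* By Lagrange interpolation at the points of l. *)
Lemma lagrange_bound d (l : seq k) (w : 'I_d -> k) (c B : R) : uniq l -> size l = d ->
  (forall z, z \in l -> abs z <= 1) -> 0 < c -> 0 <= B ->
  (forall z, z \in l -> c <= \prod_(z' <- l | z' != z) abs (z - z')) ->
  (forall z, z \in l -> abs (\sum_(j < d) w j * z ^+ j) <= B) ->
  forall j, abs (w j) <= B / c.
Proof.
move=> ul sl l1 c0 B0 hc hB j.
pose Q : {poly k} := \sum_(i < d) w i *: 'X^i.
have Qz z : Q.[z] = \sum_(i < d) w i * z ^+ i.
  by rewrite horner_sum; apply: eq_bigr => i _; rewrite !hornerE.
pose D z := \prod_(z' <- l | z' != z) (z - z').
have D0 z : z \in l -> D z != 0.
  move=> zl; rewrite -abs_gt0 abs_prod; exact: lt_le_trans (hc z zl).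
pose L : {poly k} := \sum_(z <- l) (Q.[z] / D z) *: \prod_(z' <- l | z' != z) ('X - z'%:P).
have QL : Q = L.
  apply/eqP; rewrite -subr_eq0; apply/eqP; apply: (@roots_geq_poly_eq0 _ _ l) => //.
  - apply/allP => z zl; rewrite /root hornerD hornerN subr_eq0 eq_sym; apply/eqP.
    rewrite /L horner_sum (bigD1_seq z)//= [X in _ + X]big1 => [|z' z'z].
      rewrite hornerZ horner_prod; under eq_bigr => i _ do rewrite !hornerE.
      by rewrite addr0 divfK ?D0.
    rewrite hornerZ -big_filter.
    have /rootP-> : root (\prod_(i <- [seq i <- l | i != z']) ('X - i%:P)) z.
      by rewrite root_prod_XsubC mem_filter zl eq_sym z'z.
    by rewrite mulr0.
  - rewrite sl; have sz_sum (I : Type) (s : seq I) (P : pred I) (F : I -> {poly k}) n :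
        (forall i, P i -> (size (F i) <= n)%N) -> (size (\sum_(i <- s | P i) F i)%R <= n)%N.
      move=> h; apply: (big_ind (fun q : {poly k} => (size q <= n)%N)) => //.
        by rewrite size_poly0.
      by move=> u v hu hv; rewrite (leq_trans (size_polyD _ _))// geq_max hu hv.
    rewrite (leq_trans (size_polyD _ _))// geq_max size_polyN; apply/andP; split.
      apply: sz_sum => i _; rewrite (leq_trans (size_scale_leq _ _))// size_polyXn.
      exact: ltn_ord.
    rewrite /L big_seq; apply: sz_sum => z zl; rewrite (leq_trans (size_scale_leq _ _))//.
    rewrite -big_filter size_prod_XsubC -sl -(count_predC (pred1 z) l) size_filter.
    by rewrite count_uniq_mem// zl add1n.
have -> : w j = Q`_j.
  rewrite coef_sum (bigD1 j)//= coefZ coefXn eqxx mulr1 big1 ?addr0// => i ij.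
  by rewrite coefZ coefXn; case: eqP => [e|]; rewrite ?mulr0//; move/eqP: ij; case; apply: val_inj.
rewrite QL coef_sum big_seq; apply: abs_sum_le => [|z zl].
  by rewrite divr_ge0// ltW.
rewrite coefZ absM -[X in _ <= X]mulr1 ler_pM//; last first.
  rewrite -big_filter; apply: prod_XsubC_coef_le => x; rewrite mem_filter => /andP[_]; exact: l1.
rewrite absM absV ler_pM ?invr_ge0//; first by rewrite Qz hB.
by rewrite lef_pV2 ?posrE ?abs_gt0 ?D0// abs_prod hc.
Qed.

Lemma cvr_deriv (f : ps k) r : 0 < r -> cvr f r -> cvr (psderiv f) r.
Proof.
move=> r0 /(cvr_shift r0); apply: rnull_le => n.
by rewrite ler_wpM2r ?exprn_ge0 ?(ltW r0)// absMn_le.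
Qed.
Lemma reexp_coef0 (f : ps k) r x : 0 < r -> abs x <= r -> cvr f r -> reexp abs f x 0%N = ev f x.
Proof.
move=> r0 xr hf; rewrite -ev_at0 (ev_reexp r0 xr _ hf) ?add0r//.
by rewrite abs0 ltW.
Qed.
Lemma reexp_coef1 (f : ps k) x : reexp abs f x 1%N = ev (psderiv f) x.
Proof.
rewrite /reexp /ev /evalps; congr (ksum _ _); apply/funext=> n.
by rewrite /psderiv addn1 bin1.
Qed.

End Disc.

(** * The same operations on open discs *)

Section ConvOn.
Implicit Types (x y z h : k) (r s B T : R) (f g : ps k).
Hint Resolve abs_ge0 : core.

Lemma between x T : abs x < T -> exists r, [/\ abs x <= r, 0 < r & r < T].
Proof.
move=> xT; exists ((abs x + T) / 2); have := abs_ge0 x; split; lra.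
Qed.
Lemma conv_on_cvr f r T : conv_on f T -> 0 <= r -> r < T -> cvr f r.
Proof. by move=> /conv_onP h r0 rT; apply: h; rewrite r0. Qed.

Lemma conv_onD f g T : conv_on f T -> conv_on g T -> conv_on (f + g) T.
Proof.
move=> hf hg; apply/conv_onP => r /andP[r0 rT].
by apply: cvrD => //; exact: conv_on_cvr rT.
Qed.
Lemma conv_onN f T : conv_on f T -> conv_on (- f) T.
Proof.
move=> hf; apply/conv_onP => r /andP[r0 rT].
by apply: cvrN; exact: conv_on_cvr rT.
Qed.
Lemma conv_onM f g T : conv_on f T -> conv_on g T -> conv_on (f * g) T.
Proof.
move=> hf hg; apply/conv_onP => r /andP[r0 rT].
by apply: cvrM => //; exact: conv_on_cvr rT.
Qed.
Lemma conv_onC c T : conv_on (psC c) T.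
Proof. by apply/conv_onP => r /andP[r0 rT]; exact: cvrC. Qed.
Lemma conv_onX T : conv_on psX T.
Proof. by apply/conv_onP => r /andP[r0 rT]; exact: cvrX. Qed.
Lemma conv_on0 T : conv_on (0 : ps k) T.
Proof. by apply/conv_onP => r _; exact: cvr0. Qed.
Lemma conv_on_exp f m T : conv_on f T -> conv_on (f ^+ m) T.
Proof.
move=> hf; apply/conv_onP => r /andP[r0 rT].
by apply: cvr_exp => //; exact: conv_on_cvr rT.
Qed.
Lemma conv_on_sum I (s : seq I) (P : pred I) (F : I -> ps k) T :
  (forall i, P i -> conv_on (F i) T) -> conv_on (\sum_(i <- s | P i) F i) T.
Proof.
move=> h; apply/conv_onP => r /andP[r0 rT].
by apply: cvr_sum => // i Pi; exact: conv_on_cvr (h i Pi) r0 rT.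
Qed.
Lemma conv_on_deriv f T : conv_on f T -> conv_on (psderiv f) T.
Proof.
move=> hf; apply/conv_onP => r /andP[r0 rT].
have r1 : 0 < (r + T) / 2 by have := le_lt_trans r0 rT; lra.
apply: (cvr_le r0 (r := (r + T) / 2)); first lra.
by apply: (cvr_deriv r1); apply: (conv_on_cvr hf (ltW r1)); lra.
Qed.

Lemma conv_evD f g x T : conv_on f T -> conv_on g T -> abs x < T -> ev (f + g) x = ev f x + ev g x.
Proof.
move=> hf hg /between[r [xr r0 rT]].
by rewrite (evD xr) //; [exact: conv_on_cvr (ltW r0) rT|exact: conv_on_cvr (ltW r0) rT].
Qed.
Lemma conv_evN f x T : conv_on f T -> abs x < T -> ev (- f) x = - ev f x.
Proof.
move=> hf /between[r [xr r0 rT]].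
by rewrite (evN xr) //; exact: conv_on_cvr (ltW r0) rT.
Qed.
Lemma conv_evM f g x T : conv_on f T -> conv_on g T -> abs x < T -> ev (f * g) x = ev f x * ev g x.
Proof.
move=> hf hg /between[r [xr r0 rT]].
by rewrite (evM xr) //; [exact: conv_on_cvr (ltW r0) rT|exact: conv_on_cvr (ltW r0) rT].
Qed.
Lemma conv_ev_exp f m x T : conv_on f T -> abs x < T -> ev (f ^+ m) x = ev f x ^+ m.
Proof.
move=> hf /between[r [xr r0 rT]].
by rewrite (ev_exp m xr) //; exact: conv_on_cvr (ltW r0) rT.
Qed.
Lemma conv_ev_sum I (s : seq I) (P : pred I) (F : I -> ps k) x T :
  (forall i, P i -> conv_on (F i) T) -> abs x < T ->
  ev (\sum_(i <- s | P i) F i) x = \sum_(i <- s | P i) ev (F i) x.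
Proof.
move=> hf /between[r [xr r0 rT]].
by rewrite (ev_sum _ xr) // => i Pi; exact: conv_on_cvr (hf i Pi) (ltW r0) rT.
Qed.

Lemma conv_ev_inj f g T : 0 < T -> conv_on f T -> conv_on g T ->
  (forall x, abs x < T -> ev f x = ev g x) -> f = g.
Proof.
move=> T0 hf hg h; have T2 : 0 < T / 2 by lra.
apply: (ev_inj T2).
- by apply: (conv_on_cvr hf (ltW T2)); lra.
- by apply: (conv_on_cvr hg (ltW T2)); lra.
- by move=> x xr; apply: h; lra.
Qed.

Lemma reexp_conv f h T : conv_on f T -> abs h < T ->
  conv_on (reexp abs f h) T /\ forall x, abs x < T -> ev (reexp abs f h) x = ev f (x + h).
Proof.
move=> hf hT; have [r0 [hr0 r00 r0T]] := between hT.
have main r : 0 <= r -> r < T -> cvr (reexp abs f h) (Num.max r r0) /\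
    forall x, abs x <= r -> ev (reexp abs f h) x = ev f (x + h).
  move=> rp rT; have m0 : 0 < Num.max r r0 by rewrite lt_max r00 orbT.
  have hm : abs h <= Num.max r r0 by rewrite le_max hr0 orbT.
  have cf : cvr f (Num.max r r0) by apply: (conv_on_cvr hf (ltW m0)); rewrite gt_max rT.
  split; first exact: (cvr_reexp m0 hm cf).
  by move=> x xr; rewrite (ev_reexp m0 hm _ cf)// le_max xr.
split=> [|x xT].
  apply/conv_onP => r /andP[rp rT]; have [hc _] := main r rp rT.
  by apply: (cvr_le rp) hc; rewrite le_max lexx.
by have [_] := main _ (abs_ge0 x) xT; apply.
Qed.

(** Recentring back by -h gives a series converging on the disc of radius T; it agrees with f on a
    smaller disc, hence is f. Convergence of f around h is what gives [reexp abs f h] a meaning. *)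
Lemma reexp_conv_inv f h T : conv_on (reexp abs f h) T -> abs h < T -> 0 < T ->
  (exists2 S, abs h < S & conv_on f S) -> conv_on f T.
Proof.
move=> hg hT T0 [S hS hf].
have [|hg' eg] := reexp_conv hg (_ : abs (- h) < T); first by rewrite absN.
suff -> : f = reexp abs (reexp abs f h) (- h) by [].
have m0 : 0 < Num.min S T by rewrite lt_min T0 (le_lt_trans (abs_ge0 h) hS).
have [hr er] := reexp_conv hf hS.
apply: (conv_ev_inj m0).
- by apply: (conv_on_le _ hf); rewrite ge_min lexx.
- by apply: (conv_on_le _ hg'); rewrite ge_min lexx orbT.
move=> x; rewrite lt_min => /andP[xS xT]; rewrite eg// er ?subrK//.
by apply: abs_add_lt; rewrite ?absN.
Qed.

Lemma reexp0 f T : 0 < T -> conv_on f T -> reexp abs f 0 = f :> ps k.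
Proof.
move=> T0 hf; have h0 : abs 0 < T by rewrite abs0.
have [hg eg] := reexp_conv hf h0; apply: (conv_ev_inj T0 hg hf) => x xT.
by rewrite eg// addr0.
Qed.

Lemma reexp_reexp f h h' T : conv_on f T -> abs h < T -> abs h' < T ->
  reexp abs (reexp abs f h) h' = reexp abs f (h' + h) :> ps k.
Proof.
move=> hf hT h'T; have [hg eg] := reexp_conv hf hT; have [hg' eg'] := reexp_conv hg h'T.
have hhT : abs (h' + h) < T by exact: abs_add_lt.
have [hk ek] := reexp_conv hf hhT.
apply: (conv_ev_inj (le_lt_trans (abs_ge0 h) hT) hg' hk) => x xT.
rewrite eg'// eg ?ek ?addrA//; exact: abs_add_lt.
Qed.

Lemma reexp_analytic cl f h : analytic abs cl f -> in_disc abs cl h ->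
  conv_on (reexp abs f h) 1 /\ forall x, abs x < 1 -> ev (reexp abs f h) x = ev f (x + h).
Proof.
move=> hf hh.
have main r : 0 <= r -> r < 1 -> exists s, [/\ r <= s, 0 < s, abs h <= s, radius_in cl s & cvr f s].
  move=> r0 r1; have r2 : 0 < (r + 1) / 2 by lra.
  have s0 : 0 < Num.max ((r + 1) / 2) (abs h) by rewrite lt_max r2.
  have hs : radius_in cl (Num.max ((r + 1) / 2) (abs h)).
    by apply: radius_in_max; [apply: radius_in_lt; lra|rewrite -in_discE].
  exists (Num.max ((r + 1) / 2) (abs h)); split=> //.
  - by rewrite le_max; apply/orP; left; lra.
  - by rewrite le_max lexx orbT.
  - exact: (analytic_cvr hf (ltW s0) hs).
split=> [|x x1].
  apply/conv_onP => r /andP[r0 r1]; have [s [rs s0 hs _ cf]] := main r r0 r1.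
  by apply: (cvr_le r0 rs); exact: cvr_reexp.
by have [s [rs s0 hs _ cf]] := main _ (abs_ge0 x) x1; rewrite (ev_reexp s0 hs rs cf).
Qed.

(** Both sides are the coefficient of degree 1 of the expansion at x + h, reached in two recentrings
    or in one. *)
Lemma ev_deriv_reexp cl f h x : analytic abs cl f -> in_disc abs cl h -> abs x < 1 ->
  ev (psderiv (reexp abs f h)) x = ev (psderiv f) (x + h).
Proof.
move=> hf hh x1; rewrite -!reexp_coef1; congr (_ 1%N).
have [hg eg] := reexp_analytic hf hh; have [hg' eg'] := reexp_conv hg x1.
have hxh : in_disc abs cl (x + h).
  rewrite in_discE; apply: radius_in_le (abs_addr _ _) _.
  by apply: radius_in_max; [apply: radius_in_lt|rewrite -in_discE].
have [hk ek] := reexp_analytic hf hxh.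
apply: (conv_ev_inj ltr01 hg' hk) => y y1.
rewrite eg'// eg ?ek ?addrA//; exact: abs_add_lt.
Qed.

Lemma ps_mulr_eq0 f g : g 0%N != 0 -> f * g = 0 -> f = 0.
Proof.
move=> g0 fg; apply/funext=> n; rewrite ps0E; elim/ltn_ind: n => n IH.
have := congr1 (fun f : ps k => f n) fg; rewrite psME ps0E big_ord_recr /= subnn big1 ?add0r.
  by move/eqP; rewrite mulf_eq0 (negPf g0) orbF => /eqP.
by move=> i _; rewrite IH ?mul0r.
Qed.

Lemma psMnC f m : f *+ m = psC m%:R * f.
Proof. by rewrite rmorph_nat mulr_natl. Qed.

Lemma ps_exp0 f m : (f ^+ m) 0%N = f 0%N ^+ m.
Proof. by elim: m => [|m IH]; rewrite ?expr0// !exprS psM0 IH. Qed.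

End ConvOn.

(** * Discs and branches of the tree *)

Section Tree.
Implicit Types (s : R) (x : k * R).
Hint Resolve abs_ge0 : core.
Variables (cl : bool) (d : nat) (a : 'I_d -> k) (i0 : 'I_d) (T : R) (L : seq (k * R)).
Implicit Types (i j : 'I_d).
Hypotheses (Ha_inj : injective a) (T1 : T <= 1) (T0 : 0 < T)
  (HL : valid_UP abs cl a (a i0, T) L).

Definition in_ball s (i j : 'I_d) := abs (a j - a i) < s.
Definition inD x (j : 'I_d) := abs (a j - x.1) < x.2.

Lemma in_ball_sym s i j : in_ball s i j = in_ball s j i.
Proof. by rewrite /in_ball absB. Qed.
Lemma in_ball_trans s i j l : in_ball s i j -> in_ball s j l -> in_ball s i l.
Proof. by rewrite /in_ball => h1 h2; exact: abs_tri_lt h2 h1. Qed.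
Lemma in_ball_refl s i : 0 < s -> in_ball s i i.
Proof. by rewrite /in_ball subrr abs0. Qed.
Lemma in_ball_eq s i j l : in_ball s i j -> in_ball s i l = in_ball s j l.
Proof.
move=> h; apply/idP/idP; last exact: in_ball_trans.
by apply: in_ball_trans; rewrite in_ball_sym.
Qed.
Lemma in_ball_le s s' i j : s' <= s -> in_ball s' i j -> in_ball s i j.
Proof. by move=> h; rewrite /in_ball => /lt_le_trans; apply. Qed.

Lemma mem_L_cases x : x \in L -> (same_disc abs x (a i0, T)) \/
  exists c, [/\ 0 < x.2, x.2 < T, abs (c - a i0) < T, abs (x.1 - c) <= x.2 &
     (exists j, inD x j) /\ (1 < ndiscs abs a c x.2)%N].
Proof.
case: HL => _ _ h _ /h [|[c [rho [hb hp hx]]]]; [by left|right; exists c].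
case: hb => rho0 [_ hn]; move: hx => /and3P[/eqP e xc /existsP hj].
move: hp => /andP[/= rT cT]; rewrite e; split=> //; split.
  by case: hj => j hj; exists j; rewrite /inD e.
(* Among more than two components at most one points upwards, which leaves at least two discs below
   the branching point. *)
by move: hn; case: (rho < 1)%R; rewrite ?add1n ?add0n // => /ltnW.
Qed.

Lemma uniq_L : uniq L.
Proof.
apply/(uniqP (a i0, T)) => n m nL mL e; apply/eqP; apply: contraT => /eqP nm.
case: HL => _ h _ _; have := h n m nL mL nm; rewrite e /same_disc eqxx subrr abs0 /=.
have [/andP[/eqP-> _]|[c [-> _ _ _ _]]//] := mem_L_cases (mem_nth (a i0, T) mL).
by rewrite T0.
Qed.

Lemma same_disc_L x x' j : x \in L -> x' \in L -> x.2 = x'.2 -> inD x j -> inD x' j -> x = x'.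
Proof.
move=> xL x'L e hj hj'; case: HL => _ h _ _.
rewrite -(nth_index (a i0, T) xL) -(nth_index (a i0, T) x'L).
have [->//|/eqP nm] := eqVneq (index x L) (index x' L).
have := h (index x L) (index x' L); rewrite !index_mem => /(_ xL x'L nm).
rewrite !nth_index// /same_disc e eqxx /=; case/negP.
apply: (abs_tri_lt (y := a j)); last by [].
by rewrite absB -e.
Qed.

Lemma inD_ball x i j : inD x i -> inD x j = in_ball x.2 i j.
Proof.
rewrite /inD /in_ball => hi; apply/idP/idP => hj.
  by apply: abs_tri_lt hj _; rewrite absB.
exact: abs_tri_lt hj hi.
Qed.

Lemma ndiscs_two c rho : (1 < ndiscs abs a c rho)%N -> exists i j,
  [/\ abs (a i - c) <= rho, abs (a j - c) <= rho & rho <= abs (a i - a j)].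
Proof.
move=> /card_gt1P[i [j [hi hj ij]]]; exists i, j.
move: hi hj; rewrite !inE => /andP[hi /forallP mi] /andP[hj /forallP mj]; split=> //.
rewrite leNgt; have := ij; rewrite neq_ltn => /orP[/(implyP (mj i))|/(implyP (mi j))//].
by rewrite absB.
Qed.

(** Such a disc hangs from a branching point inside the ball, which therefore contains two distinct
    a_j. In particular a ball with a single index has no member of L strictly inside it. *)
Lemma branch_two s i x : s <= T -> x \in L -> x.2 < s -> abs (x.1 - a i) < s ->
  [/\ 0 < x.2, (exists2 j, inD x j & in_ball s i j) &
   exists i1 i2, [/\ in_ball s i i1, in_ball s i i2 & x.2 <= abs (a i1 - a i2)]].
Proof.
move=> sT xL xs xi; have [/andP[/eqP e _]|[c [x0 xT cT xc [[j hj] /ndiscs_two[i1 [i2 [h1 h2 h3]]]]]]] := mem_L_cases xL.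
  by move: (lt_le_trans xs sT); rewrite e ltxx.
have ci : abs (c - a i) < s.
  by apply: (abs_tri_lt (y := x.1)) => //; rewrite absB; exact: le_lt_trans xs.
split=> //.
  by exists j => //; apply: (abs_tri_lt (y := x.1)) => //; exact: lt_trans xs.
exists i1, i2; split=> //; apply: (abs_tri_lt (y := c)) => //; exact: le_lt_trans xs.
Qed.

Definition unchosen rho (j : 'I_d) := forall x, x \in L -> x.2 = rho -> ~~ inD x j.

(** The least index of the ball: the representative by which [ndiscs] counts an open disc of radius
    rho. *)
Definition rep rho (j : 'I_d) : 'I_d := [arg min_(l < j | in_ball rho j l) l].

Lemma repP rho j : 0 < rho -> in_ball rho j (rep rho j) /\
  forall l, in_ball rho j l -> (rep rho j <= l)%N.
Proof. by move=> r0; rewrite /rep; case: arg_minnP => //; exact: in_ball_refl. Qed.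

Lemma rep_eq rho i j : 0 < rho -> in_ball rho i j -> rep rho i = rep rho j.
Proof.
move=> r0 ij; have [hi mi] := repP i r0; have [hj mj] := repP j r0.
apply: val_inj; apply/eqP; rewrite eqn_leq mi ?mj//.
  by rewrite -(in_ball_eq _ ij).
by rewrite (in_ball_eq _ ij).
Qed.

(* rho is the diameter of the ball: exactly one of the discs of radius rho that meet it is
   not in L. *)
Lemma top_vertex s i j0 : s <= T -> in_ball T i0 i -> in_ball s i j0 -> j0 != i ->
  exists rho, [/\ 0 < rho, rho < s, forall j j', in_ball s i j -> in_ball s i j' -> abs (a j - a j') <= rho &
   [/\ forall x, x \in L -> x.2 < s -> abs (x.1 - a i) < s -> x.2 <= rho,
     exists2 js, in_ball s i js & unchosen rho js,
     forall j j', in_ball s i j -> in_ball s i j' -> unchosen rho j -> unchosen rho j' -> in_ball rho j j' &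
     forall j, in_ball s i j -> (#|[set l | in_ball rho j l]| < #|[set l | in_ball s i l]|)%N]].
Proof.
move=> sT iX j0B j0i; have s0 : 0 < s by apply: le_lt_trans j0B.
case: (@Order.TotalTheory.arg_maxP _ _ 'I_d i (fun j => in_ball s i j) (fun j => abs (a j - a i)) (in_ball_refl i s0)).
move=> jm jmB jmax; pose rho := abs (a jm - a i); exists rho.
have r0 : 0 < rho.
  apply: lt_le_trans (jmax j0 j0B); rewrite abs_gt0 subr_eq0.
  by apply: contra j0i => /eqP/Ha_inj->.
have rs : rho < s by [].
have diam j j' : in_ball s i j -> in_ball s i j' -> abs (a j - a j') <= rho.
  move=> hj hj'; apply: (abs_tri_le (y := a i)); first exact: jmax.
  by rewrite absB; exact: jmax.
have rT : rho < T by exact: lt_le_trans sT.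
have closed j : (abs (a j - a i) <= rho) = in_ball s i j.
  by apply/idP/idP => h; [exact: le_lt_trans rs|exact: jmax].
pose S := [set j : 'I_d | (abs (a j - a i) <= rho) &&
      [forall i' : 'I_d, (i' < j)%N ==> ~~ (abs (a j - a i') < rho)]].
have repS j : in_ball s i j -> rep rho j \in S.
  move=> hj; have [hr mr] := repP j r0; rewrite inE closed; apply/andP; split.
    by apply: in_ball_trans hj _; exact: in_ball_le (ltW rs) hr.
  apply/forallP => l; apply/implyP => lr; apply/negP => h.
  have : in_ball rho j l by apply: in_ball_trans hr _; rewrite in_ball_sym.
  by move=> /mr; rewrite leqNgt lr.
have Srep j : j \in S -> rep rho j = j.
  rewrite inE => /andP[_ /forallP h]; have [hr mr] := repP j r0.
  apply: val_inj; apply/eqP; rewrite eqn_leq mr ?in_ball_refl//= leqNgt; apply/negP => lt.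
  by have := implyP (h _) lt; rewrite -/(in_ball rho (rep rho j) j) in_ball_sym hr.
have SB j : j \in S -> in_ball s i j by rewrite inE closed => /andP[].
have irep l : in_ball s i l -> rep rho l = rep rho i -> in_ball rho i l.
  move=> _ e; have [hi _] := repP i r0; have [hl _] := repP l r0.
  by apply: in_ball_trans hi _; rewrite -e in_ball_sym.
have nS : ndiscs abs a (a i) rho = #|S| 
  by apply: eq_card => j; apply/idP/idP; rewrite !inE.
have S2 : (1 < ndiscs abs a (a i) rho)%N.
  rewrite nS; apply/card_gt1P; exists (rep rho i), (rep rho jm); split.
  - by apply: repS; exact: in_ball_refl.
  - exact: repS.
  - apply/eqP => e; have := irep jm jmB (esym e).
    by rewrite /in_ball -/rho ltxx.
have hbr : branching abs cl a (a i) rho.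
  split=> //; split; last by have r1 := lt_le_trans rT T1; rewrite r1.
  split; first exact: ltW.
  split; last by exists i; rewrite subrr abs0 ltW.
  by have r1 := lt_le_trans rT T1; case: (cl) => //; exact: ltW.
have hpt : point_in abs (a i) rho (a i0, T) by rewrite /point_in rT.
case: HL => _ _ _ /(_ _ _ hbr hpt); rewrite /delta => hcount.
pose Lb := [seq x <- L | is_branch abs a (a i) rho x].
have LbP x j : x \in L -> x.2 = rho -> in_ball s i j -> inD x j -> x \in Lb.
  move=> xL e hj xj; rewrite mem_filter xL andbT /is_branch e eqxx /=; apply/andP; split.
    apply: (abs_tri_le (y := a j)); last by rewrite closed.
    by rewrite absB ltW// -e.
  by apply/existsP; exists j; rewrite -e.
pose r x := if [pick j | inD x j] is Some j then rep rho j else i.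
have rP x : x \in Lb -> exists j, [/\ in_ball s i j, inD x j, x.2 = rho & r x = rep rho j].
  rewrite mem_filter => /andP[/and3P[/eqP e xc /existsP[j hj]] xL].
  rewrite /r; case: pickP => [l hl|/(_ j)]; last by rewrite /inD e hj.
  exists l; split=> //; rewrite -closed; apply: abs_tri_le xc.
  by rewrite ltW// -e.
have rinj : {in Lb &, injective r}.
  move=> x x' /[dup] xLb /rP[j [hj xj e ->]] /[dup] x'Lb /rP[j' [hj' xj' e' ->]] err.
  have jj' : in_ball rho j j'.
    have [h1 _] := repP j r0; have [h2 _] := repP j' r0.
    by apply: in_ball_trans h1 _; rewrite err in_ball_sym.
  move: xLb x'Lb; rewrite !mem_filter => /andP[_ xL] /andP[_ x'L].
  apply: (same_disc_L xL x'L _ xj); first by rewrite e e'.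
  by rewrite (inD_ball _ xj') e' in_ball_sym.
have ur : uniq (map r Lb) by rewrite map_inj_in_uniq// filter_uniq// uniq_L.
have rS y : y \in map r Lb -> y \in S.
  by move=> /mapP[x /rP[j [hj _ _ ->]] ->]; exact: repS.
(* The branches in L give #|S| - 1 distinct representatives, so exactly one element of S remains:
   that of the omitted branch. *)
pose C := S :\: [set y in map r Lb].
have cardC : #|C| = 1%N.
  rewrite cardsD; have -> : S :&: [set y in map r Lb] = [set y in map r Lb].
    by apply/finset.setIidPr; apply/fintype.subsetP => y; rewrite inE; exact: rS.
  have -> : #|[set y in map r Lb]| = size Lb.
    by rewrite cardsE -(size_map r); apply/card_uniqP.
  rewrite size_filter hcount.
  rewrite nS; move: S2; rewrite nS.
  by case: #|S| => // n _; rewrite /= subSnn.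
have unC j : in_ball s i j -> unchosen rho j -> rep rho j \in C.
  move=> hj uj; rewrite inE repS// andbT inE; apply/negP => /mapP[x xLb e].
  have [l [hl xl ex er]] := rP x xLb; move: xLb; rewrite mem_filter => /andP[_ xL].
  have := uj x xL ex; rewrite (inD_ball _ xl) ex => /negP; apply.
  have [h1 _] := repP j r0; have [h2 _] := repP l r0.
  by apply: in_ball_trans h2 _; rewrite -er -e in_ball_sym.
have /cards1P[js eC] : #|C| == 1%N by rewrite cardC.
split=> //; split.
- move=> x xL xs xi; have [_ _ [i1 [i2 [h1 h2 h3]]]] := branch_two sT xL xs xi.
  exact: le_trans h3 (diam _ _ h1 h2).
- have : js \in C by rewrite eC inE.
  rewrite inE => /andP[njs jsS]; exists js; first exact: SB.
  move=> x xL e; apply/negP => xj; move/negP: njs; apply; rewrite inE.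
  have xLb := LbP _ _ xL e (SB _ jsS) xj.
  have [l [hl xl _ er]] := rP x xLb; apply/mapP; exists x => //.
  by rewrite er -(Srep _ jsS); apply: rep_eq => //; rewrite -e -(inD_ball _ xj).
- move=> j j' hj hj' uj uj'; have := unC j hj uj; have := unC j' hj' uj'.
  rewrite eC !inE => /eqP e' /eqP e.
  have [h1 _] := repP j r0; have [h2 _] := repP j' r0.
  by apply: in_ball_trans h1 _; rewrite e -e' in_ball_sym.
- move=> j hj; apply: proper_card; apply/properP; split.
    apply/fintype.subsetP => l; rewrite !inE => hl; apply: in_ball_trans hj _.
    exact: in_ball_le (ltW rs) hl.
  (* A ball of radius rho cannot contain both i and jm, which are at distance rho; so it is strictly
     smaller, and inductions on the number of indices proceed. *)
  have [hij|hij] := boolP (in_ball rho j i).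
    exists jm; rewrite !inE //; apply/negP => h.
    by rewrite (in_ball_eq jm hij) /in_ball ltxx in h.
  by exists i; rewrite !inE ?in_ball_refl.
Qed.

Implicit Types (c : k * R -> k).

(** The incidence sum at a_j cut by level: [Fsum] takes the discs strictly inside D(a_i, s^-),
    [Esum] those of radius s, of which at most one contains a_j. *)
Definition Fsum c s i j := \sum_(x <- L | (x.2 < s) && (abs (x.1 - a i) < s)) c x * (inD x j)%:R.
Definition Esum c s j := \sum_(x <- L | x.2 == s) c x * (inD x j)%:R.

Lemma Fsum_split c s rho i j j' : s <= T -> rho < s ->
  (forall x, x \in L -> x.2 < s -> abs (x.1 - a i) < s -> x.2 <= rho) ->
  in_ball s i j -> in_ball rho j j' -> Fsum c s i j' = Esum c rho j + Fsum c rho j j'.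
Proof.
move=> sT rs hle hj jj'; rewrite /Fsum /Esum big_mkcond [X in _ = X + _]big_mkcond.
rewrite [X in _ = _ + X]big_mkcond -big_split /= big_seq [RHS]big_seq; apply: eq_bigr => x xL.
have j'j : in_ball rho j' j by rewrite in_ball_sym.
have [e|ne] := eqVneq x.2 rho.
  rewrite e ltxx /= addr0 rs /=.
  have -> : inD x j = inD x j'.
    apply/idP/idP => h; first by rewrite (inD_ball _ h) e.
    by rewrite (inD_ball _ h) e.
  have [h|h] := boolP (inD x j'); last by rewrite !mulr0; case: ifP.
  rewrite ifT//; apply: (abs_tri_lt (y := a j')).
    by rewrite absB; apply: lt_trans rs; rewrite -e.
  by apply: in_ball_trans hj _; exact: in_ball_le (ltW rs) jj'.
rewrite add0r; have [h|h] := boolP (inD x j'); last by rewrite !mulr0; do 2!case: ifP.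
have [xr|xr] := ltP x.2 rho.
  rewrite (lt_trans xr rs) /= !ifT//.
    by apply: (abs_tri_lt (y := a j')) => //; rewrite absB; exact: lt_trans xr.
  apply: (abs_tri_lt (y := a j')).
    by rewrite absB; apply: lt_trans rs; exact: lt_trans xr.
  by apply: in_ball_trans hj _; exact: in_ball_le (ltW rs) jj'.
rewrite /= ifF//; apply/negP => /andP[xs xi]; have := hle x xL xs xi.
by rewrite leNgt lt_neqAle eq_sym ne xr.
Qed.

Lemma Esum_one c x j : x \in L -> inD x j -> Esum c x.2 j = c x.
Proof.
move=> xL xj; rewrite /Esum big_mkcond (bigD1_seq x) ?uniq_L//= eqxx xj mulr1 big1_seq ?addr0//.
move=> x' /andP[nx x'L]; case: eqP => // e.
have [h|_] := boolP (inD x' j); last by rewrite mulr0.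
by case/eqP: nx; exact: (same_disc_L x'L xL e h xj).
Qed.

Lemma Esum_unchosen c rho j : unchosen rho j -> Esum c rho j = 0.
Proof.
move=> uj; rewrite /Esum big_seq_cond big1// => x /andP[xL /eqP e].
by rewrite (negPf (uj x xL e)) mulr0.
Qed.

Lemma Fsum_single c s i j : s <= T -> (forall l, in_ball s i l -> l = i) -> Fsum c s i j = 0.
Proof.
move=> sT h; rewrite /Fsum big_seq_cond big1// => x /and3P[xL xs xi].
have [x0 _ [i1 [i2 [/h-> /h->]]]] := branch_two sT xL xs xi.
by rewrite subrr abs0 leNgt x0.
Qed.

Lemma ball_cases s i : (forall l, in_ball s i l -> l = i) \/ exists2 j, in_ball s i j & j != i.
Proof.
have [/forallP h|/forallPn[l]] := boolP [forall l, in_ball s i l ==> (l == i)].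
  by left=> l hl; apply/eqP; exact: implyP (h l) hl.
by rewrite negb_imply => /andP[h1 h2]; right; exists l.
Qed.

(** At the top vertex of the ball, the omitted branch has no disc of its own, so the induction
    applied to it gives kappa = 0. On a chosen branch it then gives that the coefficient of the
    branch vanishes, and those below it too. *)
Lemma tree_ind c s i kappa : s <= T -> 0 < s -> in_ball T i0 i ->
  (forall j, in_ball s i j -> Fsum c s i j = kappa) ->
  kappa = 0 /\ forall x, x \in L -> x.2 < s -> abs (x.1 - a i) < s -> c x = 0.
Proof.
have [n] := ubnP #|[set l | in_ball s i l]|; elim: n => // n IH in s i kappa *.
rewrite ltnS => cn sT s0 iX hF; have [single|[j0 j0B j0i]] := ball_cases s i.
  split; first by rewrite -(hF i (in_ball_refl i s0)) Fsum_single.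
  move=> x xL xs xi; have [x0 _ [i1 [i2 [/single-> /single->]]]] := branch_two sT xL xs xi.
  by rewrite subrr abs0 leNgt x0.
have [rho [r0 rs diam [hle [js jsB ujs] hun hcard]]] := top_vertex sT iX j0B j0i.
have rT : rho <= T by exact: le_trans (ltW rs) sT.
have key j : in_ball s i j -> kappa - Esum c rho j = 0 /\
    forall x, x \in L -> x.2 < rho -> abs (x.1 - a j) < rho -> c x = 0.
  move=> hj; apply: IH => //.
  - exact: leq_trans (hcard j hj) cn.
  - by apply: in_ball_trans iX _; exact: in_ball_le hj.
  - move=> j' jj'; have jB : in_ball s i j' by apply: in_ball_trans hj _; exact: in_ball_le (ltW rs) jj'.
    by rewrite -(hF j' jB) (Fsum_split c sT rs hle hj jj') addrAC subrr add0r.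
have k0 : kappa = 0.
  by have [] := key js jsB; rewrite (Esum_unchosen c ujs) subr0.
split=> // x xL xs xi; have [x0 [j xj hj] _] := branch_two sT xL xs xi.
have [kj hx] := key j hj; have := hle x xL xs xi; rewrite le_eqVlt => /orP[/eqP e|xr].
  by move/eqP: kj; rewrite k0 sub0r oppr_eq0 -e (Esum_one c xL xj) => /eqP.
by apply: hx => //; rewrite absB; exact: lt_trans xr.
Qed.

(** The constant kappa stands for the coefficient of the ball itself, which is not among the discs
    strictly inside it. *)
Lemma tree_span (lam : 'I_d -> k) s i : s <= T -> 0 < s -> in_ball T i0 i ->
  exists c kappa, forall j, in_ball s i j -> kappa + Fsum c s i j = lam j.
Proof.
have [n] := ubnP #|[set l | in_ball s i l]|; elim: n => // n IH in s i *.
rewrite ltnS => cn sT s0 iX; have [single|[j0 j0B j0i]] := ball_cases s i.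
  by exists (fun=> 0), (lam i) => j /[dup] /single-> _; rewrite Fsum_single ?addr0.
have [rho [r0 rs diam [hle [js jsB ujs] hun hcard]]] := top_vertex sT iX j0B j0i.
have rT : rho <= T by exact: le_trans (ltW rs) sT.
have /choice[g hg] : forall j, exists g : (k * R -> k) * k, in_ball s i j ->
    forall j', in_ball rho j j' -> g.2 + Fsum g.1 rho j j' = lam j'.
  move=> j; have [hj|hj] := boolP (in_ball s i j); last by exists (fun=> 0, 0).
  have [||c [kap h]] := IH rho j _ rT r0; last by exists (c, kap).
    exact: leq_trans (hcard j hj) cn.
  by apply: in_ball_trans iX _; exact: in_ball_le hj.
(* The constant of the ball is dictated by the omitted branch; a chosen branch receives the
   difference between its own constant and this one. *)
pose ks := (g (rep rho js)).2.
pose c x := if [pick j | inD x j] is Some j then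
  (if x.2 == rho then (g (rep rho j)).2 - ks else (g (rep rho j)).1 x) else 0.
have cP x j : x.2 <= rho -> inD x j ->
    c x = if x.2 == rho then (g (rep rho j)).2 - ks else (g (rep rho j)).1 x.
  move=> xr xj; rewrite /c; case: pickP => [l xl|/(_ j)]; last by rewrite xj.
  have -> : rep rho l = rep rho j.
    by apply: rep_eq => //; apply: in_ball_le xr _; rewrite -(inD_ball _ xl).
  by [].
exists c, ks => j hj; have [rj _] := repP j r0; set m := rep rho j in rj.
have hm : in_ball s i m by apply: in_ball_trans hj _; exact: in_ball_le (ltW rs) rj.
have mj : in_ball rho m j by rewrite in_ball_sym.
rewrite (Fsum_split c sT rs hle hm mj) -(hg m hm j mj).
have -> : Fsum c rho m j = Fsum (g m).1 rho m j.
  apply: eq_bigr => x /andP[xr _]; have [xj|_] := boolP (inD x j); last by rewrite !mulr0.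
  by rewrite (cP x j (ltW xr) xj) lt_eqF.
rewrite addrA; congr (_ + _).
have um : unchosen rho m -> Esum c rho m = 0 by exact: Esum_unchosen.
have [/hasP[x xL /andP[/eqP e xm]]|/hasPn H] := boolP (has (fun x => (x.2 == rho) && inD x m) L).
  have xr : x.2 <= rho by rewrite e.
  rewrite -[in Esum _ _ _]e (Esum_one c xL xm) (cP x m xr xm) e eqxx.
  have -> : rep rho m = m by rewrite /m; apply: rep_eq => //; rewrite in_ball_sym.
  by rewrite addrC subrK.
have {}H : unchosen rho m.
  by move=> x xL e; have := H x xL; rewrite e eqxx.
rewrite um// addr0 /ks; have -> // : rep rho js = m.
have mm : rep rho m = m by rewrite /m; apply: rep_eq => //; rewrite in_ball_sym.
by rewrite -mm; apply: rep_eq => //; exact: hun.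
Qed.

Lemma top_disc : exists2 x, x \in L & [/\ x.2 = T, forall j, inD x j = in_ball T i0 j &
  forall x', x' \in L -> x' != x -> x'.2 < T /\ abs (x'.1 - a i0) < T].
Proof.
case: HL => -[x xL /andP[/= /eqP e xi]] _ _ _; exists x => //; rewrite e in xi.
have hx j : inD x j = in_ball T i0 j.
  have xi0 : inD x i0 by rewrite /inD e absB.
  by rewrite (inD_ball _ xi0) e.
split=> // x' x'L nx; have [/andP[/= /eqP e' xi']|[c [x0 xT cT xc _]]] := mem_L_cases x'L.
  case/eqP: nx; apply: (same_disc_L x'L xL (j := i0)); first by rewrite e e'.
    by rewrite /inD absB.
  by rewrite /inD absB e.
split=> //; apply: abs_tri_lt cT; exact: le_lt_trans xT.
Qed.

Lemma sum_top c j x : x \in L -> x.2 = T -> (forall j, inD x j = in_ball T i0 j) ->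
  (forall x', x' \in L -> x' != x -> x'.2 < T /\ abs (x'.1 - a i0) < T) -> in_ball T i0 j ->
  \sum_(x <- L) c x * (inD x j)%:R = c x + Fsum c T i0 j.
Proof.
move=> xL e hx hL hj; rewrite (bigD1_seq x) ?uniq_L//= hx hj mulr1; congr (_ + _).
rewrite big_seq_cond /Fsum [RHS]big_seq_cond; apply: eq_bigl => x'.
have [x'L|//] := boolP (x' \in L); rewrite /=.
have [->|nx] := eqVneq x' x; first by rewrite e ltxx.
by have [-> ->] := hL x' x'L nx.
Qed.

Lemma inD_top x j : x \in L -> inD x j -> in_ball T i0 j.
Proof.
move=> xL; have [z zL [e hz hL]] := top_disc.
have [->|nx] := eqVneq x z; first by rewrite hz.
have [xT xi] := hL x xL nx => xj; apply: abs_tri_lt xi; exact: lt_trans xT.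
Qed.

Lemma tree_indep c : (forall j, in_ball T i0 j -> \sum_(x <- L) c x * (inD x j)%:R = 0) ->
  forall x, x \in L -> c x = 0.
Proof.
move=> h; have [z zL [e hz hL]] := top_disc.
have [||k0 hx] := @tree_ind c T i0 (- c z) (lexx T) T0.
- exact: in_ball_refl.
- move=> j hj; have := h j hj; rewrite (sum_top c zL e hz hL hj) => /eqP.
  by rewrite addrC addr_eq0 => /eqP.
move=> x xL; have [->|nx] := eqVneq x z; first by apply/eqP; rewrite -oppr_eq0 k0.
by have [xT xi] := hL x xL nx; exact: hx.
Qed.

Lemma tree_basis (lam : 'I_d -> k) : exists c,
  forall j, in_ball T i0 j -> \sum_(x <- L) c x * (inD x j)%:R = lam j.
Proof.
have [z zL [e hz hL]] := top_disc.
have [c [kap hc]] := tree_span lam (lexx T) T0 (in_ball_refl i0 T0).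
pose c' x := if x == z then kap else c x.
exists c' => j hj; rewrite (sum_top c' zL e hz hL hj) -(hc j hj) /c' eqxx; congr (_ + _).
apply: eq_bigr => x /andP[xT _]; case: eqP => // xz.
by rewrite xz e ltxx in xT.
Qed.

(** A disc of radius at least s containing one point of the ball contains them all, so it
    contributes a constant; [Fsum] is then constant on the ball and [tree_ind] applies. *)
Lemma tree_const c s i : s <= T -> 0 < s -> in_ball T i0 i ->
  (forall j, in_ball s i j -> \sum_(x <- L) c x * (inD x j)%:R = \sum_(x <- L) c x * (inD x i)%:R) ->
  forall x, x \in L -> x.2 < s -> inD x i -> c x = 0.
Proof.
move=> sT s0 iX h x xL xs xi.
have E j : in_ball s i j -> \sum_(x <- L) c x * (inD x j)%:R =
    \sum_(x <- L | s <= x.2) c x * (inD x i)%:R + Fsum c s i j.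
  move=> hj; rewrite (bigID (fun x => s <= x.2))/=; congr (_ + _).
    apply: eq_bigr => y ys; congr (_ * _); congr ((_ : bool)%:R).
    have hjy : in_ball y.2 i j by exact: in_ball_le hj.
    by apply/idP/idP => hy; rewrite (inD_ball _ hy) // in_ball_sym.
  rewrite /Fsum big_mkcond [RHS]big_mkcond; apply: eq_bigr => y _; rewrite -ltNge.
  have [ys|//] := boolP (y.2 < s); rewrite /=.
  have [yj|] := boolP (inD y j); last by rewrite mulr0; case: ifP.
  rewrite ifT//; apply: (abs_tri_lt (y := a j)) => //.
  by rewrite absB; exact: lt_trans ys.
have [|_ hx] := @tree_ind c s i (Fsum c s i i) sT s0 iX.
  by move=> j hj; apply: (addrI (\sum_(x <- L | s <= x.2) c x * (inD x i)%:R)); rewrite -!E ?h// in_ball_refl.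
by apply: hx => //; rewrite absB; exact: lt_trans xs.
Qed.

End Tree.

Lemma lin_dep (F : fieldType) (M D : nat) (Lam : 'I_M -> 'I_D -> F) : (D < M)%N ->
  exists2 mu : 'I_M -> F, exists n, mu n != 0 & forall m, \sum_(n < M) mu n * Lam n m = 0.
Proof.
move=> DM; pose A := \matrix_(n, m) Lam n m : 'M[F]_(M, D).
have : kermx A != 0.
  rewrite -mxrank_eq0 mxrank_ker subn_eq0 -ltnNge.
  exact: leq_ltn_trans (rank_leq_col A) DM.
move=> /rowV0Pn[v /sub_kermxP vA v0].
exists (fun n => v 0 n) => [|m].
  apply/existsP; apply: contraNT v0 => /existsPn h; apply/eqP/rowP => n.
  by have := h n; rewrite negbK !mxE => /eqP.
have := congr1 (fun B : 'rV_D => B 0 m) vA; rewrite !mxE => h; rewrite -[RHS]h.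
by apply: eq_bigr => n _; rewrite mxE.
Qed.

Lemma card_ord_lt n i : (i <= n)%N -> #|[pred j : 'I_n | (j < i)%N]| = i.
Proof. by move=> ile; rewrite -sum1_card -(big_ord_widen n (fun=> 1%N))// sum1_card card_ord. Qed.

(** * Radii of convergence and optimal bases *)

Section Radius.
Hint Resolve abs_ge0 : core.
Implicit Types (f : ps k) (rho : R).

Let rset f := [set rho : R | 0 <= rho < 1 /\ conv_on f rho]%classic.

Lemma rset_has_sup f : has_sup (rset f).
Proof.
split; last by exists 1 => rho /= [/andP[_ /ltW]].
exists 0; split; first by rewrite lexx ltr01.
move=> s /andP[s0 s1]; by move: (le_lt_trans s0 s1); rewrite ltxx.
Qed.


Lemma radius_geP f rho : 0 < rho -> rho <= 1 -> (rho <= Defs.radius abs f) <-> conv_on f rho.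
Proof.
move=> rho0 rho1; split=> h.
  apply/conv_onP => s /andP[s0 sr].
  have [ne _] := rset_has_sup f.
  have [t [/andP[t0 t1] ht] st] := sup_gt ne (lt_le_trans sr h).
  exact: (conv_on_cvr ht).
have [r1|r1] := ltP rho 1.
  by apply: ub_le_sup; [have [] := rset_has_sup f|split=> //; rewrite ltW].
have e1 : rho = 1 by apply/eqP; rewrite eq_le rho1.
(* [radius] is a supremum over radii below 1, so the value 1 is only approached, by 1 - e. *)
apply/ler_addgt0Pl => e e0; rewrite e1; have [e2|e2] := ltP e 1; last first.
  apply: le_trans e2 _; rewrite lerDl; apply: ub_le_sup; first by have [] := rset_has_sup f.
  split; first by rewrite lexx ltr01.
  by move=> s /andP[s0 s1]; move: (le_lt_trans s0 s1); rewrite ltxx.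
rewrite -lerBlDl; apply: ub_le_sup; first by have [] := rset_has_sup f.
split; first by rewrite subr_ge0 (ltW e2) gtrBl.
by apply: (conv_on_le _ h); rewrite e1 lerBlDl lerDr ltW.
Qed.

Variable I : finType.
Implicit Types (Y : I -> ps k).

Lemma vrad_le1 Y : vrad abs Y <= 1.
Proof. exact: bigmin_le_id. Qed.

Lemma vrad_geP Y rho : 0 < rho -> rho <= 1 -> (rho <= vrad abs Y) <-> forall c, conv_on (Y c) rho.
Proof.
move=> r0 r1; split=> h.
  by move=> c; apply/(radius_geP _ r0 r1); apply: le_trans h _; exact: bigmin_le.
apply: le_bigmin => // c _; exact/(radius_geP _ r0 r1).
Qed.

Lemma vrad_conv Y c : 0 < vrad abs Y -> conv_on (Y c) (vrad abs Y).
Proof. by move=> v0; apply: (vrad_geP Y v0 (vrad_le1 Y)).1. Qed.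

Lemma vrad_reexp Y (h : k) : 0 < vrad abs Y -> abs h < vrad abs Y ->
  vrad abs (fun c => reexp abs (Y c) h) = vrad abs Y.
Proof.
move=> v0 hv; apply/eqP; rewrite eq_le; apply/andP; split; last first.
  apply/(vrad_geP _ v0 (vrad_le1 Y)) => c.
  by have [] := reexp_conv (vrad_conv c v0) hv.
set v' := vrad abs _; rewrite leNgt; apply/negP => vv'.
have v'0 := lt_trans v0 vv'; have v'1 : v' <= 1 := vrad_le1 _.
have : v' <= vrad abs Y; last by rewrite leNgt vv'.
apply/(vrad_geP _ v'0 v'1) => c; apply: (reexp_conv_inv (h := h)) => //.
- exact: vrad_conv.
- exact: lt_trans vv'.
- by exists (vrad abs Y) => //; exact: vrad_conv.
Qed.

Variables (G : I -> I -> ps k) (a : k).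

Lemma horizontal_vrad Y : horizontal abs G a Y -> 0 < vrad abs Y.
Proof.
move=> [[rho [r0 hr]] _]; have m0 : 0 < Num.min rho 1 by rewrite lt_min r0 ltr01.
have m1 : Num.min rho 1 <= 1 by rewrite ge_min lexx orbT.
apply: (lt_le_trans m0); apply/(vrad_geP Y m0 m1).
by move=> c; apply: (conv_on_le _ (hr c)); rewrite ge_min lexx.
Qed.

Let mset i := [set rho : R | 0 < rho <= 1 /\
  exists Ys : 'I_(#|I| - i) -> I -> ps k,
    (forall m, horizontal abs G a (Ys m) /\ forall c, conv_on (Ys m c) rho)
    /\ ps_indep Ys]%classic.

Lemma mrad_mem M (Z : 'I_M -> I -> ps k) i rho : 0 < rho -> rho <= 1 ->
  (forall n, horizontal abs G a (Z n) /\ forall c, conv_on (Z n c) rho) -> ps_indep Z ->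
  (#|I| - i <= M)%N -> mset i rho.
Proof.
move=> r0 r1 hZ iZ iM.
split; first by rewrite r0.
exists (fun n => Z (widen_ord iM n)); split=> // lam hlam n.
pose mu (l : 'I_M) := \sum_(n' < #|I| - i | widen_ord iM n' == l) lam n'.
have := iZ mu _ (widen_ord iM n); rewrite /mu => h.
rewrite -[RHS]h; first by rewrite (big_pred1 n).
move=> c l; rewrite -[RHS](hlam c l) [RHS](partition_big (widen_ord iM) xpredT)//=.
apply: eq_bigr => m _; rewrite mulr_suml; by apply: eq_bigr => n' /eqP->.
Qed.

Lemma mrad_ge M (Z : 'I_M -> I -> ps k) i rho : 0 < rho -> rho <= 1 ->
  (forall n, horizontal abs G a (Z n) /\ forall c, conv_on (Z n c) rho) -> ps_indep Z ->
  (#|I| - i <= M)%N -> rho <= mrad abs G a i.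
Proof.
move=> r0 r1 hZ iZ iM; apply: ub_le_sup; first by exists 1 => s /= [/andP[_]].
exact: mrad_mem hZ iZ iM.
Qed.

(* Otherwise Y and the members of the basis converging on the disc of radius rho would be
   too many independent solutions there. *)
Lemma optimal_filtered N (Ys : 'I_N -> I -> ps k) : optimal_basis abs G a Ys ->
  forall Y (lam : 'I_N -> k) rho, horizontal abs G a Y ->
    (forall c n, Y c n = \sum_(m < N) lam m * Ys m c n) -> 0 < rho -> rho <= 1 ->
    (forall c, conv_on (Y c) rho) -> forall m, lam m != 0 -> rho <= vrad abs (Ys m).
Proof.
move=> [hor indep spans [sg [sgbij hsg]]] Y lam rho hY hlam r0 r1 hc m0 lam0.
rewrite leNgt; apply/negP => vm0.
have NI : N = #|I|.
  by have := bij_eq_card sgbij; rewrite !card_ord.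
pose A := [pred m : 'I_N | rho <= vrad abs (Ys m)].
have m0A : m0 \notin A by rewrite inE -ltNge.
pose Z (n : 'I_(#|A|).+1) := if unlift ord0 n is Some n' then Ys (enum_val n') else Y.
have hZ n : horizontal abs G a (Z n) /\ forall c, conv_on (Z n c) rho.
  rewrite /Z; case: unliftP => [n' _|_]; last by split.
  split; first exact: hor.
  by apply/(vrad_geP _ r0 r1); exact: (enum_valP n').
have iZ : ps_indep Z.
  move=> mu hmu; pose nu m := mu ord0 * lam m + \sum_(n' < #|A| | enum_val n' == m) mu (lift ord0 n').
  have nu0 : forall m, nu m = 0.
    apply: indep => c n; rewrite -[RHS](hmu c n) big_ord_recl /Z unlift_none hlam mulr_sumr.
    under [X in _ = _ + X]eq_bigr => n' _ do rewrite liftK.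
    rewrite [X in _ = _ + X](partition_big (@enum_val _ A) xpredT)//= -big_split /=.
    apply: eq_bigr => m _; rewrite /nu mulrDl mulrA mulr_suml; congr (_ + _).
    by apply: eq_bigr => n' /eqP->.
  have mu0 : mu ord0 = 0.
    have /eqP := nu0 m0; rewrite /nu big1 ?addr0 ?mulf_eq0 ?(negPf lam0) ?orbF => [/eqP//|n' /eqP e].
    by move: m0A; rewrite -e enum_valP.
  move=> n; case: (unliftP ord0 n) => [n' ->|->//].
  have := nu0 (enum_val n'); rewrite /nu mu0 mul0r add0r (big_pred1 n')// => j /=.
  by apply/eqP/eqP => [/enum_val_inj//|->].
(* These #|A| + 1 independent solutions make [mrad] at least rho at the last #|A| + 1 indices, while
   the bijection of optimality allows only #|A| such indices. *)
have big i : (#|I| - i <= #|A|.+1)%N -> rho <= mrad abs G a i by move=> h; exact: mrad_ge hZ iZ h.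
have AI : (#|A| < #|I|)%N.
  rewrite -NI -[X in (_ < X)%N](card_ord N); apply: proper_card; apply/properP.
  by split; [exact/fintype.subsetP|exists m0].
have : (#|[pred i : 'I_#|I| | (rho <= mrad abs G a i)%R]| <= #|A|)%N.
  case: (sgbij) => g _ Kg; rewrite -(card_imset A (bij_inj sgbij)).
  apply: subset_leq_card; apply/fintype.subsetP => i hi.
  by rewrite -(Kg i); apply: imset_f; rewrite inE hsg Kg.
apply/negP; rewrite -ltnNge.
pose i0 := (#|I| - #|A|.+1)%N.
have hle : (#|[pred i : 'I_#|I| | (i0 <= i)%N]| <= #|[pred i : 'I_#|I| | (rho <= mrad abs G a i)%R]|)%N.
  by apply: subset_leq_card; apply/fintype.subsetP => i; rewrite !inE => h; apply: big; lia.
apply: leq_trans hle.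
have := cardC [pred i : 'I_#|I| | (i0 <= i)%N]; rewrite card_ord => e.
have : (#|[predC [pred i : 'I_#|I| | (i0 <= i)%N]]| <= i0)%N.
  rewrite -[X in (_ <= X)%N](@card_ord_lt #|I|); last by rewrite /i0 leq_subr.
  by apply: subset_leq_card; apply/fintype.subsetP => i; rewrite !inE -ltnNge.
move=> h; rewrite -(ltn_add2r #|[predC [pred i : 'I_#|I| | (i0 <= i)%N]]|) e.
by apply: leq_ltn_trans (leq_add (leqnn _) h) _; rewrite /i0; lia.
Qed.

(** The bijection is the rank in the order of increasing radii. If v is the radius of the member of
    rank i, the last N - i members give [mrad] >= v at i. For rho > v, N - i independent solutions
    of radius rho would lie in the span of the members of radius at least rho, of which there are
    fewer. *)
Lemma filtered_optimal N (Ys : 'I_N -> I -> ps k) : N = #|I| ->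
  (forall m, horizontal abs G a (Ys m)) -> ps_indep Ys -> hor_spans abs G a Ys ->
  (forall Y (lam : 'I_N -> k) rho, horizontal abs G a Y ->
    (forall c n, Y c n = \sum_(m < N) lam m * Ys m c n) -> 0 < rho -> rho <= 1 ->
    (forall c, conv_on (Y c) rho) -> forall m, lam m != 0 -> rho <= vrad abs (Ys m)) ->
  optimal_basis abs G a Ys.
Proof.
move=> NI hor indep spans filt; split=> //.
pose leT (m m' : 'I_N) := vrad abs (Ys m) <= vrad abs (Ys m').
have leT_total : total leT by move=> m m'; exact: le_total.
have leT_trans : transitive leT by move=> m m' m''; exact: le_trans.
pose t := sort leT (enum 'I_N).
have st : size t = N by rewrite size_sort size_enum_ord.
have ut : uniq t by rewrite sort_uniq enum_uniq.
have mt m : m \in t by rewrite mem_sort mem_enum.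
have idx m : (index m t < #|I|)%N by rewrite -[X in (_ < X)%N]NI -[X in (_ < X)%N]st index_mem.
exists (fun m => Ordinal (idx m)); split.
  apply: inj_card_bij; last by rewrite !card_ord NI.
  move=> m m' /(congr1 val) /= e; rewrite -(nth_index m (mt m)) e.
  by rewrite (set_nth_default m') ?nth_index// index_mem.
move=> m /=; set i := index m t; set v := vrad abs (Ys m).
have iN : (i < N)%N by rewrite -[X in (_ < X)%N]st index_mem.
have v0 : 0 < v by exact: horizontal_vrad.
have v1 : v <= 1 by exact: vrad_le1.
have tge j : (i <= j)%N -> (j < N)%N -> v <= vrad abs (Ys (nth m t j)).
  move=> ij jN; have := sorted_leq_nth leT_trans (fun x => lexx _) m (sort_sorted leT_total (enum 'I_N)).
  move=> /(_ i j); rewrite -/t !inE st => /(_ iN jN ij).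
  by rewrite /leT nth_index.
have tle j : (j <= i)%N -> vrad abs (Ys (nth m t j)) <= v.
  move=> ji; have := sorted_leq_nth leT_trans (fun x => lexx _) m (sort_sorted leT_total (enum 'I_N)).
  move=> /(_ j i); rewrite -/t !inE st => /(_ (leq_ltn_trans ji iN) iN ji).
  by rewrite /leT nth_index.
have vin : mset i v.
  have ni j : (j < N - i)%N -> (i + j < N)%N by lia.
  apply: (@mrad_mem (N - i) (fun n => Ys (nth m t (i + n)))) => //; last by rewrite NI.
    move=> n; split; first exact: hor.
    by apply/(vrad_geP _ v0 v1); apply: tge; [exact: leq_addr|exact: ni].
  move=> mu hmu n; pose nu m' := \sum_(n' < N - i | nth m t (i + n') == m') mu n'.
  have nu0 : forall m', nu m' = 0.
    apply: indep => c l; rewrite -[RHS](hmu c l).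
    rewrite [RHS](partition_big (fun n' : 'I_(N - i) => nth m t (i + n')) xpredT)//=.
    by apply: eq_bigr => m' _; rewrite /nu mulr_suml; apply: eq_bigr => n' /eqP->.
  have := nu0 (nth m t (i + n)); rewrite /nu (big_pred1 n)// => n' /=.
  rewrite nth_uniq ?st ?ni//; apply/eqP/eqP => [e|->//]; apply: val_inj => /=; lia.
apply/eqP; rewrite eq_le; apply/andP; split.
  by apply: ub_le_sup vin; exists 1 => s /= [/andP[_]].
apply: ge_sup; first by exists v.
move=> rho /= [/andP[r0 r1] [Z [hZ iZ]]]; rewrite leNgt; apply/negP => vr.
have /choice[Lam hLam] : forall n, exists lam : 'I_N -> k,
    forall c l, Z n c l = \sum_(m' < N) lam m' * Ys m' c l.
  by move=> n; have [hn _] := hZ n; exact: spans hn.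
pose A := [pred m' : 'I_N | rho <= vrad abs (Ys m')].
have cA : (#|A| < #|I| - i)%N.
  have sub : {subset enum A <= drop i.+1 t}.
    move=> m'; rewrite mem_enum inE => hm'; have jt := mt m'.
    have [ji|ij] := leqP (index m' t) i.
      have := tle _ ji; rewrite nth_index// => h.
      by move: (le_lt_trans (le_trans hm' h) vr); rewrite ltxx.
    rewrite -(nth_index m jt) -(subnKC ij) -nth_drop mem_nth// size_drop.
    by rewrite ltn_sub2r ?index_mem//; apply: leq_ltn_trans ij _; rewrite index_mem.
  rewrite cardE; apply: leq_ltn_trans (uniq_leq_size (enum_uniq _) sub) _.
  by rewrite size_drop st -NI; lia.
have [mu [n0 mun0] hmu] := lin_dep (fun n (j : 'I_#|A|) => Lam n (enum_val j)) cA.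
move/eqP: mun0; apply; apply: iZ => c l.
under eq_bigr => n _ do rewrite hLam mulr_sumr.
rewrite exchange_big big1// => m' _.
under eq_bigr => n _ do rewrite mulrA.
rewrite -mulr_suml; have [mA|mA] := boolP (m' \in A).
  rewrite -(enum_rankK_in mA mA); have := hmu (enum_rank_in mA m') => ->.
  by rewrite mul0r.
rewrite big1 ?mul0r// => n _; have [hn cn] := hZ n.
have [->|nz] := eqVneq (Lam n m') 0; first by rewrite mulr0.
by move: mA; rewrite inE (filt _ _ rho hn (hLam n) r0 r1 cn m' nz).
Qed.

End Radius.

Section Reduction.
Variables (A : comNzRingType) (d : nat).

Definition last_ord (j : 'I_d) : 'I_d :=
  Ordinal (eq_leq (ltn_predK (ltn_ord j)) : (d.-1 < d)%N).
Definition pred_ord (j : 'I_d) : 'I_d := Ordinal (leq_ltn_trans (leq_pred j) (ltn_ord j)).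

(* Multiplication by X modulo a monic polynomial X^d + sum P_j X^j, plus a constant. *)
Definition red_step (P w : 'I_d -> A) (c : A) (j : 'I_d) : A :=
  (if j == 0%N :> nat then c else w (pred_ord j)) - P j * w (last_ord j).

End Reduction.

Lemma red_stepE (A : comNzRingType) d (P w : 'I_d -> A) (c z : A) : (0 < d)%N ->
  \sum_(j < d) P j * z ^+ j + z ^+ d = 0 ->
  \sum_(j < d) red_step P w c j * z ^+ j = z * \sum_(j < d) w j * z ^+ j + c.
Proof.
case: d P w => // d P w _ hz.
have el (j : 'I_d.+1) : last_ord j = ord_max by apply: val_inj.
under eq_bigr => j _ do rewrite /red_step el mulrBl.
rewrite big_split /= sumrN.
have -> : \sum_(j < d.+1) P j * w ord_max * z ^+ j = - (w ord_max * z ^+ d.+1).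
  have -> : \sum_(j < d.+1) P j * w ord_max * z ^+ j = w ord_max * \sum_(j < d.+1) P j * z ^+ j.
    by rewrite mulr_sumr; apply: eq_bigr => j _; rewrite mulrCA mulrA.
  by rewrite -mulrN; congr (_ * _); apply/eqP; rewrite -addr_eq0 hz.
rewrite opprK big_ord_recl /= expr0 mulr1 [in RHS]big_ord_recr /= mulrDr [z * (_ * _)]mulrCA -exprS.
rewrite [RHS]addrAC; congr (_ + _); rewrite addrC; congr (_ + _); rewrite mulr_sumr; apply: eq_bigr => j _.
rewrite /bump /= add1n exprS mulrCA; congr (_ * (_ * _)); congr (w _).
by apply: val_inj.
Qed.

(** * The finite etale covering *)

Section Cover.
Implicit Types (x y z h : k) (s B T : R).
Hint Resolve abs_ge0 : core.

Variables (cl : bool) (d : nat) (f : ps k).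
Hypotheses (Hf_an : analytic abs cl f)
  (Hf_disc : forall x, in_disc abs cl x -> in_disc abs cl (ev f x))
  (Hf_etale : exists g, analytic abs cl g /\ psmul (psderiv f) g = psC 1)
  (Hf_deg : forall y, in_disc abs cl y -> exists s : seq k,
       [/\ uniq s, size s = d &
           forall x, (in_disc abs cl x /\ ev f x = y) <-> x \in s]).
Variables (Pc : 'I_d -> ps k).
Hypotheses (HPc_an : forall j, analytic abs cl (Pc j))
  (HP : forall n, \sum_(j < d) psmul (comp_an abs (Pc j) f) (pspow psX j) n
                  + pspow psX d n = 0).

Definition is_fiber (y : k) (l : seq k) := [/\ uniq l, size l = d &
  forall x, (in_disc abs cl x /\ ev f x = y) <-> x \in l].

Lemma in_disc0 : in_disc abs cl (0 : k).
Proof. by rewrite in_discE abs0; apply: radius_in_lt. Qed.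
Lemma in_disc_le1 x : in_disc abs cl x -> abs x <= 1.
Proof. by rewrite in_discE => /radius_in_le1. Qed.
Lemma in_disc_common (l : seq k) : (forall x, x \in l -> in_disc abs cl x) ->
  exists r, [/\ 0 < r, radius_in cl r & forall x, x \in l -> abs x <= r].
Proof.
move=> h; have [|r [r0 hr /allP hl]] := @radius_in_bigmax cl (map abs l).
  by apply/allP => _ /mapP[x xl ->]; have := h x xl; rewrite in_discE.
by exists r; split=> // x xl; apply: hl; exact: map_f.
Qed.

Lemma f_coef_le1 n : abs (f n) <= 1.
Proof.
apply: (analytic_coef_le1 Hf_an) => x hx; exact: in_disc_le1 (Hf_disc hx).
Qed.

Lemma f0_disc : in_disc abs cl (f 0%N).
Proof. by have := Hf_disc in_disc0; rewrite ev_at0. Qed.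

Lemma comp_an_ev g r x : analytic abs cl g -> 0 < r -> radius_in cl r -> abs x <= r ->
  cvr (comp_an abs g f) r /\ ev (comp_an abs g f) x = ev g (ev f x).
Proof.
move=> hg r0 hr xr; have r0' := ltW r0; have r1 := radius_in_le1 hr.
have hfr := analytic_cvr Hf_an r0' hr.
(* [comp_an] expands g at f(0) and substitutes f - f(0); the radius s is large enough for both the
   recentring and the values of f. *)
pose h := psadd f (psC (- f 0%N)); pose s := Num.max r (abs (f 0%N)).
have s0 : 0 < s by rewrite lt_max r0.
have hs : radius_in cl s by apply: radius_in_max => //; rewrite -in_discE f0_disc.
have hgs := analytic_cvr hg (ltW s0) hs.
have f0s : abs (f 0%N) <= s by rewrite le_max lexx orbT.
have h0 : h 0%N = 0 by rewrite /h /psadd /psC /= subrr.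
have hh : gle h r s.
  move=> [|n]; first by rewrite h0 abs0 mul0r ltW.
  rewrite /h /psadd /psC /= addr0 le_max; apply/orP; left.
  rewrite -[X in _ <= X]mul1r ler_pM ?exprn_ge0 ?f_coef_le1//.
  by rewrite exprS ler_piMr// exprn_ile1.
have ch : cvr h r by apply: (cvrD r0' hfr (cvrC _ r0')).
have cg := cvr_reexp s0 f0s hgs.
split; first exact: (cvr_comp r0' (ltW s0) h0 hh ch cg).
rewrite (ev_comp xr (ltW s0) h0 hh ch cg).
have E : ev h x = ev f x - f 0%N.
  by rewrite (evD xr hfr (cvrC _ r0')) evC.
rewrite (ev_reexp s0 f0s _ hgs); last first.
  exact: (ev_gle xr ch).
by rewrite E subrK.
Qed.

Lemma charpoly_root x : in_disc abs cl x ->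
  \sum_(j < d) ev (Pc j) (ev f x) * x ^+ j + x ^+ d = 0.
Proof.
move=> hx; have [|r [r0 hr xr]] := @in_disc_common [:: x].
  by move=> y; rewrite inE => /eqP->.
have {}xr : abs x <= r by apply: xr; rewrite inE.
have r0' := ltW r0; have cX m : cvr (psX ^+ m) r by apply: cvr_exp => //; exact: cvrX.
have evX m : ev (psX ^+ m) x = x ^+ m by rewrite (ev_exp _ xr (cvrX r0')) evX.
have E : \sum_(j < d) comp_an abs (Pc j) f * psX ^+ j + psX ^+ d = 0 :> ps k.
  apply/funext=> n; rewrite psDE ps_sumE -[RHS](HP n) !pspowE; congr (_ + _).
  by apply: eq_bigr => j _; rewrite pspowE.
have cc j : cvr (comp_an abs (Pc j) f) r by have [] := comp_an_ev (HPc_an j) r0 hr xr.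
have := congr1 (fun g => ev g x) E; rewrite ev0.
rewrite (evD xr (_ : cvr _ r) (cX d)); last first.
  apply: cvr_sum => // j _; exact: cvrM.
rewrite (ev_sum _ xr); last by move=> j _; exact: cvrM.
rewrite evX => h; rewrite -[RHS]h; congr (_ + _); apply: eq_bigr => j _.
rewrite (evM xr (cc j) (cX j)) evX; congr (_ * _).
by have [_ ->] := comp_an_ev (HPc_an j) r0 hr xr.
Qed.

Definition charpoly y : {poly k} := \sum_(j < d) ev (Pc j) y *: 'X^j + 'X^d.

Lemma charpolyE y x : (charpoly y).[x] = \sum_(j < d) ev (Pc j) y * x ^+ j + x ^+ d.
Proof.
rewrite hornerD horner_sum hornerXn; congr (_ + _).
by apply: eq_bigr => j _; rewrite !hornerE.
Qed.

Lemma charpoly_fiber y l : is_fiber y l -> charpoly y = \prod_(z <- l) ('X - z%:P).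
Proof.
move=> [ul sl hl]; have szs : (size (\sum_(j < d) ev (Pc j) y *: 'X^j : {poly k})%R < d.+1)%N.
  rewrite ltnS; apply: (big_ind (fun q : {poly k} => (size q <= d)%N)) => [|u v hu hv|i _].
  - by rewrite size_poly0.
  - by rewrite (leq_trans (size_polyD _ _))// geq_max hu hv.
  - by rewrite (leq_trans (size_scale_leq _ _))// size_polyXn ltn_ord.
have sP : size (charpoly y) = d.+1 by rewrite /charpoly addrC size_polyDl size_polyXn.
have lP : lead_coef (charpoly y) = 1.
  by rewrite /charpoly addrC lead_coefDl ?lead_coefXn// size_polyXn.
rewrite (@all_roots_prod_XsubC _ (charpoly y) l).
- by rewrite lP scale1r.
- by rewrite sP sl.
- by apply/allP => x /hl[hx <-]; rewrite /root charpolyE charpoly_root.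
- by rewrite uniq_rootsE.
Qed.

Lemma fiber_le1 y l z : is_fiber y l -> z \in l -> abs z <= 1.
Proof. by move=> [_ _ h] /h[/in_disc_le1]. Qed.

(** The values of [Pc j] are, up to sign, symmetric functions of the points of a fibre, hence of
    absolute value at most 1. *)
Lemma Pc_coef_le1 j n : abs (Pc j n) <= 1.
Proof.
apply: (analytic_coef_le1 (HPc_an j)) => y /Hf_deg[l hl].
have -> : ev (Pc j) y = (charpoly y)`_j.
  rewrite coefD coef_sum coefXn ltn_eqF ?addr0 ?ltn_ord// (bigD1 j)//= coefZ coefXn eqxx mulr1.
  rewrite big1 ?addr0// => i ij; rewrite coefZ coefXn; case: eqP => [e|]; rewrite ?mulr0//.
  by move/eqP: ij; case; apply: val_inj.
rewrite (charpoly_fiber hl); apply: prod_XsubC_coef_le => z; exact: fiber_le1 hl.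
Qed.

(* The quotient of f - y by prod (X - z) has coefficients of absolute value at most 1, and
   conversely P(y, x) = P(y, x) - P(f x, x) is bounded by |y - f x|. *)
Lemma dist_fiber x y l : in_disc abs cl x -> in_disc abs cl y -> is_fiber y l ->
  abs (ev f x - y) = \prod_(z <- l) abs (x - z).
Proof.
move=> hx hy hl; apply/eqP; rewrite eq_le; apply/andP; split; last first.
  have -> : \prod_(z <- l) abs (x - z) = abs (charpoly y).[x].
    rewrite (charpoly_fiber hl) horner_prod abs_prod.
    by apply: eq_bigr => z _; rewrite !hornerE.
  rewrite charpolyE -[X in abs X]subr0 -[X in _ - X](charpoly_root hx) opprD addrACA subrr addr0 -sumrN -big_split /=.
  apply: abs_sum_le => // j _; rewrite -mulrBl absM.
  rewrite -[X in _ <= X]mulr1 ler_pM//.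
    rewrite (absB (ev f x)).
    exact: (ev_lipschitz (HPc_an j) (Pc_coef_le1 j) hy (Hf_disc hx)).
  by rewrite absX exprn_ile1// in_disc_le1.
have [ul sl hl'] := hl.
have [|r0 [r00 hr0 xr0]] := @in_disc_common [:: x, y & l].
  by move=> z; rewrite !inE => /or3P[/eqP->//|/eqP->//|/hl'[]].
have P0 : 0 <= \prod_(z <- l) abs (x - z) by apply: prodr_ge0.
have main r : r0 <= r -> radius_in cl r -> abs (ev f x - y) * r ^+ d <= \prod_(z <- l) abs (x - z).
  move=> r0r hr; have rp := lt_le_trans r00 r0r; have rp' := ltW rp; have r1 := radius_in_le1 hr.
  have hfr := analytic_cvr Hf_an rp' hr.
  have xr z : z \in [:: x, y & l] -> abs z <= r by move=> /xr0 /le_trans; apply.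
  have E z : abs z <= r -> ev (f - psC y) z = ev f z - y.
    by move=> zr; rewrite (evB zr hfr (cvrC _ rp')) evC.
  rewrite -E ?xr ?mem_head// -sl -[X in _ <= X]mul1r.
  apply: zeros_bound => //.
  - by apply: xr; rewrite mem_head.
  - by move=> z zl; apply: xr; rewrite !inE zl !orbT.
  - by apply: (cvrD rp' hfr); apply: cvrN; exact: cvrC.
  - apply: gle1 => // n; rewrite psBE; apply: abs_sub_le; first exact: f_coef_le1.
    by rewrite /psC; case: eqP => _; rewrite ?abs0// in_disc_le1.
  - by move=> z zl; rewrite E ?xr ?inE ?zl ?orbT//; have /hl'[_ ->] := zl; rewrite subrr.
have [r01|r01] := ltP r0 1; last first.
  have r1 : r0 = 1 by apply/eqP; rewrite eq_le r01 (radius_in_le1 hr0).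
  by have := main r0 (lexx _) hr0; rewrite r1 expr1n mulr1.
apply: (@pow_limit _ _ r0 d) => // c rc c1; apply: main; first exact: ltW.
exact: radius_in_lt.
Qed.

(** Apply [dist_fiber] at x + c with c small and cancel |c|: the left side becomes |f'(x)|, the
    other distances do not change. *)
Lemma deriv_fiber x y l : in_disc abs cl y -> is_fiber y l -> x \in l ->
  abs (ev (psderiv f) x) <= \prod_(z <- l | z != x) abs (x - z).
Proof.
move=> hy hl xl; have [ul sl hl'] := hl; have [hx fx] := (hl' x).2 xl.
have [|r [r0 hr xr]] := @in_disc_common [:: x].
  by move=> z; rewrite inE => /eqP->.
have {}xr : abs x <= r by apply: xr; rewrite inE.
have hfr := analytic_cvr Hf_an (ltW r0) hr; have r1 := radius_in_le1 hr.
have [D0|D0] := eqVneq (ev (psderiv f) x) 0; first by rewrite D0 abs0 prodr_ge0.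
have P0 z : z \in l -> z != x -> 0 < abs (x - z) by move=> _ zx; rewrite abs_gt0 subr_eq0 eq_sym.
have [m [m0 mr ml]] : exists m, [/\ 0 < m, m <= r & forall z, z \in l -> z != x -> m <= abs (x - z)].
  elim: (l) P0 => [|z l0 IH] P0; first by exists r.
  have [w wl|m [m0 mr ml]] := IH; first by apply: P0; rewrite inE wl orbT.
  have [zx|zx] := eqVneq z x.
    by exists m; split=> // w; rewrite inE => /orP[/eqP->|/ml//]; rewrite zx eqxx.
  exists (Num.min m (abs (x - z))); split.
  - by rewrite lt_min m0 P0 ?mem_head.
  - by rewrite ge_min mr.
  - by move=> w; rewrite inE => /orP[/eqP-> _|/ml h /h h']; rewrite ge_min ?h' ?lexx ?orbT.
(* Below m, the shift by c leaves the distances to the other points z unchanged; below |f'(x)| r^2,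
   the linear term dominates the remainder, bounded by |c| / r^2. *)
have [c c0 cm] : exists2 c, 0 < abs c & abs c < Num.min (Num.min m 1) (abs (ev (psderiv f) x) * r ^+ 2).
  have pos : 0 < abs (ev (psderiv f) x) * r ^+ 2 by rewrite mulr_gt0 ?exprn_gt0 ?abs_gt0.
  apply: abs_dense => //; first by rewrite !lt_min m0 ltr01.
  by rewrite !ge_min lexx orbT.
move: cm; rewrite !lt_min => /andP[/andP[cm _] cD].
have cr : abs c <= r by rewrite ltW// (lt_le_trans cm).
have hG := cvr_reexp r0 xr hfr.
have E : ev f (x + c) - y = c * (ev (psderiv f) x + c * ev (psshift (psshift (reexp abs f x))) c).
  rewrite [x + c]addrC -(ev_reexp r0 xr cr hfr) (ev_shift r0 cr hG).
  rewrite (ev_shift r0 cr (cvr_shift r0 hG)) (reexp_coef0 r0 xr hfr) fx addrAC subrr add0r.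
  by rewrite {1}/psshift reexp_coef1.
have hxc : in_disc abs cl (x + c).
  rewrite in_discE; apply: radius_in_le hr; exact: abs_add_le.
have := dist_fiber hxc hy hl; rewrite E absM abs_dom; last first.
  rewrite absM; apply: le_lt_trans (_ : abs c * (1 / r / r) < _).
    rewrite ler_wpM2l//; apply: (ev_gle cr).
      by do 2!apply: cvr_shift => //.
    do 2!apply: gle_shift => //; apply: gle_reexp => //.
    by apply: gle1 (ltW r0) r1 f_coef_le1.
  have -> : 1 / r / r = (r ^+ 2)^-1 by rewrite expr2 invfM mul1r.
  by rewrite ltr_pdivrMr ?exprn_gt0.
rewrite (bigD1_seq x)//= addrC addKr => /(mulfI (lt0r_neq0 c0)) ->.
rewrite le_eqVlt; apply/orP; left; apply/eqP.
rewrite big_seq_cond [RHS]big_seq_cond; apply: eq_bigr => z /andP[zl zx].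
have cz : abs c < abs (x - z) by exact: lt_le_trans cm (ml _ zl zx).
by rewrite addrAC (abs_dom cz).
Qed.

Lemma deriv_lower r : 0 < r -> radius_in cl r -> exists2 c, 0 < c &
  forall x, abs x <= r -> c <= abs (ev (psderiv f) x).
Proof.
move=> r0 hr; have [g [hg e]] := Hf_etale.
have hgr := analytic_cvr hg (ltW r0) hr; have [B B0 hB] := cvr_gle hgr.
have hd := cvr_deriv r0 (analytic_cvr Hf_an (ltW r0) hr).
(* B bounds the inverse of f'; adding 1 keeps the denominator positive. *)
exists (B + 1)^-1 => [|x xr]; first by rewrite invr_gt0 ltr_wpDl.
have : ev (psderiv f * g) x = 1 by rewrite [psderiv f * g]e evC.
rewrite (evM xr hd hgr) => /(congr1 abs); rewrite absM abs1 => h.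
have g1 : abs (ev g x) <= B + 1.
  by apply: le_trans (ev_gle xr hgr hB) _; rewrite lerDl.
have g0 : 0 < abs (ev g x).
  rewrite lt0r abs_ge0 andbT; apply/eqP => g0; move/eqP: h; rewrite g0 mulr0 eq_sym.
  by rewrite oner_eq0.
have -> : abs (ev (psderiv f) x) = (abs (ev g x))^-1.
  by apply: (mulIf (lt0r_neq0 g0)); rewrite h mulVf ?lt0r_neq0.
by rewrite lef_pV2// posrE ltr_wpDl.
Qed.

(** * The fibre over b and the images of discs *)

Variables (b : k) (a : 'I_d -> k).
Hypotheses (Hb : in_disc abs cl b) (Ha_inj : injective a)
  (Ha : forall i, in_disc abs cl (a i) /\ ev f (a i) = b).

Lemma d_gt0 : (0 < d)%N.
Proof.
have [l [_ <- hl]] := Hf_deg f0_disc.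
have : 0 \in l by apply/hl; rewrite ev_at0; split=> //; exact: in_disc0.
by case: (l).
Qed.

Hint Resolve d_gt0 : core.

Lemma fiber_b : is_fiber b (codom a).
Proof.
have [l [ul sl hl]] := Hf_deg Hb; have ua : uniq (codom a) by apply/injectiveP.
have sa : size (codom a) = d by rewrite size_codom card_ord.
have sub : {subset codom a <= l} by move=> _ /codomP[i ->]; apply/hl.
have [_ e] := uniq_min_size ua sub (eq_leq (etrans sl (esym sa))).
by split=> // x; rewrite e; exact: hl.
Qed.

Lemma dist_b x : in_disc abs cl x -> abs (ev f x - b) = \prod_(j < d) abs (x - a j).
Proof.
move=> hx; rewrite (dist_fiber hx Hb fiber_b) /codom /image_mem big_map big_enum.
by [].
Qed.

(* the radius of the disc f(D(c, r^-)) when this disc contains b *)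
Definition image_radius (c : k) (r : R) := \prod_(j < d) Num.max r (abs (c - a j)).

Lemma image_radius_gt0 c r : 0 < r -> 0 < image_radius c r.
Proof. by move=> r0; apply: prodr_gt0 => j _; rewrite lt_max r0. Qed.
Lemma image_radius_le c r r' : 0 <= r -> r <= r' -> image_radius c r <= image_radius c r'.
Proof.
move=> r0 rr; apply: ler_prod => j _; rewrite le_max r0/= ge_max !le_max rr lexx.
by rewrite orbT.
Qed.
Lemma lt_image_radius (F : 'I_d -> R) c r i : 0 < r ->
  (forall j, 0 <= F j <= Num.max r (abs (c - a j))) -> F i < Num.max r (abs (c - a i)) ->
  \prod_(j < d) F j < image_radius c r.
Proof.
move=> r0 hF hi; rewrite /image_radius (bigD1 i)//= [X in _ < X](bigD1 i)//=.
apply: le_lt_trans (_ : F i * \prod_(j < d | j != i) Num.max r (abs (c - a j)) < _).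
  by rewrite ler_wpM2l//; [case/andP: (hF i)|apply: ler_prod].
by rewrite ltr_pM2r// prodr_gt0// => j _; rewrite lt_max r0.
Qed.
Lemma image_radius_lt c r r' i : 0 <= r -> r < r' -> abs (c - a i) < r' ->
  image_radius c r < image_radius c r'.
Proof.
move=> r0 rr ci; apply: (@lt_image_radius _ _ _ i); first exact: le_lt_trans rr.
  by move=> j; rewrite le_max r0/= ge_max !le_max (ltW rr) lexx orbT.
by rewrite gt_max !lt_max rr ci.
Qed.
Lemma image_radius_center c c' r : abs (c - c') <= r -> image_radius c r = image_radius c' r.
Proof.
move=> cc; apply: eq_bigr => j _; apply/eqP; rewrite eq_le !ge_max !le_max lexx/=.
have h u v : abs (u - v) <= r -> (abs (u - a j) <= r) || (abs (u - a j) <= abs (v - a j)).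
  move=> uv; have := abs_tri u v (a j); rewrite le_max => /orP[h|->]; last by rewrite orbT.
  by rewrite (le_trans h uv).
by rewrite h//= h// absB.
Qed.
Lemma image_radius1 c : in_disc abs cl c -> image_radius c 1 = 1.
Proof.
move=> hc; apply: big1 => j _; apply: max_l; apply: abs_sub_le; apply: in_disc_le1 => //.
by have [] := Ha j.
Qed.
(** Quantitative continuity in r: each of the d factors shrinks at most by t. It allows r to move a
    little without the image radius crossing a given value. *)
Lemma image_radius_scale c r t : 0 <= r -> 0 <= t <= 1 ->
  t ^+ d * image_radius c r <= image_radius c (t * r).
Proof.
move=> r0 /andP[t0 t1]; rewrite -[t ^+ d](_ : \prod_(j < d) t = _); last by rewrite prodr_const card_ord.
rewrite -big_split /=; apply: ler_prod => j _.
rewrite mulr_ge0//=; last by rewrite le_max r0.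
rewrite maxr_pMr// ge_max !le_max lexx/=.
by apply/orP; right; rewrite ler_piMl.
Qed.
Lemma image_radius_shrink c r s : 0 < r -> s < image_radius c r ->
  exists r', [/\ 0 < r', r' < r & s < image_radius c r'].
Proof.
move=> r0 sr; have ir0 := image_radius_gt0 c r0.
have t1 : s / image_radius c r < 1 by rewrite ltr_pdivrMr// mul1r.
have [t [h1 _ t0 t1']] := abs_root_near1 d.-1 t1.
rewrite prednK ?d_gt0// in h1.
exists (abs t * r); split; [exact: mulr_gt0|by rewrite gtr_pMl|].
apply: lt_le_trans (image_radius_scale c (ltW r0) _); last by rewrite abs_ge0 ltW.
by rewrite -ltr_pdivrMr.
Qed.
Lemma image_radius_grow c r s : 0 < r -> r < 1 -> image_radius c r < s ->
  exists r', [/\ r < r', r' <= 1 & image_radius c r' <= s].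
Proof.
move=> r0 r1 rs; have ir0 := image_radius_gt0 c r0; have s0 := lt_trans ir0 rs.
have t1 : image_radius c r / s < 1 by rewrite ltr_pdivrMr// mul1r.
have [t [h1 _ t0 t1']] := abs_root_near1 d.-1 t1.
rewrite prednK ?d_gt0// in h1.
have rt : r < r / abs t by rewrite ltr_pdivlMr// gtr_pMr.
exists (Num.min (r / abs t) 1); split; [by rewrite lt_min rt r1|by rewrite ge_min lexx orbT|].
apply: le_trans (_ : image_radius c (r / abs t) <= s).
  apply: image_radius_le; rewrite ?ge_min ?lexx//.
  by rewrite le_min ler01 divr_ge0// ltW.
have := @image_radius_scale c (r / abs t) (abs t); rewrite divr_ge0 ?(ltW r0)// abs_ge0 (ltW t1').
move=> /(_ isT isT); rewrite [abs t * _]mulrC divfK ?lt0r_neq0// => h.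
rewrite -(ler_pM2l (exprn_gt0 d t0)); apply: le_trans h _.
by rewrite -ler_pdivrMr// ltW.
Qed.

Lemma in_disc_sub c r x : in_disc abs cl c -> r <= 1 -> abs (x - c) < r -> in_disc abs cl x.
Proof.
move=> hc r1 xc; rewrite -(subrK c x) in_discE.
apply: radius_in_le (_ : radius_in cl (Num.max (abs (x - c)) (abs c))); first exact: abs_addr _ _.
apply: radius_in_max; last by rewrite -in_discE.
apply: radius_in_lt; exact: lt_le_trans r1.
Qed.

(** For a nearest a_i, the distance from x to a_j is the maximum of |x - a_i| and |a_i - a_j|. *)
Lemma dist_b_nearest x : in_disc abs cl x -> exists i,
  (forall j, abs (x - a i) <= abs (x - a j)) /\ abs (ev f x - b) = image_radius (a i) (abs (x - a i)).
Proof.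
move=> hx; have i0 := Ordinal d_gt0.
case: (@Order.TotalTheory.arg_minP _ _ 'I_d i0 xpredT (fun i => abs (x - a i))) => // i _ hi.
exists i; split=> [j|]; first exact: hi.
rewrite dist_b//; apply: eq_bigr => j _; apply/eqP; rewrite eq_le; apply/andP; split.
  by have := abs_tri x (a i) (a j).
rewrite ge_max hi//=; apply: (abs_tri_le (y := x)) => //.
by rewrite absB hi.
Qed.

Lemma image_discP c r i : in_disc abs cl c -> 0 < r -> r <= 1 -> abs (c - a i) < r ->
  image_disc abs f b (c, r) (image_radius c r).
Proof.
move=> hc r0 r1 ci y /=; split=> [[x [xc <-]]|yb].
  have hx := in_disc_sub hc r1 xc; rewrite -/(ev f x) dist_b//.
  have hj j : abs (x - a j) <= Num.max r (abs (c - a j)).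
    apply: le_trans (abs_tri x c (a j)) _.
    by rewrite ge_max !le_max lexx (ltW xc) orbT.
  apply: (@lt_image_radius _ _ _ i) => // [j|]; first by rewrite abs_ge0 hj.
  by rewrite lt_max (abs_tri_lt xc).
have ir1 : image_radius c r <= 1 by rewrite -(image_radius1 hc) image_radius_le// ltW.
have hy : in_disc abs cl y by apply: in_disc_sub Hb ir1 yb.
have [l hl] := Hf_deg hy; have hl' : is_fiber y l by [].
have [/hasP[z zl zc]|/hasPn H] := boolP (has (fun z => abs (z - c) < r) l).
  by have [_ _ h] := hl'; have /h[hz fz] := zl; exists z.
(* If the fibre of y missed D(c, r^-), |f - y| would be constant there, equal to its value |b - y|
   at a_i; then |f - b| <= |y - b| on the whole disc, against a generic point of it. *)
exfalso.
have far x z : abs (x - c) < r -> z \in l -> abs (x - z) = abs (c - z).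
  move=> xc zl; have := H z zl; rewrite -leNgt absB => cz.
  rewrite (abs_iso (y := c)); first exact: absB _ _.
  by rewrite (absB c); exact: lt_le_trans cz.
have [r' [r'0 r'r hr']] := image_radius_shrink r0 yb.
have [e re er] := abs_dense (ltW r'0) r'r r1.
have e0 : e != 0 by rewrite -abs_gt0 (lt_trans r'0).
have [x xc xa] := generic_point c a e0.
have xcr := le_lt_trans xc er; have hx := in_disc_sub hc r1 xcr.
have fxb : abs (y - b) < abs (ev f x - b).
  apply: lt_le_trans hr' _; rewrite dist_b//; apply: ler_prod => j _.
  rewrite le_max (ltW r'0)/= ge_max (le_trans (ltW re))//=.
  have := abs_tri c x (a j); rewrite le_max => /orP[h|//].
  by rewrite (le_trans h)// absB (le_trans xc).
have fxy w : abs (w - c) < r -> abs (ev f w - y) = \prod_(z <- l) abs (c - z).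
  move=> wc; have hw := in_disc_sub hc r1 wc.
  rewrite (dist_fiber hw hy hl') big_seq [RHS]big_seq; apply: eq_bigr => z zl.
  exact: far.
have aic : abs (a i - c) < r by rewrite absB.
have := fxy _ aic; have [_ ->] := Ha i; rewrite absB -(fxy _ xcr) => e1.
move: fxb; rewrite ltNge => /negP; apply; apply: (abs_tri_le (y := y)) => //.
by rewrite -e1.
Qed.


(** * Pull-back of the direct image to the points a_i *)

Variables (u : 'I_d -> ps k).
Hypotheses (Hu0 : forall i, u i 0%N = a i)
  (HuP : forall i n, \sum_(j < d) psmul (reexp abs (Pc j) b) (pspow (u i) j) n
                     + pspow (u i) d n = 0).
Variables (V : 'I_d -> 'I_d -> ps k).
Hypotheses (HVU : forall (i i' : 'I_d) n, \sum_(j < d) psmul (V i j) (pspow (u j) i') n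
                        = psC ((i == i')%:R) n)
  (HUV : forall (i i' : 'I_d) n, \sum_(j < d) psmul (pspow (u i) j) (V j i') n
                        = psC ((i == i')%:R) n).
Variables (r : nat) (G : 'I_r -> 'I_r -> ps k).
Hypothesis HG : forall i j, analytic abs cl (G i j).
Variables (H : 'I_r * 'I_d -> 'I_r * 'I_d -> ps k).
Hypotheses (HH_an : forall y0 z0 : 'I_r * 'I_d, analytic abs cl (H y0 z0))
  (HH : forall (j : 'I_r) (l : 'I_d) (i : 'I_r),
      psmul (psderiv f)
        (fun n => \sum_(m < d) psmul (comp_an abs (H (i, m) (j, l)) f) (pspow psX m) n)
      = psadd (if i == j then (fun n => pspow psX l.-1 n *+ l) else (fun=> 0))
              (psmul (pspow psX l) (G i j))).



Let in_disc_a i : in_disc abs cl (a i). Proof. by have [] := Ha i. Qed.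

(* the expansion of f - b at a_i, and the coordinate t at a_i *)
Definition locf i : ps k := reexp abs f (a i) - psC b.
Definition loct i : ps k := psC (a i) + psX.

Lemma locf0 i : locf i 0%N = 0.
Proof.
have [|q [q0 hq aq]] := @in_disc_common [:: a i].
  by move=> x; rewrite inE => /eqP->; exact: in_disc_a.
have aiq : abs (a i) <= q by apply: aq; rewrite inE.
rewrite /locf psBE (reexp_coef0 q0 aiq (analytic_cvr Hf_an (ltW q0) hq)).
by have [_ ->] := Ha i; rewrite subrr.
Qed.

Hint Resolve locf0 : core.

Lemma locf_conv i : conv_on (locf i) 1.
Proof.
have [h _] := reexp_analytic Hf_an (in_disc_a i).
by apply: conv_onD => //; apply: conv_onN; exact: conv_onC.
Qed.
Lemma ev_locf i x : abs x < 1 -> ev (locf i) x = ev f (x + a i) - b.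
Proof.
move=> x1; have [h e] := reexp_analytic Hf_an (in_disc_a i).
rewrite (conv_evD h (conv_onN (conv_onC b (T := 1))) x1) (conv_evN (conv_onC b (T := 1)) x1).
by rewrite evC e.
Qed.
Lemma in_disc_add i x : abs x < 1 -> in_disc abs cl (x + a i).
Proof.
move=> x1; rewrite in_discE; apply: radius_in_le (abs_addr _ _) _.
by apply: radius_in_max; [exact: radius_in_lt|rewrite -in_discE in_disc_a].
Qed.
Lemma loct_conv i T : conv_on (loct i) T.
Proof. by apply: conv_onD; [exact: conv_onC|exact: conv_onX]. Qed.
Lemma ev_loct i x : ev (loct i) x = x + a i.
Proof.
rewrite (evD (lexx (abs x))); first by rewrite evC evX addrC.
  exact: cvrC.
exact: cvrX.
Qed.

(** Obtained from the values of f - b through [gauss_le]; it lets series converging on the image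
    disc be composed with [locf i]. *)
Lemma gle_locf i (c : k) : c != 0 -> abs c < 1 -> gle (locf i) (abs c) (image_radius (a i) (abs c)).
Proof.
move=> c0 c1; have c0' : 0 < abs c by rewrite abs_gt0.
apply: (gauss_le c0).
- exact/ltW/image_radius_gt0.
- exact: (conv_on_cvr (locf_conv i)).
move=> x xc; have x1 := le_lt_trans xc c1; rewrite ev_locf// dist_b; last exact: in_disc_add.
apply: ler_prod => j _; rewrite abs_ge0/= -addrA.
apply: le_trans (abs_addr _ _) _; rewrite ge_max !le_max xc/=.
by rewrite lexx orbT.
Qed.

Lemma pull_conv i Z S T : conv_on Z S -> 0 < T -> T <= 1 -> image_radius (a i) T <= S ->
  conv_on (pscomp Z (locf i)) T /\
  forall x, abs x < T -> ev (pscomp Z (locf i)) x = ev Z (ev f (x + a i) - b).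
Proof.
move=> hZ T0 T1 hT.
have main q : 0 <= q -> q < T -> exists2 c, q < abs c & cvr (pscomp Z (locf i)) (abs c) /\
    forall x, abs x <= abs c -> ev (pscomp Z (locf i)) x = ev Z (ev f (x + a i) - b).
  move=> q0 qT; have [c qc cT] := abs_dense q0 qT T1.
  exists c => //; have c0' := le_lt_trans q0 qc.
  have c0 : c != 0 by rewrite -abs_gt0.
  have c1 := lt_le_trans cT T1; have gF := gle_locf i c0 c1.
  have lt1 : image_radius (a i) (abs c) < S.
    apply: lt_le_trans hT; apply: (image_radius_lt (i := i)) => //.
    by rewrite subrr abs0.
  have ir0 := image_radius_gt0 (a i) c0'.
  have cF : cvr (locf i) (abs c) by exact: (conv_on_cvr (locf_conv i)).
  have cZ : cvr Z (image_radius (a i) (abs c)) by exact: (conv_on_cvr hZ (ltW ir0)).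
  split; first exact: (cvr_comp _ (ltW ir0) (locf0 i) gF cF cZ).
  move=> x xc; rewrite (ev_comp xc (ltW ir0) (locf0 i) gF cF cZ) ev_locf//.
  exact: le_lt_trans c1.
split=> [|x xT].
  apply/conv_onP => q /andP[q0 qT]; have [c /ltW qc [h _]] := main q q0 qT.
  exact: cvr_le h.
by have [c /ltW xc [_ ->]] := main _ (abs_ge0 x) xT.
Qed.

Lemma image_radius_le_id i T : 0 <= T -> T <= 1 -> image_radius (a i) T <= T.
Proof.
move=> T0 T1; rewrite /image_radius (bigD1 i)//= subrr abs0 max_l//.
rewrite ler_piMr//; apply: prodr_ile1 => j _; rewrite le_max T0/= ge_max T1/=.
by apply: abs_sub_le; apply: in_disc_le1; exact: in_disc_a.
Qed.

Lemma locf1_neq0 i : locf i 1%N != 0.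
Proof.
have -> : locf i 1%N = ev (psderiv f) (a i).
  by rewrite /locf psBE /psC /= subr0 reexp_coef1.
have [|q [q0 hq aq]] := @in_disc_common [:: a i].
  by move=> x; rewrite inE => /eqP->; exact: in_disc_a.
have [c c0 hc] := deriv_lower q0 hq.
by rewrite -abs_gt0; apply: lt_le_trans (hc _ (aq _ _)); rewrite ?inE.
Qed.

Lemma analytic_pull i g : analytic abs cl g -> 
  conv_on (pscomp (reexp abs g b) (locf i)) 1 /\
  forall x, abs x < 1 -> ev (pscomp (reexp abs g b) (locf i)) x = ev g (ev f (x + a i)).
Proof.
move=> hg; have [hr er] := reexp_analytic hg Hb.
have [hc ec] := pull_conv hr ltr01 (lexx _) (image_radius_le_id i ler01 (lexx _)).
split=> // x x1; rewrite ec// er ?subrK//.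
rewrite dist_b; last exact: in_disc_add.
apply: lt_le_trans (image_radius_le_id i ler01 (lexx _)).
apply: (lt_image_radius (i := i)) => // [j|].
  rewrite abs_ge0 le_max /=; apply/orP; left; apply: abs_sub_le; apply: in_disc_le1 => //.
  exact: in_disc_add.
by rewrite addrK lt_max x1.
Qed.

Lemma loct_root i : \sum_(j < d) pscomp (reexp abs (Pc j) b) (locf i) * loct i ^+ j + loct i ^+ d = 0.
Proof.
have c1 j : conv_on (pscomp (reexp abs (Pc j) b) (locf i) * loct i ^+ j) 1.
  apply: conv_onM; first by have [] := analytic_pull i (HPc_an j).
  by apply: conv_on_exp; exact: loct_conv.
have c2 : conv_on (loct i ^+ d) 1 by apply: conv_on_exp; exact: loct_conv.
have c3 := conv_on_sum (index_enum 'I_d) (P := xpredT) (fun j _ => c1 j).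
apply: (conv_ev_inj ltr01) => [||x x1]; first exact: conv_onD.
  exact: conv_on0.
rewrite (conv_evD c3 c2 x1) ev0 (conv_ev_sum _ (fun j _ => c1 j) x1).
rewrite (conv_ev_exp d (loct_conv i (T := 1)) x1) ev_loct.
rewrite -[RHS](charpoly_root (in_disc_add i x1)).
congr (_ + _); apply: eq_bigr => j _.
have [hc ec] := analytic_pull i (HPc_an j).
rewrite (conv_evM hc (conv_on_exp j (loct_conv i (T := 1))) x1) ec//.
by rewrite (conv_ev_exp j (loct_conv i (T := 1)) x1) ev_loct.
Qed.

(* a_i is a simple root of P(b, X), so P has only one root with constant term a_i. *)
Lemma u_locf i : pscomp (u i) (locf i) = loct i.
Proof.
set w := pscomp (u i) (locf i); set t := loct i.
pose A j := pscomp (reexp abs (Pc j) b) (locf i).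
have Ew : \sum_(j < d) A j * w ^+ j + w ^+ d = 0.
  have E : \sum_(j < d) (reexp abs (Pc j) b : ps k) * u i ^+ j + u i ^+ d = 0.
    apply/funext=> n; rewrite psDE ps_sumE -[RHS](HuP i n) !pspowE; congr (_ + _).
    by apply: eq_bigr => j _; rewrite pspowE.
  have := congr1 (fun g => pscomp g (locf i)) E; rewrite pscomp0 pscompD pscomp_sum => h.
  rewrite -[RHS]h; congr (_ + _); last by rewrite pscompX_exp ?locf0.
  by apply: eq_bigr => j _; rewrite pscompM ?locf0// pscompX_exp ?locf0.
have w0 : w 0%N = a i by rewrite /w pscomp_coef0 ?locf0.
have t0 : t 0%N = a i by rewrite /t /loct psDE /psC /psX /= addr0.
(* Q below is the divided difference of P at w and t; its constant term is the derivative of P(b, X)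
   at the simple root a_i. *)
pose S j : ps k := \sum_(m < j) w ^+ (j.-1 - m) * t ^+ m.
pose Q := \sum_(j < d) A j * S j + S d.
have EQ : (w - t) * Q = 0.
  have -> : (w - t) * Q = (\sum_(j < d) A j * w ^+ j + w ^+ d) - (\sum_(j < d) A j * t ^+ j + t ^+ d).
    have key (g1 g2 g3 g4 : ps k) : g1 + g2 - (g3 + g4) = (g1 - g3) + (g2 - g4).
      by rewrite opprD addrACA.
    rewrite key /Q mulrDr; congr (_ + _); last by rewrite subrXX.
    rewrite mulr_sumr -sumrN -big_split /=; apply: eq_bigr => j _.
    by rewrite mulrCA -subrXX mulrBr.
  by rewrite Ew loct_root subr0.
apply/eqP; rewrite -subr_eq0; apply/eqP; apply: (ps_mulr_eq0 _ EQ).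
have S0 j : S j 0%N = a i ^+ j.-1 *+ j.
  rewrite /S ps_sumE; under eq_bigr => m _ do rewrite psM0 !ps_exp0 w0 t0 -exprD.
  rewrite -[X in _ *+ X](card_ord j) -sumr_const; apply: eq_bigr => m _.
  by congr (_ ^+ _); have := ltn_ord m; lia.
have A0 j : A j 0%N = ev (Pc j) b.
  have [|q [q0 hq aq]] := @in_disc_common [:: b].
    by move=> x; rewrite inE => /eqP->.
  have bq : abs b <= q by apply: aq; rewrite inE.
  rewrite /A pscomp_coef0 ?locf0//.
  exact: (reexp_coef0 q0 bq (analytic_cvr (HPc_an j) (ltW q0) hq)).
have -> : Q 0%N = ((charpoly b)^`()).[a i].
  rewrite /Q psDE ps_sumE S0 derivD derivXn hornerD hornerMn hornerXn; congr (_ + _).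
  rewrite linear_sum horner_sum; apply: eq_bigr => j _.
  by rewrite psM0 S0 A0 /= derivZ derivXn hornerZ hornerMn hornerXn.
have fb := fiber_b.
rewrite (charpoly_fiber fb).
have ai : a i \in codom a by exact: codom_f.
have [ucod _ _] := fb.
rewrite (big_rem _ ai)/= derivM derivXsubC mul1r !hornerE subrr mul0r addr0 horner_prod.
rewrite prodf_seq_neq0; apply/allP => z zl /=; rewrite !hornerE subr_eq0.
by apply/eqP => e; move: zl; rewrite -e mem_rem_uniq// inE eqxx.
Qed.

(** The element with coordinates Z on the t^m e_l, read near a_i as an element of M: s becomes f,
    and the powers of t are multiplied out. *)
Definition pull i (Z : 'I_r * 'I_d -> ps k) : 'I_r -> ps k :=
  fun l => \sum_(m < d) loct i ^+ m * pscomp (Z (l, m)) (locf i).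

(** The coordinates of D_s Z at b. *)
Definition Hdefect (Z : 'I_r * 'I_d -> ps k) (y : 'I_r * 'I_d) : ps k :=
  psderiv (Z y) + \sum_(z : 'I_r * 'I_d) (reexp abs (H y z) b : ps k) * Z z.

(** The relation f' D_s = D_t on the basis element t^m' e_c, moved from expansions at 0 to
    expansions at a_i by comparing values. *)
Lemma HH_loc i l c m' :
  psderiv (locf i) * (\sum_(m < d) pscomp (reexp abs (H (l, m) (c, m')) b) (locf i) * loct i ^+ m)
  = (if l == c then loct i ^+ m'.-1 *+ m' else 0) + loct i ^+ m' * reexp abs (G l c) (a i).
Proof.
have cH m : conv_on (pscomp (reexp abs (H (l, m) (c, m')) b) (locf i) * loct i ^+ m) 1.
  apply: conv_onM; first by have [] := analytic_pull i (HH_an (l, m) (c, m')).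
  by apply: conv_on_exp; exact: loct_conv.
have cd : conv_on (psderiv (locf i)) 1 by apply: conv_on_deriv; exact: locf_conv.
have csum := conv_on_sum (index_enum 'I_d) (P := xpredT) (fun j _ => cH j).
have ct m : conv_on (loct i ^+ m) 1 by apply: conv_on_exp; exact: loct_conv.
have [cG eG] := reexp_analytic (HG l c) (in_disc_a i).
have cdelta : conv_on (if l == c then loct i ^+ m'.-1 *+ m' else 0) 1.
  case: ifP => _; last exact: conv_on0.
  by rewrite psMnC; apply: conv_onM => //; exact: conv_onC.
have et m x : abs x < 1 -> ev (loct i ^+ m) x = (x + a i) ^+ m.
  by move=> x1; rewrite (conv_ev_exp m (loct_conv i (T := 1)) x1) ev_loct.
apply: (conv_ev_inj ltr01) => [||x x1].
- exact: conv_onM.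
- by apply: conv_onD => //; exact: conv_onM.
rewrite (conv_evM cd csum x1) (conv_ev_sum _ (fun j _ => cH j) x1).
rewrite (conv_evD cdelta (conv_onM (ct m') cG) x1) (conv_evM (ct m') cG x1) eG// et//.
have hxa := in_disc_add i x1.
have [|q [q0 hq aq]] := @in_disc_common [:: x + a i].
  by move=> y; rewrite inE => /eqP->.
have {}aq : abs (x + a i) <= q by apply: aq; rewrite inE.
have q0' := ltW q0; have cX m : cvr (psX ^+ m) q by apply: cvr_exp => //; exact: cvrX.
have eX m : ev (psX ^+ m) (x + a i) = (x + a i) ^+ m.
  by rewrite (ev_exp m aq (cvrX q0')) evX.
have cc m : cvr (comp_an abs (H (l, m) (c, m')) f) q.
  by have [] := comp_an_ev (HH_an (l, m) (c, m')) q0 hq aq.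
have E : psderiv f * (\sum_(m < d) comp_an abs (H (l, m) (c, m')) f * psX ^+ m)
  = (if l == c then psX ^+ m'.-1 *+ m' else 0) + psX ^+ m' * G l c :> ps k.
  have -> : \sum_(m < d) comp_an abs (H (l, m) (c, m')) f * psX ^+ m =
      (fun n => \sum_(m < d) psmul (comp_an abs (H (l, m) (c, m')) f) (pspow psX m) n) :> ps k.
    by apply/funext=> n; rewrite ps_sumE; apply: eq_bigr => m _; rewrite pspowE.
  apply: etrans (HH c m' l) _; apply: (f_equal2 (@psadd k)); last by rewrite pspowE.
  by case: ifP => // _; apply/funext=> n; rewrite psMnE pspowE.
have := congr1 (fun g => ev g (x + a i)) E.
rewrite (evM aq (cvr_deriv q0 (analytic_cvr Hf_an q0' hq))); last first.
  by apply: cvr_sum => // m _; exact: cvrM.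
rewrite (ev_sum _ aq); last by move=> m _; exact: cvrM.
have cG' := analytic_cvr (HG l c) q0' hq.
rewrite (evD aq (_ : cvr _ q) (cvrM q0' (cX m') cG')); last first.
  case: ifP => _; last exact: cvr0.
  by rewrite psMnC; apply: cvrM => //; exact: cvrC.
rewrite (evM aq (cX m') cG') eX => e.
have -> : ev (psderiv (locf i)) x = ev (psderiv f) (x + a i).
  rewrite /locf psderivD -rmorphN psderivC addr0.
  exact: (ev_deriv_reexp Hf_an (in_disc_a i) x1).
have -> : \sum_(m < d) ev (pscomp (reexp abs (H (l, m) (c, m')) b) (locf i) * loct i ^+ m) x
  = \sum_(m < d) ev (comp_an abs (H (l, m) (c, m')) f * psX ^+ m) (x + a i).
  apply: eq_bigr => m _; have [hc ec] := analytic_pull i (HH_an (l, m) (c, m')).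
  rewrite (conv_evM hc (ct m) x1) et// ec// (evM aq (cc m) (cX m)) eX.
  by have [_ ->] := comp_an_ev (HH_an (l, m) (c, m')) q0 hq aq.
rewrite e; congr (_ + _); case: ifP => _; last by rewrite !ev0.
rewrite !psMnC (evM aq (cvrC _ q0') (cX _)) (conv_evM (conv_onC _ (T := 1)) (ct _) x1).
by rewrite !evC eX et.
Qed.

(** The identity D_t = f' D_s near a_i, from the Leibniz and chain rules and [HH_loc]. *)
Lemma pull_connection i Z l :
  psderiv (pull i Z l) + \sum_c (reexp abs (G l c) (a i) : ps k) * pull i Z c
  = psderiv (locf i) * pull i (Hdefect Z) l.
Proof.
have F0 := locf0 i.
pose Zp (y : 'I_r * 'I_d) := pscomp (Z y) (locf i).
have E1 : psderiv (pull i Z l) =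
  \sum_(m < d) (loct i ^+ m.-1 *+ m) * Zp (l, m)
  + psderiv (locf i) * \sum_(m < d) loct i ^+ m * pscomp (psderiv (Z (l, m))) (locf i).
  rewrite /pull psderiv_sum mulr_sumr -big_split /=; apply: eq_bigr => m _.
  rewrite psderivM psderiv_comp// psderiv_exp; congr (_ + _); last by rewrite mulrCA.
  by rewrite /loct psderivD psderivC psderivX add0r mulr1.
have E2 : psderiv (locf i) * pull i (Hdefect Z) l =
  psderiv (locf i) * (\sum_(m < d) loct i ^+ m * pscomp (psderiv (Z (l, m))) (locf i))
  + \sum_z (psderiv (locf i) * \sum_(m < d) pscomp (reexp abs (H (l, m) z) b) (locf i) * loct i ^+ m) * Zp z.
  rewrite /pull mulr_sumr mulr_sumr.
  transitivity (\sum_(m < d) (psderiv (locf i) * (loct i ^+ m * pscomp (psderiv (Z (l, m))) (locf i))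
     + \sum_z psderiv (locf i) * (pscomp (reexp abs (H (l, m) z) b) (locf i) * loct i ^+ m) * Zp z)).
    apply: eq_bigr => m _; rewrite pscompD mulrDr mulrDr; congr (_ + _).
    rewrite pscomp_sum !mulr_sumr; apply: eq_bigr => z _; rewrite pscompM// -/(Zp z).
    by rewrite -!mulrA; congr (_ * _); rewrite mulrCA.
  rewrite big_split exchange_big; congr (_ + _); apply: eq_bigr => z _.
  by rewrite mulr_sumr mulr_suml.
rewrite E1 E2 [X in X + _]addrC -addrA; congr (_ + _).
transitivity (\sum_(c < r) \sum_(m' < d) psderiv (locf i) *
  (\sum_(m < d) pscomp (reexp abs (H (l, m) (c, m')) b) (locf i) * loct i ^+ m) * Zp (c, m')); last first.
  by rewrite pair_bigA; apply: eq_bigr => -[c m'] _.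
under [RHS]eq_bigr => c _ do under eq_bigr => m' _ do rewrite HH_loc mulrDl.
under [RHS]eq_bigr => c _ do rewrite big_split /=.
rewrite big_split /=; congr (_ + _).
  rewrite [RHS](bigD1 l)//= [X in _ + X]big1 ?addr0 => [|c cl'].
    by apply: eq_bigr => m _; rewrite eqxx.
  by apply: big1 => m _; rewrite eq_sym (negPf cl') mul0r.
apply: eq_bigr => c _; rewrite /pull mulr_sumr; apply: eq_bigr => m' _.
by rewrite mulrCA mulrA.
Qed.

(** Substituting [locf i] is injective since f'(a_i) is nonzero, so each block of X is killed by U;
    then V U = 1. *)
Lemma pull_inj (X : 'I_r * 'I_d -> ps k) : (forall i l, pull i X l = 0) -> forall y : 'I_r * 'I_d, X y = 0.
Proof.
move=> h [l m].
have hU i : \sum_(m' < d) u i ^+ m' * X (l, m') = 0.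
  apply: (pscomp_inj0 (locf0 i) (locf1_neq0 i)); rewrite -[RHS](h i l) pscomp_sum.
  by apply: eq_bigr => m' _; rewrite pscompM ?locf0// pscompX_exp ?locf0// u_locf.
have -> : X (l, m) = \sum_(m' < d) (\sum_(j < d) V m j * u j ^+ m') * X (l, m').
  rewrite (bigD1 m)//= [X in _ + X]big1 ?addr0 => [|m' m'm].
    have -> : \sum_(j < d) V m j * u j ^+ m = psC (m == m)%:R.
      by apply/funext=> n; rewrite ps_sumE -(HVU m m n); apply: eq_bigr => j _; rewrite pspowE.
    by rewrite eqxx rmorph1 mul1r.
  have -> : \sum_(j < d) V m j * u j ^+ m' = psC (m == m')%:R.
    by apply/funext=> n; rewrite ps_sumE -(HVU m m' n); apply: eq_bigr => j _; rewrite pspowE.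
  by rewrite eq_sym (negPf m'm) rmorph0 mul0r.
under eq_bigr => m' _ do rewrite mulr_suml.
rewrite exchange_big big1// => j _.
under eq_bigr => m' _ do rewrite -mulrA.
by rewrite -mulr_sumr hU mulr0.
Qed.

(** Pulling back amounts to applying U and substituting [locf i]; here U V = 1 is used. *)
Lemma pull_Vr_mul i l (v : 'I_r * 'I_d -> ps k) :
  pull i (Vr_mul V v) l = pscomp (v (l, i)) (locf i).
Proof.
have F0 := locf0 i.
rewrite /pull; transitivity (pscomp (\sum_(m < d) u i ^+ m * (Vr_mul V v (l, m) : ps k)) (locf i)).
  rewrite pscomp_sum; apply: eq_bigr => m _.
  by rewrite pscompM// pscompX_exp// u_locf.
congr (pscomp _ _).
have E m : (Vr_mul V v (l, m) : ps k) = \sum_(j < d) V m j * v (l, j).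
  by apply/funext=> n; rewrite ps_sumE.
under eq_bigr => m _ do rewrite E mulr_sumr.
rewrite exchange_big /= (bigD1 i)//= [X in _ + X]big1 ?addr0 => [|j ji].
  under eq_bigr => m _ do rewrite mulrA.
  rewrite -mulr_suml; have -> : \sum_(m < d) u i ^+ m * V m i = psC (i == i)%:R.
    by apply/funext=> n; rewrite ps_sumE -(HUV i i n); apply: eq_bigr => m _; rewrite pspowE.
  by rewrite eqxx rmorph1 mul1r.
under eq_bigr => m _ do rewrite mulrA.
rewrite -mulr_suml; have -> : \sum_(m < d) u i ^+ m * V m j = psC (i == j)%:R.
  by apply/funext=> n; rewrite ps_sumE -(HUV i j n); apply: eq_bigr => m _; rewrite pspowE.
by rewrite eq_sym (negPf ji) rmorph0 mul0r.
Qed.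

Lemma pull_vvec i (y : ps k) : pscomp (pscomp y (psadd (u i) (psC (- a i)))) (locf i) = y :> ps k.
Proof.
have h0 : (u i + psC (- a i)) 0%N = 0 by rewrite psDE Hu0 /psC /= subrr.
rewrite pscompA// ?locf0//; have -> : pscomp (psadd (u i) (psC (- a i))) (locf i) = psX.
  change (pscomp (u i + psC (- a i)) (locf i) = psX).
  by rewrite pscompD u_locf pscompC ?locf0// /loct rmorphN addrAC subrr add0r.
apply/funext=> n; rewrite (pscompE _ _ (ltnSn n)) -?(ps_head_tail n.+1 y)//.
rewrite {2}(ps_head_tail n.+1 y) psDE /pstail ltnS leqnn addr0.
by [].
Qed.


(** * Polynomials in t, their coordinates over s, and convergence on the image disc *)

Definition psP (Q : {poly k}) : ps k := fun n => Q`_n.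
Lemma psPE (Q : {poly k}) : psP Q = \sum_(m < size Q) psC Q`_m * psX ^+ m.
Proof.
rewrite {1}(ps_head_tail (size Q) (psP Q)) -[RHS]addr0; congr (_ + _).
apply/funext=> n; rewrite /pstail ps0E; case: ltnP => // h; exact: nth_default.
Qed.
Lemma cvr_psP Q s : 0 <= s -> cvr (psP Q) s.
Proof. by move=> s0; rewrite psPE; apply: cvr_sum => // m _; exact: cvr_monomial. Qed.
Lemma ev_psP Q x : ev (psP Q) x = Q.[x].
Proof.
rewrite psPE (ev_sum _ (lexx (abs x))); last by move=> m _; exact: cvr_monomial.
by rewrite horner_coef; apply: eq_bigr => m _; rewrite ev_monomial.
Qed.
Lemma pscomp_psP (Q : {poly k}) (h : ps k) : h 0%N = 0 -> pscomp (psP Q) h = (map_poly (@psC k) Q).[h].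
Proof.
move=> h0; rewrite psPE pscomp_sum.
rewrite (@horner_coef_wide _ (size Q)); last exact: size_poly.
by apply: eq_bigr => m _; rewrite pscomp_monomial// coef_map.
Qed.
Lemma horner_u (Q : {poly k}) i : (map_poly (@psC k) Q).[u i]
  = pscomp (psP (Q \Po ('X + (a i)%:P))) (psadd (u i) (psC (- a i))).
Proof.
rewrite pscomp_psP; last by rewrite /psadd Hu0 /psC /= subrr.
rewrite map_comp_poly horner_comp rmorphD /= map_polyX map_polyC /= hornerD hornerX hornerC.
congr (_.[_]); change (u i = u i + psC (- a i) + psC (a i)).
by rewrite rmorphN subrK.
Qed.

(* Reduction of Q(t) modulo P(s, t). *)
Lemma poly_reduce (Q : {poly k}) : exists w : 'I_d -> ps k,
  [/\ forall j, conv_on (w j) 1,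
      forall i, \sum_(j < d) w j * u i ^+ j = (map_poly (@psC k) Q).[u i] &
      forall x, in_disc abs cl x -> abs (ev f x - b) < 1 ->
        \sum_(j < d) ev (w j) (ev f x - b) * x ^+ j = Q.[x]].
Proof.
elim/poly_ind: Q => [|Q c [w [w1 wu wx]]].
  exists (fun=> 0); split=> [j|i|x _ _]; first exact: conv_on0.
    by rewrite rmorph0 horner0 big1// => j _; rewrite mul0r.
  by rewrite horner0 big1// => j _; rewrite ev0 mul0r.
pose Pb j : ps k := reexp abs (Pc j) b.
have cP j : conv_on (Pb j) 1 by have [] := reexp_analytic (HPc_an j) Hb.
have cif (e : bool) j : conv_on (if e then psC c else w j) 1.
  by case: e => //; exact: conv_onC.
exists (red_step Pb w (psC c)); split=> [j|i|x hx fx1].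
- by apply: conv_onD => //; apply: conv_onN; exact: conv_onM.
- rewrite red_stepE// ?wu.
    by rewrite rmorphD rmorphM /= map_polyX map_polyC /= hornerD hornerM hornerX hornerC mulrC.
  apply/funext=> n; rewrite psDE ps_sumE -[RHS](HuP i n) !pspowE; congr (_ + _).
  by apply: eq_bigr => j _; rewrite pspowE.
have eP j : ev (Pb j) (ev f x - b) = ev (Pc j) (ev f x).
  by have [_ ->] := reexp_analytic (HPc_an j) Hb; rewrite ?subrK.
transitivity (\sum_(j < d) red_step (fun j => ev (Pc j) (ev f x)) (fun j => ev (w j) (ev f x - b)) c j * x ^+ j).
  apply: eq_bigr => j _; congr (_ * _).
  rewrite /red_step (conv_evD (cif _ _) (conv_onN (conv_onM (cP j) (w1 _))) fx1).
  rewrite (conv_evN (conv_onM (cP j) (w1 _)) fx1) (conv_evM (cP j) (w1 _) fx1) eP.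
  by congr (_ - _); case: ifP => _ //; rewrite evC.
rewrite red_stepE//; last exact: charpoly_root.
by rewrite wx// hornerD hornerM hornerX hornerC mulrC.
Qed.

(** If |x| exceeds every |a_j|, then |f(x) - b| = |x|^d. So the tube lies in a closed disc of
    admissible radius, where [deriv_lower] applies. *)
Lemma tube_radius s : s < 1 -> exists q, [/\ 0 < q, radius_in cl q &
  forall x, in_disc abs cl x -> abs (ev f x - b) <= s -> abs x <= q].
Proof.
move=> s1; have [|q [q0 hq aq]] := @in_disc_common (codom a).
  by move=> _ /codomP[i ->].
have [e [e1 _ e0 e2]] := abs_root_near1 d.-1 s1; rewrite prednK// in e1.
exists (Num.max q (abs e)); split; first by rewrite lt_max q0.
  by apply: radius_in_max => //; exact: radius_in_lt.
move=> x hx fx; rewrite leNgt gt_max; apply/negP => /andP[qx ex].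
move: fx; rewrite dist_b// leNgt => /negP; apply; apply: lt_le_trans e1 _.
rewrite -[_ ^+ d](_ : \prod_(j < d) abs e = _); last by rewrite prodr_const card_ord.
apply: ler_prod => j _; rewrite abs_ge0/= -(absN (x - a j)) opprB addrC.
have aj : abs (a j) < abs (- x).
  by rewrite absN; apply: le_lt_trans qx; apply: aq; exact: codom_f.
by rewrite (abs_dom aj) absN ltW.
Qed.

(** The values of the w_j at y are the coefficients of the polynomial of degree less than d
    interpolating Q on the fibre of y + b. The denominators are at least |f'|, so C depends on the
    tube only, not on Q. *)
Lemma reduce_bound (c : k) : 0 < abs c -> abs c < 1 -> exists2 C, 0 <= C &
  forall (w : 'I_d -> ps k) (Q : {poly k}) B, (forall j, conv_on (w j) 1) ->
    (forall x, in_disc abs cl x -> abs (ev f x - b) < 1 ->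
        \sum_(j < d) ev (w j) (ev f x - b) * x ^+ j = Q.[x]) -> 0 <= B ->
    (forall x, in_disc abs cl x -> abs (ev f x - b) <= abs c -> abs Q.[x] <= B) ->
    forall j, gle (w j) (abs c) (B * C).
Proof.
move=> c0 c1; have [q [q0 hq tq]] := tube_radius c1.
have [m m0 hm] := deriv_lower q0 hq.
exists m^-1 => [|w Q B w1 wx B0 hB j]; first by rewrite invr_ge0 ltW.
have cc : c != 0 by rewrite -abs_gt0.
apply: (gauss_le cc).
- by rewrite mulr_ge0// invr_ge0 ltW.
- exact: (conv_on_cvr (w1 j)).
move=> y yc; have hy : in_disc abs cl (y + b).
  apply: (in_disc_sub Hb (lexx 1)); rewrite addrK; exact: le_lt_trans c1.
have [l hl] := Hf_deg hy; have fl : is_fiber (y + b) l by [].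
have [ul sl hl'] := hl.
have zc z : z \in l -> in_disc abs cl z /\ ev f z - b = y.
  by move=> /hl'[hz ->]; rewrite addrK.
apply: (lagrange_bound (w := fun j => ev (w j) y) ul sl) => // z zl.
- by apply: in_disc_le1; have [] := zc z zl.
- apply: le_trans (deriv_fiber hy fl zl).
  by apply: hm; apply: tq; have [hz e] := zc z zl; rewrite ?e.
- have [hz e] := zc z zl; have := wx z hz; rewrite e => ->.
    by apply: hB => //; rewrite e.
  exact: le_lt_trans c1.
Qed.

(** A formal estimate: finitely many coefficients of D, v and powers of h enter, however small the
    radii of v and h may be. *)
Lemma coef_continuous (v h : ps k) (t : R) (m : nat) : 0 < t -> exists2 K, 0 <= K &
  forall (D : ps k) e, gle D t e -> abs ((v * pscomp D h) m) <= K * e.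
Proof.
move=> t0.
have tri I (l : seq I) (P : pred I) (F : I -> k) :
    abs (\sum_(i <- l | P i) F i) <= \sum_(i <- l | P i) abs (F i).
  apply: (big_ind2 (fun x s => abs x <= s)) => //; first by rewrite abs0.
  move=> x1 s1 x2 s2 h1 h2; apply: le_trans (abs_addr _ _) _.
  have := abs_ge0 x1; have := abs_ge0 x2; rewrite ge_max; lra.
exists (\sum_(i < m.+1) \sum_(l < (m - i).+1) abs (v i) * (abs ((h ^+ l) (m - i)%N) / t ^+ l)).
  apply: sumr_ge0 => i _; apply: sumr_ge0 => l _.
  by rewrite mulr_ge0// divr_ge0// exprn_ge0// ltW.
move=> D e hD; rewrite psME; apply: le_trans (tri _ _ _ _) _.
rewrite mulr_suml; apply: ler_sum => i _.
rewrite absM /pscomp mulr_suml; apply: le_trans (ler_wpM2l (abs_ge0 _) (tri _ _ _ _)) _.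
rewrite mulr_sumr; apply: ler_sum => l _; rewrite pspowE absM -mulrA ler_wpM2l//.
rewrite mulrC -mulrA ler_wpM2l// -ler_pdivrMl ?invr_gt0 ?exprn_gt0// invrK mulrC.
exact: hD.
Qed.

(** Boundedness at a radius c > s gives convergence at s by comparison with the powers of s/c. *)
Lemma conv_on_bounded (g : ps k) S :
  (forall s, 0 <= s -> s < S -> exists c B, s < c /\ gle g c B) -> conv_on g S.
Proof.
move=> h; apply/conv_onP => s /andP[s0 sS].
have [c [B [sc hB]]] := h s s0 sS; have c0 := le_lt_trans s0 sc.
have B0 := gle_ge0 (ltW c0) hB.
have : 0 <= s / c < 1 by rewrite divr_ge0 ?(ltW c0)//= ltr_pdivrMr// mul1r.
move=> /rnull_geom /(rnullM B0); apply: rnull_le => n.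
rewrite expr_div_n mulrA ler_pdivlMr ?exprn_gt0// mulrAC; apply: ler_wpM2r; first exact: exprn_ge0.
exact: hB.
Qed.

(* e |-> e^2 (3 - 2 e) doubles the contact order with 0 and with 1. *)
Fixpoint idem_iter (q : {poly k}) n : {poly k} :=
  if n is n'.+1 then idem_iter q n' ^+ 2 * (3%:R - idem_iter q n' *+ 2) else q.

Lemma idem_iterS q n x : (idem_iter q n.+1).[x] =
  (idem_iter q n).[x] ^+ 2 * (3%:R - 2%:R * (idem_iter q n).[x]).
Proof. by rewrite /= hornerM horner_exp hornerD hornerN !hornerMn hornerC mulr_natl. Qed.

Lemma idem_iter_to0 q x t n : 0 <= t -> t < 1 -> abs q.[x] <= t -> abs (idem_iter q n).[x] <= t ^+ n.+1.
Proof.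
move=> t0 t1 h; elim: n => [|n IH]; first by rewrite expr1.
have le1 : abs (idem_iter q n).[x] <= 1 by apply: le_trans IH _; rewrite exprn_ile1// ltW.
rewrite idem_iterS absM absX.
apply: le_trans (_ : (t ^+ n.+1) ^+ 2 * 1 <= _).
  apply: ler_pM => //; [exact: exprn_ge0|by rewrite lerXn2r// nnegrE// exprn_ge0|].
  apply: abs_sub_le; first exact: (abs_nat 3).
  by rewrite absM mulr_ile1// (abs_nat 2).
rewrite mulr1 -exprM; apply: ler_wiXn2l; rewrite ?(ltW t1)//; lia.
Qed.

Lemma idem_iter_to1 q x t n : 0 <= t -> t < 1 -> abs (q.[x] - 1) <= t ->
  abs ((idem_iter q n).[x] - 1) <= t ^+ n.+1.
Proof.
move=> t0 t1 h; elim: n => [|n IH]; first by rewrite expr1.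
have le1 : abs ((idem_iter q n).[x] - 1) <= 1 by apply: le_trans IH _; rewrite exprn_ile1// ltW.
set e := (idem_iter q n).[x] in IH le1 *.
have -> : (idem_iter q n.+1).[x] - 1 = - ((e - 1) ^+ 2 * (1 + e *+ 2)).
  by rewrite idem_iterS -/e; ring.
have el : abs e <= 1 by rewrite -(subrK 1 e) abs_add_le ?abs1.
rewrite absN absM absX; apply: le_trans (_ : (t ^+ n.+1) ^+ 2 * 1 <= _).
  apply: ler_pM => //; [exact: exprn_ge0|by rewrite lerXn2r// nnegrE// exprn_ge0|].
  apply: abs_add_le; first by rewrite abs1.
  exact: le_trans (absMn_le _ _) el.
rewrite mulr1 -exprM; apply: ler_wiXn2l; rewrite ?(ltW t1)//; lia.
Qed.

(* Take for q the product of the (t - a_j) / (a_i - a_j) over the a_j outside D(a_i, T^-). *)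
Lemma approx_indicator i T (c : k) : 0 < T -> T <= 1 -> abs c < image_radius (a i) T ->
  exists T' t (q : {poly k}), [/\ 0 < T', T' < T, 0 <= t & t < 1] /\
    forall x, in_disc abs cl x -> abs (ev f x - b) <= abs c ->
      (abs (x - a i) < T -> abs (x - a i) <= T' /\ abs (q.[x] - 1) <= t) /\
      (T <= abs (x - a i) -> abs q.[x] <= t).
Proof.
move=> T0 T1 cT; have [T1' [T1'0 T1'T hT1']] := image_radius_shrink T0 cT.
pose inU j := abs (a j - a i) < T.
(* T' is still below T, but reaches every a_j of the disc, and its image radius still exceeds |c|:
   the part of the tube in D(a_i, T^-) lies in the closed disc of radius T'. *)
pose T' := \big[Num.max/T1']_(j < d | inU j) abs (a j - a i).
have T'T : T' < T by exact: bigmax_lt.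
have T1T' : T1' <= T'.
  by exact: bigmax_ge_id.
have inT' j : inU j -> abs (a j - a i) <= T'.
  move=> hj; exact: (le_bigmax_cond _ (fun j => abs (a j - a i)) hj).
have T'0 : 0 < T' by exact: lt_le_trans T1T'.
have cT' : abs c < image_radius (a i) T'.
  by apply: lt_le_trans hT1' _; apply: image_radius_le => //; exact: ltW.
have ir0 := image_radius_gt0 (a i) T0.
(* The first ratio bounds the deviation of each factor of q from 1 inside; the second bounds |q|
   outside. *)
pose t := Num.max (T' / T) (abs c / image_radius (a i) T).
pose q : {poly k} := \prod_(j < d | ~~ inU j) (1 + (a i - a j)^-1 *: ('X - (a i)%:P)).
have out j : ~~ inU j -> T <= abs (a i - a j) by rewrite /inU absB leNgt.
have outn0 j : ~~ inU j -> a i - a j != 0.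
  by move=> /out h; rewrite -abs_gt0; exact: lt_le_trans h.
have qx x : q.[x] = \prod_(j < d | ~~ inU j) (1 + (x - a i) / (a i - a j)).
  by rewrite horner_prod; apply: eq_bigr => j _; rewrite !hornerE mulrC.
have t0 : 0 <= t by rewrite le_max divr_ge0// ltW.
exists T', t, q; split; first split=> //.
  by rewrite gt_max !ltr_pdivrMr// !mul1r T'T cT.
move=> x hx fx; split=> hxT.
  have xT' : abs (x - a i) <= T'.
    have [i1 [near e]] := dist_b_nearest hx.
    have i1T : abs (a i1 - a i) <= T'.
      apply: inT'; rewrite /inU; apply: (abs_tri_lt (y := x)) => //.
      by rewrite absB; exact: le_lt_trans (near i) hxT.
    apply: (abs_tri_le (y := a i1)) => //; rewrite leNgt; apply/negP => h.
    move: fx; rewrite e leNgt => /negP; apply; apply: lt_le_trans cT' _.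
    rewrite -(image_radius_center i1T); apply: image_radius_le; exact: ltW.
  split=> //; rewrite qx.
  apply: (big_ind (fun z => abs (z - 1) <= t)).
  - by rewrite subrr abs0.
  - move=> z1 z2 h1 h2; have -> : z1 * z2 - 1 = (z1 - 1) * (z2 - 1) + (z1 - 1) + (z2 - 1) by ring.
    apply: abs_add_le => //; apply: abs_add_le => //.
    rewrite absM -[X in _ <= X]mulr1 ler_pM//; apply: le_trans h2 _.
    by rewrite ge_max !ler_pdivrMr// !mul1r (ltW T'T) (ltW cT).
  - move=> j /out oj; rewrite addrAC subrr add0r absM absV le_max; apply/orP; left.
    apply: ler_pM => //; first by rewrite invr_ge0.
    by rewrite lef_pV2// posrE ?(lt_le_trans T0 oj).
have -> : abs q.[x] = \prod_(j < d | ~~ inU j) abs (x - a j) / \prod_(j < d | ~~ inU j) abs (a i - a j).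
  rewrite qx abs_prod -prodf_div; apply: eq_bigr => j oj.
  rewrite -absV -absM; congr (abs _); have := outn0 j oj => n0.
  by field.
rewrite le_max; apply/orP; right.
have P0 : 0 < \prod_(j < d | ~~ inU j) abs (a i - a j).
  by apply: prodr_gt0 => j oj; rewrite abs_gt0 outn0.
have Q0 : 0 < \prod_(j < d | inU j) T by apply: prodr_gt0.
have -> : image_radius (a i) T = \prod_(j < d | inU j) T * \prod_(j < d | ~~ inU j) abs (a i - a j).
  rewrite /image_radius (bigID inU)/=; congr (_ * _); apply: eq_bigr => j oj.
    by apply: max_l; rewrite absB ltW.
  by apply: max_r; exact: out.
rewrite ler_pdivrMr// invfM mulrA divfK ?lt0r_neq0// ler_pdivlMr//.
(* Outside the disc each a_j of the disc is at distance at least T from x; what is left of |f(x) -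
   b| <= |c| bounds the product over the remaining a_j. *)
apply: le_trans fx; rewrite dist_b// [X in _ <= X](bigID inU)/= [X in X <= _]mulrC.
apply: ler_wpM2r; first exact: prodr_ge0.
apply: ler_prod => j hj; rewrite (ltW T0)/=.
by rewrite (abs_iso (y := a i)) // absB; exact: lt_le_trans hj hxT.
Qed.

(* The sum is the coefficientwise limit of the coordinates of polynomials approximating y on
   D(a_i, T^-) and 0 elsewhere in the tube |f - b| <= |c|; these coordinates are uniformly
   bounded by interpolation on the fibres of f. *)
Lemma lower_bound_conv i T (y : ps k) m : 0 < T -> T <= 1 -> conv_on y T ->
  conv_on (\sum_(j < d) V m j * (if abs (a j - a i) < T then
     pscomp (reexp abs y (a j - a i)) (psadd (u j) (psC (- a j))) else 0))
   (image_radius (a i) T).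
Proof.
move=> T0 T1 hy; set W := \sum_(j < d) _.
apply: conv_on_bounded => s s0 sT.
have ir1 : image_radius (a i) T <= 1.
  exact: le_trans (image_radius_le_id i (ltW T0) T1) T1.
have [c sc cT] := abs_dense s0 sT ir1.
have c0 := le_lt_trans s0 sc; have c1 := lt_le_trans cT ir1.
have [T' [t [q [[T'0 T'T t0 t1] hq]]]] := approx_indicator T0 T1 cT.
have [C C0 hC] := reduce_bound c0 c1.
have cy : cvr y T' by exact: (conv_on_cvr hy (ltW T'0)).
have [B B0 hB] := cvr_gle cy.
have approx e : 0 < e -> exists Q : {poly k}, forall x, in_disc abs cl x -> abs (ev f x - b) <= abs c ->
    (abs (x - a i) < T -> abs (Q.[x] - ev y (x - a i)) <= e) /\
    (T <= abs (x - a i) -> abs Q.[x] <= e).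
  move=> e0; have [N hN] := gle_tail e0 cy.
  pose Q0 : {poly k} := \sum_(l < N) y l *: ('X - (a i)%:P) ^+ l.
  have Q0x x : Q0.[x] = \sum_(l < N) y l * (x - a i) ^+ l.
    by rewrite horner_sum; apply: eq_bigr => l _; rewrite !hornerE.
  pose M := \sum_(l < N) abs (y l).
  have M0 : 0 <= M by apply: sumr_ge0.
  have Q0M x : in_disc abs cl x -> abs Q0.[x] <= M.
    move=> hx; rewrite Q0x; apply: abs_sum_le => // l _.
    apply: le_trans (_ : abs (y l) <= _); last first.
      by rewrite /M (bigD1 l)//= lerDl sumr_ge0.
    rewrite absM absX ler_piMr// exprn_ile1//.
    by apply: abs_sub_le; exact: in_disc_le1.
  have Q0y x : abs (x - a i) <= T' -> abs (Q0.[x] - ev y (x - a i)) <= e.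
    move=> xT'; have -> : ev y (x - a i) = Q0.[x] + ev (pstail N y) (x - a i).
      rewrite {1}(ps_head_tail N y) (evD xT' _ (cvr_tail N (ltW T'0) cy)); last first.
        by apply: cvr_sum => [|l _]; [exact: ltW|exact: (cvr_monomial _ _ (ltW T'0))].
      congr (_ + _); rewrite (ev_sum _ xT'); last first.
        by move=> l _; exact: (cvr_monomial _ _ (ltW T'0)).
      by rewrite Q0x; apply: eq_bigr => l _; rewrite ev_monomial.
    rewrite opprD addrA subrr add0r absN.
    exact: (ev_gle xT' (cvr_tail N (ltW T'0) cy)).
  have t01 : 0 <= t < 1 by rewrite t0.
  (* M bounds the truncation Q0 on the whole unit disc, so n steps of the iteration with M t^(n+1)
     <= e suffice on both sides. *)
  have [n hn] := rnullM M0 (rnull_geom t01) e0; have {}hn := hn n.+1 (leqnSn n).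
  exists (Q0 * idem_iter q n) => x hx fx; have [qin qout] := hq x hx fx; split=> hxT.
    have [xT' q1] := qin hxT; rewrite hornerM.
    have -> : Q0.[x] * (idem_iter q n).[x] - ev y (x - a i)
      = Q0.[x] * ((idem_iter q n).[x] - 1) + (Q0.[x] - ev y (x - a i)) by ring.
    apply: abs_add_le; last exact: Q0y.
    rewrite absM; apply: le_trans hn; apply: ler_pM => //; first exact: Q0M.
    exact: idem_iter_to1.
  rewrite hornerM absM; apply: le_trans hn; apply: ler_pM => //; first exact: Q0M.
  by apply: idem_iter_to0 => //; exact: qout.
(* B bounds y on the inner part of the tube and 1 covers the approximation error, at most 1. The
   bound is the same for all approximants, so it passes to the limit at each coefficient n. *)
exists (abs c), (Num.max B 1 * C); split=> // n.
apply: le_eps => [e e0|]; last by rewrite mulr_ge0// le_max B0.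
have [z z0] : exists2 z, 0 < abs z & abs z < Num.min (abs c) T.
  by apply: abs_dense => //; rewrite ?lt_min ?c0// ge_min T1 orbT.
rewrite lt_min => /andP[zc zT]; have zn0 : z != 0 by rewrite -abs_gt0.
pose hu j : ps k := psadd (u j) (psC (- a j)).
have /choice[K hK] : forall j, exists K, 0 <= K /\ forall (D : ps k) e, gle D (abs z) e ->
    abs ((V m j * pscomp D (hu j)) n) <= K * e.
  move=> j.
  by have [Kj Kj0 hj] := coef_continuous (V m j) (hu j) n z0; exists Kj.
pose KK := \sum_(j < d) K j.
have KK0 : 0 <= KK by apply: sumr_ge0 => j _; have [] := hK j.
have KK1 : 0 < KK + 1 by rewrite ltr_wpDl.
pose eps := Num.min 1 (e / (KK + 1)).
have eps0 : 0 < eps by rewrite lt_min ltr01 divr_gt0.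
have [Q hQ] := approx eps eps0.
have [w [w1 wu wx]] := poly_reduce Q.
have QB x : in_disc abs cl x -> abs (ev f x - b) <= abs c -> abs Q.[x] <= Num.max B 1.
  move=> hx fx; have [Qin Qout] := hQ x hx fx.
  have eps1 : eps <= Num.max B 1.
    by apply: (@le_trans _ _ 1); [rewrite /eps ge_min lexx|rewrite le_max lexx orbT].
  have [xT|/Qout h] := ltP (abs (x - a i)) T; last exact: le_trans h eps1.
  rewrite -(subrK (ev y (x - a i)) Q.[x]); apply: abs_add_le.
    exact: le_trans (Qin xT) eps1.
  have [xT' _] := (hq x hx fx).1 xT.
  by apply: le_trans (ev_gle xT' cy hB) _; rewrite le_max lexx.
have MB0 : 0 <= Num.max B 1 by rewrite le_max B0.
have hw := hC w Q _ w1 wx MB0 QB m.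
(* The approximation error expanded at a_j. As |z| is below |c| and T, the disc of radius |z| around
   a_j stays in the tube and on one side of the boundary of D(a_i, T^-). *)
pose D j : ps k := (if abs (a j - a i) < T then reexp abs y (a j - a i) else 0)
                    - psP (Q \Po ('X + (a j)%:P)).
have hD j : gle (D j) (abs z) eps.
  have cif : cvr (if abs (a j - a i) < T then reexp abs y (a j - a i) else 0) (abs z).
    case: ifP => ajT; last exact: cvr0.
    by have [h _] := reexp_conv hy ajT; exact: (conv_on_cvr h).
  have cP' : cvr (psP (Q \Po ('X + (a j)%:P))) (abs z) by exact: cvr_psP.
  apply: (gauss_le zn0 (ltW eps0)) => [|x xz].
    by apply: cvrD => //; exact: cvrN.
  rewrite (evB xz cif cP') ev_psP horner_comp !hornerE.
  have x1 : abs x < 1 by apply: le_lt_trans xz _; exact: lt_trans c1.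
  have hx : in_disc abs cl (x + a j).
    by apply: (in_disc_sub (in_disc_a j) (lexx 1)); rewrite addrK.
  have fx : abs (ev f (x + a j) - b) <= abs c.
    rewrite dist_b// (bigD1 j)//= addrK; apply: le_trans (_ : abs x * 1 <= _).
      rewrite ler_wpM2l//; apply: prodr_ile1 => l _; rewrite abs_ge0/=.
      by apply: abs_sub_le; exact: in_disc_le1.
    by rewrite mulr1 (le_trans xz)// ltW.
  have [Qin Qout] := hQ _ hx fx; rewrite (absB _ Q.[_]).
  have xT := le_lt_trans xz zT.
  case: ifP => ajT.
    have [_ ->//] := reexp_conv hy ajT; rewrite addrA; apply: Qin.
    by rewrite -addrA; exact: abs_add_lt.
  rewrite ev0 subr0; apply: Qout; rewrite leNgt; apply/negP => h.
  move/negP: ajT; apply; apply: (abs_tri_lt (y := x + a j)) => //.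
  by rewrite opprD addrCA subrr addr0 absN.
(* The coordinates w are recovered from the series Q(u_j) by V U = 1, just as W is formed from the
   branches of y. *)
have EW : W - w m = \sum_(j < d) V m j * pscomp (D j) (hu j).
  have -> : w m = \sum_(j < d) V m j * (map_poly (@psC k) Q).[u j].
    under eq_bigr => j _ do rewrite -wu mulr_sumr.
    rewrite exchange_big (bigD1 m)//= [X in _ + X]big1 ?addr0 => [|j jm].
      under eq_bigr => i0 _ do rewrite mulrCA.
      rewrite -mulr_sumr; have -> : \sum_(i0 < d) V m i0 * u i0 ^+ m = psC (m == m)%:R.
        by apply/funext=> n0; rewrite ps_sumE -(HVU m m n0); apply: eq_bigr => i0 _; rewrite pspowE.
      by rewrite eqxx rmorph1 mulr1.
    under eq_bigr => i0 _ do rewrite mulrCA.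
    rewrite -mulr_sumr; have -> : \sum_(i0 < d) V m i0 * u i0 ^+ j = psC (m == j)%:R.
      by apply/funext=> n0; rewrite ps_sumE -(HVU m j n0); apply: eq_bigr => i0 _; rewrite pspowE.
    by rewrite eq_sym (negPf jm) rmorph0 mulr0.
  rewrite /W -sumrN -big_split /=; apply: eq_bigr => j _.
  rewrite -mulrBr; congr (_ * _); rewrite /D pscompD pscompN horner_u; congr (_ - _).
  by case: ifP => // _; rewrite pscomp0.
have -> : W n = (W - w m) n + w m n by rewrite psBE subrK.
have lt1 : abs ((W - w m) n) <= e.
  rewrite EW ps_sumE; apply: abs_sum_le => [|j _]; first exact: ltW.
  have [Kj0 hKj] := hK j; apply: le_trans (hKj _ _ (hD j)) _.
  apply: le_trans (_ : KK * (e / (KK + 1)) <= _).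
    apply: ler_pM => //; [exact: ltW| |by rewrite ge_min lexx orbT].
    by rewrite /KK (bigD1 j)//= lerDl sumr_ge0// => l _; have [] := hK l.
  by rewrite mulrCA ger_pMr// ler_pdivrMr// mul1r lerDl.
apply: le_trans (ler_wpM2r (exprn_ge0 n (ltW c0)) (abs_addr _ _)) _.
rewrite maxr_pMl ?exprn_ge0 ?(ltW c0)// ge_max !le_max hw/= andbT; apply/orP; right.
rewrite -[X in _ <= X]mulr1; apply: ler_pM => //; first exact/exprn_ge0/ltW.
by rewrite exprn_ile1// ltW.
Qed.


(** * Linked bases, the family of discs and coordinates on it *)

Variable Y : 'I_d -> 'I_r -> 'I_r -> ps k.
Hypotheses (HYopt : forall i, optimal_basis abs G (a i) (Y i))
  (HYlink : forall (i j : 'I_d) (l : 'I_r), abs (a j - a i) < vrad abs (Y i l) ->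
      exists m, forall c, reexp abs (Y i l c) (a j - a i) = Y j m c).
Variable reps : seq ('I_d * 'I_r).
Hypotheses (Hreps1 : forall x : 'I_d * 'I_r, exists2 y : 'I_d * 'I_r, y \in reps & same_pair abs a Y y x)
  (Hreps2 : forall y y' : 'I_d * 'I_r, y \in reps -> y' \in reps -> same_pair abs a Y y y' -> y = y').
Variable fam : seq (('I_d * 'I_r) * (k * R)).
Definition UP (Q : 'I_d * 'I_r) := [seq X.2 | X <- fam & X.1 == Q].
Hypotheses (Hfam1 : forall x : ('I_d * 'I_r) * (k * R), x \in fam -> x.1 \in reps)
  (Hfam2 : forall Q, Q \in reps -> valid_UP abs cl a (a Q.1, vrad abs (Y Q.1 Q.2)) (UP Q)).
Implicit Types (i j : 'I_d) (l m : 'I_r) (P Q : 'I_d * 'I_r) (X : ('I_d * 'I_r) * (k * R)).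

Local Notation same_pair := (same_pair abs a Y).
Let rho P := vrad abs (Y P.1 P.2).

Lemma image_radius_in i j T : abs (a j - a i) <= T -> image_radius (a j) T = image_radius (a i) T.
Proof. exact: image_radius_center. Qed.

Lemma pull_sum I (s : seq I) (c : I -> k) (Z : I -> 'I_r * 'I_d -> ps k) i l :
  pull i (fun w => \sum_(n <- s) psC (c n) * Z n w) l = \sum_(n <- s) psC (c n) * pull i (Z n) l.
Proof.
rewrite /pull; under eq_bigr => m _ do rewrite pscomp_sum mulr_sumr.
rewrite exchange_big; apply: eq_bigr => n _; rewrite mulr_sumr; apply: eq_bigr => m _.
by rewrite pscompM// pscompC// mulrCA.
Qed.

Lemma pull_sub (Z Z' : 'I_r * 'I_d -> ps k) i l :
  pull i (fun w => Z w - Z' w) l = pull i Z l - pull i Z' l.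
Proof.
rewrite /pull -sumrB; apply: eq_bigr => m _.
by rewrite pscompD pscompN mulrBr.
Qed.

Lemma pull_ev (Z : 'I_r * 'I_d -> ps k) i l S T : (forall w, conv_on (Z w) S) -> 0 < T -> T <= 1 ->
  image_radius (a i) T <= S -> conv_on (pull i Z l) T /\
  forall x, abs x < T ->
    ev (pull i Z l) x = \sum_(m < d) (x + a i) ^+ m * ev (Z (l, m)) (ev f (x + a i) - b).
Proof.
move=> hZ T0 T1 hT.
have c1 (m : nat) : conv_on (loct i ^+ m) T by apply: conv_on_exp; exact: loct_conv.
have c2 (m : 'I_d) := pull_conv (hZ (l, m)) T0 T1 hT.
have c3 (m : 'I_d) : conv_on (loct i ^+ m * pscomp (Z (l, m)) (locf i)) T.
  by apply: conv_onM => //; have [] := c2 m.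
split=> [|x xT]; first by apply: conv_on_sum => m _; exact: c3.
rewrite /pull (conv_ev_sum _ (fun (m : 'I_d) _ => c3 m) xT); apply: eq_bigr => m _.
have [h e] := c2 m; rewrite (conv_evM (c1 m) h xT) e//.
by rewrite (conv_ev_exp m (loct_conv i (T := T)) xT) ev_loct.
Qed.

(** Both pull-backs expand one function, the value of Z at f(t), on D(a_i, T^-). *)
Lemma pull_recenter (Z : 'I_r * 'I_d -> ps k) i j l S T : (forall w, conv_on (Z w) S) ->
  0 < T -> T <= 1 -> image_radius (a i) T <= S -> abs (a j - a i) < T ->
  reexp abs (pull i Z l) (a j - a i) = pull j Z l :> ps k.
Proof.
move=> hZ T0 T1 hT ij; have [ci ei] := pull_ev l hZ T0 T1 hT.
have [cj ej] : conv_on (pull j Z l) T /\ forall x, abs x < T ->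
    ev (pull j Z l) x = \sum_(m < d) (x + a j) ^+ m * ev (Z (l, m)) (ev f (x + a j) - b).
  by apply: pull_ev hZ T0 T1 _; rewrite (image_radius_in (ltW ij)).
have [cr er] := reexp_conv ci ij; apply: (conv_ev_inj T0 cr cj) => x xT.
rewrite er// ej// ei; last exact: abs_add_lt.
by have -> : x + (a j - a i) + a i = x + a j by ring.
Qed.

Let horY i m : horizontal abs G (a i) (Y i m). Proof. by case: (HYopt i). Qed.
Let rho_gt0 P : 0 < rho P. Proof. exact: (horizontal_vrad (horY P.1 P.2)). Qed.
Let rho_le1 P : rho P <= 1. Proof. exact: vrad_le1. Qed.
Let convY P l : conv_on (Y P.1 P.2 l) (rho P). Proof. exact: (vrad_conv l (rho_gt0 P)). Qed.

Lemma Y_indep i (lam : 'I_r -> k) :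
  (forall l, \sum_m psC (lam m) * Y i m l = 0 :> ps k) -> forall m, lam m = 0.
Proof.
case: (HYopt i) => _ ind _ _ h; apply: ind => l n.
by have := congr1 (fun g : ps k => g n) (h l); rewrite ps_sumE; under eq_bigr => m _ do rewrite psCM.
Qed.

Lemma Y_coord_inj i (lam mu : 'I_r -> k) :
  (forall l, \sum_m psC (lam m) * Y i m l = \sum_m psC (mu m) * Y i m l :> ps k) -> lam =1 mu.
Proof.
move=> h m; apply/eqP; rewrite -subr_eq0; apply/eqP; move: m; apply: (@Y_indep i) => l.
under eq_bigr => m _ do rewrite rmorphB mulrBl.
by rewrite sumrB h subrr.
Qed.

Lemma Y_inj i m m' : (forall l, Y i m l = Y i m' l) -> m = m'.
Proof.
move=> h; have delta m1 l : \sum_m2 psC ((m2 == m1)%:R) * Y i m2 l = Y i m1 l :> ps k.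
  rewrite (bigD1 m1)//= eqxx rmorph1 mul1r big1 ?addr0// => m2 /negPf->.
  by rewrite rmorph0 mul0r.
have /(_ m) : (fun m2 => (m2 == m)%:R : k) =1 (fun m2 => (m2 == m')%:R).
  by apply: (@Y_coord_inj i) => l; rewrite !delta h.
by rewrite eqxx; case: eqP => // _ /eqP; rewrite oner_eq0.
Qed.

Lemma same_pair_sym P Q : same_pair P Q -> same_pair Q P.
Proof.
move=> [e [h1 h2]]; split; first by [].
rewrite -e absB; split=> // c; rewrite -h2.
by rewrite (reexp_reexp (@convY P c) h1) ?(absB (a P.1))// subrKA subrr (reexp0 (rho_gt0 P)).
Qed.

Lemma same_pair_trans P Q Q' : same_pair P Q -> same_pair Q Q' -> same_pair P Q'.
Proof.
move=> [e [h1 h2]] [e' [h1' h2']]; split; first by rewrite e.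
rewrite -e in h1'; split; first exact: abs_tri_lt h1' h1.
by move=> c; rewrite -h2' -h2 (reexp_reexp (@convY P c) h1 h1') subrKA.
Qed.

Lemma link_pair P i : abs (a i - a P.1) < rho P -> exists m, same_pair P (i, m).
Proof.
move=> h; have [m hm] := HYlink h; exists m; split=> //=.
rewrite -(vrad_reexp (rho_gt0 P) h); congr (vrad abs _).
by apply/funext => c; rewrite hm.
Qed.

Lemma same_pair_uniq P i m m' : same_pair P (i, m) -> same_pair P (i, m') -> m = m'.
Proof.
by move=> [_ [_ h]] [_ [_ h']]; apply: (@Y_inj i) => l; have := h l; have := h' l => /= <- <-.
Qed.

(* the representative of the fundamental pair of Y P.1 P.2 *)
Definition prep P := s2val (cid2 (Hreps1 P)).
Lemma prepP P : prep P \in reps /\ same_pair (prep P) P.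
Proof. by rewrite /prep; case: cid2. Qed.

Lemma prep_eq P Q : P \in reps -> same_pair P Q -> prep Q = P.
Proof.
move=> hP hPQ; have [h1 h2] := prepP Q; apply/esym/Hreps2 => //.
exact: same_pair_trans hPQ (same_pair_sym h2).
Qed.

Lemma prep_same P Q : same_pair P Q -> prep P = prep Q.
Proof.
move=> h; have [h1 h2] := prepP P; apply/esym/prep_eq => //; exact: same_pair_trans h2 h.
Qed.

(** Existence is the linking of the bases; uniqueness holds because the members of [Y i] are
    pairwise distinct. *)
Lemma mem_prep P i : P \in reps -> abs (a i - a P.1) < rho P ->
  exists2 m, same_pair P (i, m) & forall m', (prep (i, m') == P) = (m' == m).
Proof.
move=> hP h; have [m hm] := link_pair h; exists m => // m'.
apply/eqP/eqP => [e|->]; last exact: prep_eq.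
by apply: same_pair_uniq hm; rewrite -e; have [] := prepP (i, m').
Qed.

Let valid P (hP : P \in reps) : valid_UP abs cl a (a P.1, rho P) (UP P) := Hfam2 hP.

Lemma mem_UP X : (X \in fam) = (X.2 \in UP X.1).
Proof.
apply/idP/mapP => [XF|[X']]; first by exists X; rewrite ?mem_filter ?eqxx.
rewrite mem_filter => /andP[/eqP e X'F]; case: X X' e X'F => [P U] [P' U'] /= -> h ->.
by [].
Qed.

Lemma fam_uniq : uniq fam.
Proof.
apply: count_mem_uniq => X; have [XF|XF] := boolP (X \in fam); last by apply/count_memPn.
have ur := uniq_L (rho_gt0 X.1) (valid (Hfam1 XF)).
have := count_uniq_mem X.2 ur; rewrite -mem_UP XF /UP count_map count_filter => <-.
by apply: eq_count => -[P U] /=; case: X {XF ur} => P' U' /=; rewrite xpair_eqE andbC.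
Qed.

(* The coordinate of a combination of the family on the solution Y i m at a_i. *)
Definition coord (c : ('I_d * 'I_r) * (k * R) -> k) i m :=
  \sum_(U <- UP (prep (i, m))) c (prep (i, m), U) * (inD a U i)%:R.

Let W X := Vr_mul V (vvec abs a u Y X.1 X.2).

Lemma pull_W X i l : pull i (W X) l =
  if inD a X.2 i then reexp abs (Y X.1.1 X.1.2 l) (a i - a X.1.1) else 0.
Proof.
rewrite /W pull_Vr_mul.
rewrite /vvec /= -/(inD a X.2 i); case: ifP => _; last exact: pscomp0.
exact: pull_vvec.
Qed.

Lemma inD_rho X i : X \in fam -> inD a X.2 i -> abs (a i - a X.1.1) < rho X.1.
Proof.
move=> XF hi; have XL : X.2 \in UP X.1 by rewrite -mem_UP.
exact: (inD_top (valid (Hfam1 XF)) XL hi).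
Qed.

Lemma pull_W_coord X i l : X \in fam ->
  pull i (W X) l = \sum_m psC (((prep (i, m) == X.1) && inD a X.2 i)%:R) * Y i m l.
Proof.
move=> XF; rewrite pull_W; have [hi|hi] := boolP (inD a X.2 i); last first.
  by rewrite big1// => m _; rewrite andbF rmorph0 mul0r.
have [m [_ [_ hm]] um] := mem_prep (Hfam1 XF) (inD_rho XF hi).
rewrite (bigD1 m)//= um eqxx rmorph1 mul1r big1 ?addr0// => m' m'm.
by rewrite um (negPf m'm) rmorph0 mul0r.
Qed.

Lemma pull_comb c i l : pull i (fun w => \sum_(X <- fam) psC (c X) * W X w) l =
  \sum_m psC (coord c i m) * Y i m l.
Proof.
rewrite pull_sum big_seq; under eq_bigr => X XF do rewrite pull_W_coord// mulr_sumr.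
rewrite -big_seq exchange_big; apply: eq_bigr => m _.
rewrite /coord rmorph_sum mulr_suml big_map big_filter [RHS]big_mkcond; apply: eq_bigr => -[P U] _ /=.
rewrite eq_sym; case: eqP => [->|_]; first by rewrite rmorphM mulrA.
by rewrite rmorph0 mul0r mulr0.
Qed.

Lemma coord_prep c P i m : P \in reps -> same_pair P (i, m) ->
  coord c i m = \sum_(U <- UP P) c (P, U) * (inD a U i)%:R.
Proof. by move=> hP h; rewrite /coord (prep_eq hP h). Qed.

Lemma coord_ball0 c P : P \in reps -> (forall i m, same_pair P (i, m) -> coord c i m = 0) ->
  forall U, U \in UP P -> c (P, U) = 0.
Proof.
move=> hP h U UU; apply: (tree_indep Ha_inj (rho_le1 P) (rho_gt0 P) (valid hP) (c := fun U => c (P, U))) UU.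
move=> j hj; have [m hm _] := mem_prep hP hj.
by rewrite -(coord_prep c hP hm); exact: h.
Qed.

Lemma coord_inj0 c : (forall i m, coord c i m = 0) -> forall X, X \in fam -> c X = 0.
Proof.
move=> h X XF; rewrite [X]surjective_pairing; apply: (coord_ball0 (Hfam1 XF)) => //.
by rewrite -mem_UP.
Qed.

Lemma coord_surj (lam : 'I_d -> 'I_r -> k) : exists c, forall i m, coord c i m = lam i m.
Proof.
(* Distinct representatives P concern disjoint sets of indices (j, m), so each tree is solved
   separately. The sum over m has a single term for j in the ball; it avoids naming that m. *)
have /choice[c hc] P : exists c, P \in reps -> forall j, in_ball a (rho P) P.1 j ->
    \sum_(U <- UP P) c U * (inD a U j)%:R = \sum_(m | prep (j, m) == P) lam j m.
  have [hP|_] := boolP (P \in reps); last by exists (fun=> 0).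
  have [c hc] := tree_basis Ha_inj (rho_le1 P) (rho_gt0 P) (valid hP)
    (fun j => \sum_(m | prep (j, m) == P) lam j m).
  by exists c.
exists (fun X => c X.1 X.2) => i m; rewrite /coord /=; have [hP hm] := prepP (i, m).
have hi : abs (a i - a (prep (i, m)).1) < rho (prep (i, m)) by case: hm => _ [].
rewrite hc//; have [m' _ um] := mem_prep hP hi.
rewrite (big_pred1 m)// => m2; rewrite um.
by have := um m; rewrite eqxx => /esym/eqP <-.
Qed.

(** [coord] is linear and bijective from coefficients on [fam] to coordinates indexed by (m, i). A
    strict inequality either way would produce, by [lin_dep], a dependency contradicting injectivity
    or surjectivity. *)
Lemma size_fam : size fam = #|{: 'I_r * 'I_d}|.
Proof.
pose X n := tnth (in_tuple fam) n.
apply/eqP; rewrite eqn_leq; apply/andP; split; rewrite leqNgt; apply/negP => lt.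
  have [mu [n0 /eqP mu0] hmu] := lin_dep (fun n (w : 'I_#|{: 'I_r * 'I_d}|) =>
    let z := enum_val w in ((prep (z.2, z.1) == (X n).1) && inD a (X n).2 z.2)%:R : k) lt.
  apply: mu0; pose c Z := \sum_(n | X n == Z) mu n.
  have cX n : c (X n) = mu n.
    rewrite /c (big_pred1 n)// => n' /=; rewrite /X !(tnth_nth (X n)) /= nth_uniq ?fam_uniq//.
  rewrite -cX; apply: (@coord_inj0 c); last exact: mem_tnth.
  move=> i m; have := hmu (enum_rank (m, i)); rewrite enum_rankK /= => h.
  rewrite -[RHS]h /coord big_map big_filter big_mkcond big_tnth; apply: eq_bigr => n _.
  rewrite -/(X n) -cX eq_sym; case: eqP => [->|_]; last by rewrite mulr0.
  by rewrite -surjective_pairing.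
have /choice[cc hcc] (z : 'I_r * 'I_d) : exists c, forall i m, coord c i m = ((m, i) == z)%:R.
  exact: coord_surj.
have [mu [n0 /eqP mu0] hmu] := lin_dep (fun (w : 'I_#|{: 'I_r * 'I_d}|) n => cc (enum_val w) (X n)) lt.
apply: mu0; pose c Z := \sum_w mu w * cc (enum_val w) Z.
have c0 Z : Z \in fam -> c Z = 0.
  by move=> /(@tnthP _ _ (in_tuple fam)) [n ->]; exact: hmu.
have cz : coord c (enum_val n0).2 (enum_val n0).1 = 0.
  rewrite /coord big_seq big1// => U UU; rewrite c0 ?mul0r// mem_UP.
  exact: UU.
have lin i m : coord c i m = \sum_w mu w * coord (cc (enum_val w)) i m.
  rewrite /coord /c; under eq_bigr => U _ do rewrite mulr_suml.
  rewrite exchange_big; apply: eq_bigr => w _.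
  by rewrite mulr_sumr; apply: eq_bigr => U _; rewrite mulrA.
rewrite -[RHS]cz lin (bigD1 n0)//= hcc -surjective_pairing eqxx mulr1.
rewrite [X in _ + X]big1 ?addr0// => n nn0; rewrite hcc -surjective_pairing.
by rewrite (inj_eq enum_val_inj) eq_sym (negPf nn0) mulr0.
Qed.

(** * The family as an optimal basis *)

Lemma horizontalP (I : finType) (A : I -> I -> ps k) (e : k) (Z : I -> ps k) T : 0 < T ->
  (forall c, conv_on (Z c) T) ->
  (forall c, psderiv (Z c) + \sum_c' (reexp abs (A c c') e : ps k) * Z c' = 0) ->
  horizontal abs A e Z.
Proof.
move=> T0 hc h; split; first by exists T.
move=> c n; have := congr1 (fun g : ps k => g n) (h c).
by rewrite psDE ps_sumE.
Qed.

Lemma horizontalE (I : finType) (A : I -> I -> ps k) (e : k) (Z : I -> ps k) :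
  horizontal abs A e Z ->
  forall c, psderiv (Z c) + \sum_c' (reexp abs (A c c') e : ps k) * Z c' = 0.
Proof. by move=> [_ h] c; apply/funext => n; rewrite psDE ps_sumE; exact: h. Qed.

Lemma pull_horizontal i Z : horizontal abs H b Z -> horizontal abs G (a i) (pull i Z).
Proof.
move=> hZ; have [[S [S0 hS]] _] := hZ; have m0 : 0 < Num.min S 1 by rewrite lt_min S0 ltr01.
have m1 : Num.min S 1 <= 1 by rewrite ge_min lexx orbT.
apply: (horizontalP m0) => l.
  have [] // := pull_ev (i := i) l hS m0 m1.
  by apply: le_trans (image_radius_le_id i (ltW m0) m1) _; rewrite ge_min lexx.
rewrite pull_connection.
suff -> : pull i (Hdefect Z) l = 0 by rewrite mulr0.
rewrite /pull big1// => m _; have -> : Hdefect Z (l, m) = 0 by exact: horizontalE.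
by rewrite pscomp0 mulr0.
Qed.

(** Expand every pull-back of Z on [Y i], realise these coordinates by [coord_surj], and conclude by
    [pull_inj]. *)
Lemma comb_spans Z : horizontal abs H b Z ->
  exists c, forall w, Z w = \sum_(X <- fam) psC (c X) * W X w.
Proof.
move=> hZ; have /choice[lam hlam] i : exists lam : 'I_r -> k, forall l, pull i Z l = \sum_m psC (lam m) * Y i m l.
  have [_ _ sp _] := HYopt i; have [lam h] := sp _ (pull_horizontal i hZ).
  exists lam => l; apply/funext => n; rewrite h ps_sumE; by apply: eq_bigr => m _; rewrite psCM.
have [c hc] := coord_surj lam; exists c => w; apply/eqP; rewrite -subr_eq0; apply/eqP; move: w.
apply: pull_inj => i l.
rewrite pull_sub pull_comb hlam; under [X in _ - X]eq_bigr => m _ do rewrite hc.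
by rewrite subrr.
Qed.

Lemma fam_disc X : X \in fam -> exists i,
  [/\ inD a X.2 i, 0 < X.2.2, X.2.2 <= rho X.1 & image_radius X.2.1 X.2.2 = image_radius (a i) X.2.2].
Proof.
move=> XF; have XL : X.2 \in UP X.1 by rewrite -mem_UP.
have [i [hi x0 xr]] : exists i, [/\ inD a X.2 i, 0 < X.2.2 & X.2.2 <= rho X.1].
  have [/andP[/= /eqP e xi]|[c [x0 /ltW xT _ _ [[j hj] _]]]] := mem_L_cases (valid (Hfam1 XF)) XL.
    by exists X.1.1; rewrite /inD e absB lexx -e; split=> //; rewrite e; exact: rho_gt0.
  by exists j.
by exists i; split=> //; apply/esym/image_radius_center; rewrite ltW.
Qed.

Lemma W_conv X w : X \in fam -> conv_on (W X w) (image_radius X.2.1 X.2.2).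
Proof.
move=> XF; have [i [hi x0 xr ->]] := fam_disc XF.
have hir := inD_rho XF hi; case: w => l m.
have hy : conv_on (reexp abs (Y X.1.1 X.1.2 l) (a i - a X.1.1)) X.2.2.
  by apply: (conv_on_le xr); have [] := reexp_conv (@convY X.1 l) hir.
have := lower_bound_conv
  (i := i) m x0 (le_trans xr (rho_le1 _)) hy.
congr conv_on; apply/funext => n; rewrite ps_sumE /W /Vr_mul; apply: eq_bigr => j _.
congr (psmul _ _ n); rewrite /vvec /= -/(inD a X.2 j) (inD_ball j hi) /in_ball.
case: ifP => // hj; rewrite (reexp_reexp (@convY X.1 l) hir); last exact: lt_le_trans xr.
by rewrite subrKA.
Qed.

(** Checked after pull-back, where D_t annihilates either 0 or a member of [Y i], and the factor f'
    cancels. *)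
Lemma W_horizontal X : X \in fam -> horizontal abs H b (W X).
Proof.
move=> XF; have [i0 [_ x0 _ _]] := fam_disc XF.
apply: (horizontalP (image_radius_gt0 X.2.1 x0)) => [w|]; first exact: W_conv.
apply: pull_inj => i l.
apply: (ps_mulr_eq0 (g := psderiv (locf i))).
  by rewrite /psderiv mulr1n; exact: locf1_neq0.
rewrite mulrC -[LHS](pull_connection).
have [hi|hi] := boolP (inD a X.2 i); last first.
  rewrite pull_W (negPf hi) (_ : psderiv 0 = 0) ?add0r; last first.
    by apply/funext => n; rewrite /psderiv mul0rn.
  by apply: big1 => c _; rewrite pull_W (negPf hi) mulr0.
have [m [_ [_ hm]] _] := mem_prep (Hfam1 XF) (inD_rho XF hi).
have E l' : pull i (W X) l' = Y i m l' by rewrite pull_W hi hm.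
rewrite E; under eq_bigr => c _ do rewrite E.
exact: (horizontalE (horY i m)).
Qed.

(* If a solution with c X <> 0 converged beyond the image of the disc X.2, its pull-back would
   converge on a disc larger than X.2; the coordinates of the pull-back on the
   solutions attached to X.1 would then vanish or be constant around X.2. *)
Lemma comb_filtered Z c T X : horizontal abs H b Z ->
  (forall w, Z w = \sum_(X <- fam) psC (c X) * W X w) -> 0 < T -> T <= 1 ->
  (forall w, conv_on (Z w) T) -> X \in fam -> c X != 0 -> T <= image_radius X.2.1 X.2.2.
Proof.
move=> hZ hc T0 T1 cZ XF cX; have [i [hi x0 xr ->]] := fam_disc XF.
have x1 := le_trans xr (rho_le1 X.1).
rewrite leNgt; apply/negP => lt; move/eqP: cX; apply.
have xlt1 : X.2.2 < 1.
  rewrite lt_neqAle x1 andbT; apply/eqP => e; move: lt; rewrite e.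
  rewrite image_radius1; first by rewrite ltNge T1.
  by have [] := Ha i.
(* The disc of radius S around a_i strictly contains that of X, while its image still lies where Z
   converges. *)
have [S [xS S1 hS]] := image_radius_grow x0 xlt1 lt.
have S0 := lt_trans x0 xS.
have eZ j l : pull j Z l = \sum_m psC (coord c j m) * Y j m l.
  have -> : Z = (fun w => \sum_(X <- fam) psC (c X) * W X w) by apply/funext.
  exact: pull_comb.
have big j m : image_radius (a j) S <= T -> coord c j m != 0 -> S <= vrad abs (Y j m).
  move=> hj; apply: (optimal_filtered (HYopt j) (pull_horizontal j hZ) _ S0 S1).
    by move=> l n; rewrite eZ ps_sumE; apply: eq_bigr => m' _; rewrite psCM.
  by move=> l; have [] := pull_ev l cZ S0 S1 hj.
have XL : X.2 \in UP X.1 by rewrite -mem_UP.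
have hP := Hfam1 XF; have hir := inD_rho XF hi.
(* Beyond the disc of the pair no solution attached to it converges, so by [big] its coordinates
   vanish at all the a_j concerned. *)
have [rS|Sr] := ltP (rho X.1) S.
  rewrite [X]surjective_pairing; apply: (coord_ball0 hP) XL => j m hm.
  apply/eqP; apply: contraT => cj; have [e [hj _]] := hm.
  have : S <= vrad abs (Y j m).
    apply: big cj; rewrite -(image_radius_in (i := j) (j := i)) //.
    apply: ltW; apply: lt_trans rS; apply: abs_tri_lt hir _.
    by rewrite absB.
  by rewrite leNgt; case/negP; move: e => /= <-.
have [m hm um] := mem_prep hP hir.
(* Every solution occurring at a_i converges up to S, hence by linking is a member of the basis at
   a_j; recentring the pull-back from a_i to a_j carries its coordinates along. *)
have const j : in_ball a S i j -> coord c j =1 (fun m' => \sum_m0 coord c i m0 * (prep (j, m') == prep (i, m0))%:R).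
  move=> hj; apply: (@Y_coord_inj j) => l; rewrite -eZ -(pull_recenter l cZ S0 S1 hS hj).
  under [RHS]eq_bigr => m' _ do rewrite rmorph_sum mulr_suml.
  rewrite exchange_big /= eZ.
  (* A zero coordinate is treated apart, since the corresponding solution may fail to converge on
     the disc of radius S. *)
  have cterm m0 : conv_on (psC (coord c i m0) * Y i m0 l) S /\
     reexp abs (psC (coord c i m0) * Y i m0 l) (a j - a i) =
     \sum_m' psC (coord c i m0 * (prep (j, m') == prep (i, m0))%:R) * Y j m' l.
    have [->|cn] := eqVneq (coord c i m0) 0.
      rewrite rmorph0 mul0r; split; first exact: conv_on0.
      rewrite big1 => [|m' _]; last by rewrite mul0r rmorph0 mul0r.
      have [h1 h2] := reexp_conv (conv_on0 (T := S)) hj.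
      by apply: (conv_ev_inj S0 h1 (conv_on0 (T := S))) => x xS'; rewrite h2// !ev0.
    have Sm := big i m0 hS cn; have hj' : abs (a j - a (i, m0).1) < rho (i, m0) by exact: lt_le_trans Sm.
    have cY : conv_on (Y i m0 l) S by exact: (conv_on_le Sm (@convY (i, m0) l)).
    have cc : conv_on (psC (coord c i m0) * Y i m0 l) S by apply: conv_onM => //; exact: conv_onC.
    split=> //; have [m1 h1] := link_pair hj'; have [_ [_ e1]] := h1.
    rewrite (bigD1 m1)//= (prep_same h1) eqxx mulr1 big1 ?addr0 => [|m' m'm1].
      rewrite -e1 /=; have [d1 e2] := reexp_conv cc hj; have [d3 e3] := reexp_conv cY hj.
      have d4 := conv_onC (coord c i m0) (T := S).
      apply: (conv_ev_inj S0 d1); first exact: conv_onM.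
      move=> x xS'; rewrite e2// (conv_evM d4 d3 xS') e3// (conv_evM d4 cY); last exact: abs_add_lt.
      by rewrite !evC.
    case: eqP => [e|_]; last by rewrite mulr0 rmorph0 mul0r.
    rewrite -(prep_same h1) in e.
    case/eqP: m'm1; apply: (@same_pair_uniq (prep (i, m0)) j).
      by rewrite -e; have [] := prepP (j, m').
    by apply: same_pair_trans h1; have [] := prepP (i, m0).
  have cs := conv_on_sum (index_enum 'I_r) (P := xpredT) (fun m0 _ => (cterm m0).1).
  have [h1 h2] := reexp_conv cs hj.
  have hr m0 : conv_on (reexp abs (psC (coord c i m0) * Y i m0 l) (a j - a i)) S.
    by have [] := reexp_conv (cterm m0).1 hj.
  have cs' := conv_on_sum (index_enum 'I_r) (P := xpredT) (fun m0 _ => hr m0).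
  transitivity (\sum_m0 (reexp abs (psC (coord c i m0) * Y i m0 l) (a j - a i) : ps k)).
    apply: (conv_ev_inj S0 h1 cs') => x xS'; rewrite h2//.
    rewrite (conv_ev_sum _ (fun m0 _ => (cterm m0).1) (abs_add_lt xS' hj)).
    rewrite (conv_ev_sum _ (fun m0 _ => hr m0) xS'); apply: eq_bigr => m0 _.
    by have [_ ->] := reexp_conv (cterm m0).1 hj.
  by apply: eq_bigr => m0 _; rewrite (cterm m0).2.
rewrite [X]surjective_pairing.
have tc := tree_const Ha_inj (rho_le1 X.1) (rho_gt0 X.1) (valid hP) (c := fun U => c (X.1, U)) Sr S0 hir.
apply: tc XL xS hi => j hj.
have hjr : abs (a j - a X.1.1) < rho X.1 by apply: abs_tri_lt hir; exact: lt_le_trans Sr.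
have [mj hmj umj] := mem_prep hP hjr.
rewrite -(coord_prep c hP hmj) -(coord_prep c hP hm) (const j hj).
have pj := prep_eq hP hmj.
rewrite (bigD1 m)//= pj (prep_eq hP hm) eqxx mulr1 big1 ?addr0// => m0 m0m.
by rewrite eq_sym um (negPf m0m) mulr0.
Qed.

(** One inequality is [W_conv]; the other is [comb_filtered] for the combination reduced to [W X],
    with T its own radius. *)
Lemma vrad_W X : X \in fam -> vrad abs (W X) = image_radius X.2.1 X.2.2.
Proof.
move=> XF; have [i [_ x0 xr e]] := fam_disc XF; have s0 := image_radius_gt0 X.2.1 x0.
have x1 := le_trans xr (rho_le1 X.1).
have s1 : image_radius X.2.1 X.2.2 <= 1.
  by rewrite e; apply: le_trans (x1); exact: (image_radius_le_id i (ltW x0) x1).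
have ge : image_radius X.2.1 X.2.2 <= vrad abs (W X).
  by apply/(vrad_geP _ s0 s1) => w; exact: W_conv.
apply/eqP; rewrite eq_le ge andbT; have v0 := lt_le_trans s0 ge.
apply: (@comb_filtered (W X) (fun X' => (X' == X)%:R)) => //.
- exact: W_horizontal.
- move=> w; rewrite (bigD1_seq X) ?fam_uniq//= eqxx rmorph1 mul1r big1 ?addr0// => X' /negPf->.
  by rewrite rmorph0 mul0r.
- exact: vrad_le1.
- by move=> w; exact: vrad_conv.
- by rewrite eqxx oner_neq0.
Qed.

Lemma W_image X : X \in fam -> exists sg : R, image_disc abs f b X.2 sg /\ vrad abs (W X) = sg.
Proof.
move=> XF; have [i [hi x0 xr e]] := fam_disc XF; exists (image_radius X.2.1 X.2.2).
split; last exact: vrad_W.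
have x1 := le_trans xr (rho_le1 X.1); have hi' : abs (X.2.1 - a i) < X.2.2 by rewrite absB.
rewrite [X in image_disc _ _ _ X _]surjective_pairing.
apply: (image_discP _ x0 x1 hi').
by have [hai _] := Ha i; exact: (in_disc_sub hai x1 hi').
Qed.

Lemma W_optimal : optimal_basis abs H b (fun n : 'I_(size fam) => W (tnth (in_tuple fam) n)).
Proof.
pose X n := tnth (in_tuple fam) n.
have XF n : X n \in fam by exact: mem_tnth.
(* Passes from coefficients indexed by positions to coefficients on members; the sum has one term
   because [fam] has no repetition. *)
pose cof (mu : 'I_(size fam) -> k) Z := \sum_(n | X n == Z) mu n.
have cofX mu n : cof mu (X n) = mu n.
  by rewrite /cof (big_pred1 n)// => n' /=; rewrite /X !(tnth_nth (X n)) /= nth_uniq ?fam_uniq.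
have combE mu w : \sum_(Z <- fam) psC (cof mu Z) * W Z w = \sum_n psC (mu n) * W (X n) w :> ps k.
  by rewrite big_tnth; apply: eq_bigr => n _; rewrite -/(X n) cofX.
have psE mu w n : \sum_m mu m * W (X m) w n = (\sum_(Z <- fam) psC (cof mu Z) * W Z w : ps k) n.
  by rewrite combE ps_sumE; apply: eq_bigr => m _; rewrite psCM.
apply: filtered_optimal.
- exact: size_fam.
- by move=> n; exact: W_horizontal.
- move=> mu hmu n; rewrite -cofX; apply: (@coord_inj0 (cof mu)) => // i m.
  move: m; apply: (@Y_indep i) => l; rewrite -pull_comb.
  rewrite /pull big1// => m _; rewrite (_ : \sum_(_ <- _) _ = 0) ?pscomp0 ?mulr0//.
  by apply/funext => n'; rewrite -psE; exact: hmu.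
- move=> Z hZ; have [c hc] := comb_spans hZ; exists (fun n => c (X n)) => w n.
  by rewrite hc big_tnth ps_sumE; apply: eq_bigr => m _; rewrite psCM.
- move=> Z mu T hZ hc T0 T1 cZ n mun; rewrite vrad_W//.
  apply: (@comb_filtered Z (cof mu)) => //; last by rewrite cofX.
  by move=> w; apply/funext => n'; rewrite hc psE.
Qed.


End Cover.

End NonArchimedean.

Theorem theorem4p11
  (R : realType) (k : closedFieldType) (abs : k -> R) (p : nat)
  (Habs : nonarch_complete_abs abs p)
  (cl : bool) (d : nat) (f : ps k)
  (* phi : D_t -> D_s, s = f(t), finite etale of degree d *)
  (Hf_an : analytic abs cl f)
  (Hf_disc : forall x, in_disc abs cl x -> in_disc abs cl (evalps abs f x))
  (Hf_etale : exists g, analytic abs cl g /\ psmul (psderiv f) g = psC 1)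
  (Hf_deg : forall y, in_disc abs cl y -> exists s : seq k,
       [/\ uniq s, size s = d &
           forall x, (in_disc abs cl x /\ evalps abs f x = y) <-> x \in s])
  (* P(s,X) = X^d + sum_{j<d} Pc j (s) X^j, with P(f(t), t) = 0 *)
  (Pc : 'I_d -> ps k) (HPc_an : forall j, analytic abs cl (Pc j))
  (HP : forall n, \sum_(j < d) psmul (comp_an abs (Pc j) f) (pspow psX j) n
                  + pspow psX d n = 0)
  (* the fibre over b *)
  (b : k) (Hb : in_disc abs cl b)
  (a : 'I_d -> k) (Ha_inj : injective a)
  (Ha : forall i, in_disc abs cl (a i) /\ evalps abs f (a i) = b)
  (* u_{a_i}(s) in k[[s-b]] *)
  (u : 'I_d -> ps k) (Hu0 : forall i, u i 0%N = a i)
  (HuP : forall i n, \sum_(j < d) psmul (reexp abs (Pc j) b) (pspow (u i) j) n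
                     + pspow (u i) d n = 0)
  (* V = U^{-1}, U i j = u_{a_i}^j *)
  (V : 'I_d -> 'I_d -> ps k)
  (HVU : forall (i i' : 'I_d) n, \sum_(j < d) psmul (V i j) (pspow (u j) i') n
                        = psC ((i == i')%:R) n)
  (HUV : forall (i i' : 'I_d) n, \sum_(j < d) psmul (pspow (u i) j) (V j i') n
                        = psC ((i == i')%:R) n)
  (* the differential module (M, D_t) of rank r, matrix G in the basis e_1..e_r *)
  (r : nat) (G : 'I_r -> 'I_r -> ps k) (HG : forall i j, analytic abs cl (G i j))
  (* its direct image (M_phi, D_s): matrix H in the basis t^l e_j ~ (j, l) *)
  (H : 'I_r * 'I_d -> 'I_r * 'I_d -> ps k) (HH_an : forall x y, analytic abs cl (H x y))
  (HH : forall (j : 'I_r) (l : 'I_d) (i : 'I_r),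
      psmul (psderiv f)
        (fun n => \sum_(m < d) psmul (comp_an abs (H (i, m) (j, l)) f) (pspow psX m) n)
      = psadd (if i == j then (fun n => pspow psX l.-1 n *+ l) else (fun=> 0))
              (psmul (pspow psX l) (G i j)))
  (* optimal, ordered, linked bases Y i j = Y_{a_i, j} *)
  (Y : 'I_d -> 'I_r -> 'I_r -> ps k)
  (HYopt : forall i, optimal_basis abs G (a i) (Y i))
  (HYord : forall i (j j' : 'I_r), (j <= j')%N -> vrad abs (Y i j) <= vrad abs (Y i j'))
  (HYlink : forall (i j : 'I_d) (l : 'I_r), abs (a j - a i) < vrad abs (Y i l) ->
      exists m, forall c, reexp abs (Y i l c) (a j - a i) = Y j m c)
  (* representatives of the distinct fundamental pairs *)
  (reps : seq ('I_d * 'I_r))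
  (Hreps1 : forall x, exists2 y, y \in reps & same_pair abs a Y y x)
  (Hreps2 : forall y y', y \in reps -> y' \in reps -> same_pair abs a Y y y' -> y = y')
  (* the family {(P, U) : P in reps, U in U_P} *)
  (fam : seq (('I_d * 'I_r) * (k * R)))
  (Hfam1 : forall x, x \in fam -> x.1 \in reps)
  (Hfam2 : forall P, P \in reps ->
      valid_UP abs cl a (a P.1, vrad abs (Y P.1 P.2))
               [seq x.2 | x <- fam & x.1 == P]) :
  let W := fun x : ('I_d * 'I_r) * (k * R) => Vr_mul V (vvec abs a u Y x.1 x.2) in
  (forall x, x \in fam ->
     horizontal abs H b (W x) /\
     exists sg : R, image_disc abs f b x.2 sg /\ vrad abs (W x) = sg) /\
  optimal_basis abs H b (fun n : 'I_(size fam) => W (tnth (in_tuple fam) n)).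
Proof.
move=> W; split=> [X XF|].
  split.
    exact: (W_horizontal Habs Hf_an Hf_disc Hf_etale Hf_deg HPc_an HP Hb Ha_inj Ha Hu0 HuP HVU HUV
      HG HH_an HH HYopt HYlink Hreps1 Hreps2 Hfam1 Hfam2).
  exact: (W_image Habs Hf_an Hf_disc Hf_etale Hf_deg HPc_an HP Hb Ha_inj Ha Hu0 HuP HVU HUV
    HG HH_an HH HYopt HYlink Hreps1 Hreps2 Hfam1 Hfam2).
exact: (W_optimal Habs Hf_an Hf_disc Hf_etale Hf_deg HPc_an HP Hb Ha_inj Ha Hu0 HuP HVU HUV
  HG HH_an HH HYopt HYlink Hreps1 Hreps2 Hfam1 Hfam2).
Qed.
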